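(* Let $V$ be a vertex operator algebra over $\mathbb{F}$, $n\ge0$, and $U$ an $A_n(V)$-module which does not factor through $A_{n-1}(V)$. Then there exists a $V$-module $M_n(U)=\bigoplus_{m\ge0}M_n(U)(m)$ with $M_n(U)(0)\ne0$, generated (as a $V$-module) by $M_n(U)(n)$, with $M_n(U)(n)\cong U$ as $A_n(V)$-modules, satisfying the universal property: for any weak $V$-module $M$ and any $A_n(V)$-module homomorphism $\phi:U\to\Omega_n(M)$, there is a unique homomorphism of weak $V$-modules $\bar\phi:M_n(U)\to M$ extending $\phi$. Moreover, $M_n(U)$ has a unique maximal submodule $\bar J$ with $\bar J\cap M_n(U)(n)=0$; the quotient $L_n(U)=M_n(U)/\bar J$ is a $V$-module with $L_n(U)(n)\cong U$ and $L_n(U)(0)\neq 0$, and $U$ is a simple $A_n(V)$-module if and only if $L_n(U)$ is an irreducible $V$-module.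
   Context: Standing assumptions: $\mathbb{F}$ is an algebraically closed field with $\mathrm{char}\,\mathbb{F}\neq 2$. $V$ is a vertex operator algebra over $\mathbb{F}$ ($\mathbb{Z}$-graded vertex algebra $V=\bigoplus_kV_k$ with finite-dimensional graded pieces, $V_k=0$ for $k\ll0$, Virasoro vector $\omega\in V_2$ with modes $L(k)$, $u_kv\in V_{s+t-k-1}$ for $u\in V_s,v\in V_t$, Virasoro relations, $\frac{d}{dz}Y(v,z)=Y(L(-1)v,z)$, $L(0)|_{V_k}=k$). $\deg a=s$ for $a\in V_s$; $(1+z)^k=\sum_{i\ge0}\binom ki z^i$. For $n\ge0$: $O_n(V)$ is the span of all $L(-1)a+L(0)a$ and all $a\circ^s_{n,t}b=\mathrm{Res}_z\,Y(a,z)b\,\frac{(1+z)^{\deg a+n+s}}{z^{2n+2+t}}$ ($a$ homogeneous, $0\le s\le t$); $A_n(V)=V/O_n(V)$ is an associative algebra with product induced by $a*_nb=\sum_{j=0}^n(-1)^j\binom{j+n}{n}\mathrm{Res}_z\,Y(a,z)b\frac{(1+z)^{\deg a+n}}{z^{n+j+1}}$; $O_n(V)\subseteq O_{n-1}(V)$ so $A_{n-1}(V)$ is a quotient of $A_n(V)$. An $A_n(V)$-module factors through $A_{n-1}(V)$ if $O_{n-1}(V)/O_n(V)$ acts as zero (for $n=0$, set $A_{-1}(V)=0$, so every nonzero module does not factor). Weak $V$-module: $Y_M(v,z)=\sum v_kz^{-k-1}$ with $u_lw=0$ for $l\gg0$, $Y_M(\mathbf 1,z)=\mathrm{id}$,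 Jacobi identity. $V$-module: weak module with grading $M=\bigoplus_{m\ge0}M(m)$, $v_kM(m)\subseteq M(m+\deg v-k-1)$. $o(a)=a_{\deg a-1}$. $\Omega_n(M)=\{w\in M\mid u_iw=0$ for homogeneous $u$, $i\ge\deg u+n\}$, an $A_n(V)$-module via $[a]\mapsto o(a)$; for a $V$-module, $M(n)\subseteq\Omega_n(M)$ is an $A_n(V)$-submodule. *)

(* Defs.v *)
From HB Require Import structures.
From mathcomp Require Import all_boot all_order all_algebra.
From Stdlib Require Import ClassicalEpsilon.
Set Implicit Arguments. Unset Strict Implicit. Unset Printing Implicit Defensive.
Import Order.TTheory GRing.Theory Num.Theory.
Local Open Scope ring_scope.

Section VOADefs.
Variable F : closedFieldType.

(* Sum of an eventually-zero sequence  \sum_{i >= 0} f i  (all sums below are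
   of this kind, finiteness following from the truncation axioms). *)
Definition isum (X : nmodType) (f : nat -> X) : X :=
  \sum_(i < epsilon (inhabits 0%N) (fun N : nat => forall i, (N <= i)%N -> f i = 0)) f i.

(* generalized binomial coefficient  binom(p, i)  for p an integer:
   coefficients of (1+z)^p = \sum_{i>=0} binom(p,i) z^i *)
Definition binomZ (p : int) (i : nat) : int :=
  match p with
  | Posz m => ('C(m, i))%:Z
  | Negz m => (-1) ^+ i * ('C(m + i, i))%:Z
  end.

Definition linmap (X Y : lmodType F) (f : X -> Y) :=
  forall (c : F) x y, f (c *: x + y) = c *: f x + f y.

Definition subspace (X : lmodType F) (P : X -> Prop) :=
  [/\ P 0, (forall x y, P x -> P y -> P (x + y)) & (forall (c : F) x, P x -> P (c *: x))].

Inductive span (X : lmodType F) (P : X -> Prop) : X -> Prop :=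
| span_gen x : P x -> span P x
| span0 : span P 0
| spanD x y : span P x -> span P y -> span P (x + y)
| spanZ (c : F) x : span P x -> span P (c *: x).

Definition graded (X : lmodType F) (gr : int -> X -> Prop) :=
  [/\ (forall k, subspace (gr k)),
      (forall x, exists (ks : seq int) (f : int -> X),
           (forall k, gr k (f k)) /\ x = \sum_(k <- ks) f k)
    & (forall (ks : seq int) (f : int -> X), uniq ks -> (forall k, gr k (f k)) ->
           \sum_(k <- ks) f k = 0 -> forall k, k \in ks -> f k = 0)].

Definition gr_closed (X : lmodType F) (gr : int -> X -> Prop) (S : X -> Prop) :=
  forall x, S x -> forall (ks : seq int) (f : int -> X), uniq ks ->
    (forall k, gr k (f k)) -> x = \sum_(k <- ks) f k -> forall k, k \in ks -> S (f k).

Section Modes.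
Variable V : lmodType F.

Definition bilin (X : lmodType F) (Y : int -> V -> X -> X) :=
  (forall k (c : F) a b w, Y k (c *: a + b) w = c *: Y k a w + Y k b w) /\
  (forall k a (c : F) w w', Y k a (c *: w + w') = c *: Y k a w + Y k a w').

Definition truncation (X : lmodType F) (Y : int -> V -> X -> X) :=
  forall u w, exists N : int, forall k, N <= k -> Y k u w = 0.

(* Jacobi identity, written componentwise (Borcherds identity):
   sum_i binom(p,i) (u_{r+i} v)_{p+q-i} w
   = sum_i (-1)^i binom(r,i) (u_{p+r-i} v_{q+i} w - (-1)^r v_{q+r-i} u_{p+i} w) *)
Definition borcherds (YV : int -> V -> V -> V) (X : lmodType F) (Y : int -> V -> X -> X) :=
  forall (p q r : int) (u v : V) (w : X),
    isum (fun i => ((binomZ p i)%:~R : F) *: Y (p + q - i%:Z) (YV (r + i%:Z) u v) w)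
    = isum (fun i => (((-1) ^+ i * binomZ r i)%:~R : F) *:
             (Y (p + r - i%:Z) u (Y (q + i%:Z) v w)
              - ((-1 : F) ^ r) *: Y (q + r - i%:Z) v (Y (p + i%:Z) u w))).
End Modes.

Record VOA (V : lmodType F) := {
  Vgr : int -> V -> Prop;
  Y : int -> V -> V -> V;          (* Y k u v = u_k v *)
  vac : V;
  om : V;
  cc : F;
  VOA_graded : graded Vgr;
  VOA_findim : forall k, exists s : seq V, forall v, Vgr k v ->
                  exists c : nat -> F, v = \sum_(i < size s) c i *: s`_i;
  VOA_bounded : exists K : int, forall k v, k < K -> Vgr k v -> v = 0;
  VOA_bilin : bilin Y;
  VOA_trunc : truncation Y;
  VOA_vacuum : forall k v, Y k vac v = if k == -1 then v else 0;
  VOA_creation : (forall k v, 0 <= k -> Y k v vac = 0) /\ (forall v, Y (-1) v vac = v);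
  VOA_jacobi : borcherds Y Y;
  VOA_vac_deg : Vgr 0 vac;
  VOA_om_deg : Vgr 2 om;
  VOA_mode_deg : forall s t k u v, Vgr s u -> Vgr t v -> Vgr (s + t - k - 1) (Y k u v);
  (* Virasoro relations, L(k) = omega_{k+1}; the central term
     (m^3-m)/12 c is written ((m^3-m)/6) * (c/2) (meaningful as char F <> 2) *)
  VOA_virasoro : forall m n v,
     Y (m + 1) om (Y (n + 1) om v) - Y (n + 1) om (Y (m + 1) om v)
     = ((m - n)%:~R : F) *: Y (m + n + 1) om v
       + (if m + n == 0 then (((m ^+ 3 - m) %/ 6)%Z%:~R : F) * (cc / 2%:R) else 0) *: v;
  VOA_deriv : forall k v w, Y k (Y 0 om v) w = ((- k)%:~R : F) *: Y (k - 1) v w;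
  VOA_L0 : forall k v, Vgr k v -> Y 1 om v = (k%:~R : F) *: v
}.

Section Modules.
Variables (V : lmodType F) (A : VOA V).

Definition Lop (k : int) (a : V) : V := Y A (k + 1) (om A) a.

Definition weak_module (M : lmodType F) (YM : int -> V -> M -> M) :=
  [/\ bilin YM, truncation YM,
      (forall k w, YM k (vac A) w = if k == -1 then w else 0)
    & borcherds (Y A) YM].

Definition Vmodule (M : lmodType F) (YM : int -> V -> M -> M) (grM : int -> M -> Prop) :=
  [/\ weak_module YM, graded grM,
      (forall j w, j < 0 -> grM j w -> w = 0)
    & (forall s k m v w, Vgr A s v -> grM m w -> grM (m + s - k - 1) (YM k v w))].

Definition weak_hom (M1 M2 : lmodType F) (Y1 : int -> V -> M1 -> M1)
    (Y2 : int -> V -> M2 -> M2) (f : M1 -> M2) :=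
  linmap f /\ forall k v w, f (Y1 k v w) = Y2 k v (f w).

Definition weak_sub (M : lmodType F) (YM : int -> V -> M -> M) (S : M -> Prop) :=
  subspace S /\ forall k v w, S w -> S (YM k v w).

(* submodules of a V-module: graded submodules *)
Definition graded_sub (M : lmodType F) (YM : int -> V -> M -> M)
    (grM : int -> M -> Prop) (S : M -> Prop) :=
  weak_sub YM S /\ gr_closed grM S.

Definition generated_by (M : lmodType F) (YM : int -> V -> M -> M) (P : M -> Prop) :=
  forall S, weak_sub YM S -> (forall w, P w -> S w) -> forall w, S w.

Definition irreducible (M : lmodType F) (YM : int -> V -> M -> M) (grM : int -> M -> Prop) :=
  (exists w : M, w <> 0) /\
  forall S, graded_sub YM grM S -> (forall w, S w -> w = 0) \/ (forall w, S w).

Definition Omega (n : nat) (M : lmodType F) (YM : int -> V -> M -> M) (w : M) :=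
  forall d u i, Vgr A d u -> d + n%:Z <= i -> YM i u w = 0.

(* a o^s_{n,t} b, for a homogeneous of degree d *)
Definition circ (n s t : nat) (d : int) (a b : V) : V :=
  isum (fun i => ((binomZ (d + n%:Z + s%:Z) i)%:~R : F) *:
                 Y A (i%:Z - Posz (2 * n + 2 + t)%N) a b).

Definition genO (n : nat) (x : V) : Prop :=
  (exists a, x = Lop (-1) a + Lop 0 a) \/
  (exists d a b (s t : nat), [/\ Vgr A d a, (s <= t)%N & x = circ n s t d a b]).

Definition On (n : nat) : V -> Prop := span (genO n).

(* a *_n b, for a homogeneous of degree d *)
Definition star (n : nat) (d : int) (a b : V) : V :=
  \sum_(j < n.+1) (((-1) ^+ j * ('C(j + n, n))%:R : F)) *:
     isum (fun i => ((binomZ (d + n%:Z) i)%:~R : F) *: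
                    Y A (i%:Z - Posz (n + j + 1)%N) a b).

(* A module over A_n(V) = V/O_n(V), given by the action of representatives *)
Definition An_module (n : nat) (U : lmodType F) (rho : V -> U -> U) :=
  [/\ (forall (c : F) a b u, rho (c *: a + b) u = c *: rho a u + rho b u),
      (forall a, linmap (rho a)),
      (forall x u, On n x -> rho x u = 0),
      (forall d a b u, Vgr A d a -> rho (star n d a b) u = rho a (rho b u))
    & (forall u, rho (vac A) u = u)].

(* the module factors through A_{n-1}(V)  (A_{-1}(V) = 0) *)
Definition factors_prev (n : nat) (U : lmodType F) (rho : V -> U -> U) :=
  match n with
  | 0%N => forall x u, rho x u = 0
  | n'.+1 => forall x u, On n' x -> rho x u = 0
  end.

Definition simple_An (U : lmodType F) (rho : V -> U -> U) :=
  (exists u : U, u <> 0) /\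
  forall S, subspace S -> (forall a u, S u -> S (rho a u)) ->
    (forall u, S u -> u = 0) \/ (forall u, S u).

(* f : U -> M is an A_n(V)-module isomorphism onto the subspace P of M,
   A_n(V) acting on M via o(a) = a_{deg a - 1} *)
Definition An_iso_onto (U M : lmodType F) (rho : V -> U -> U)
    (YM : int -> V -> M -> M) (f : U -> M) (P : M -> Prop) :=
  [/\ linmap f, injective f, (forall w, P w <-> exists u, w = f u)
    & (forall d a u, Vgr A d a -> f (rho a u) = YM (d - 1) a (f u))].

End Modules.
End VOADefs.

(* Main.v *)
Require Import Defs.
From HB Require Import structures.
From mathcomp Require Import all_boot all_order all_algebra.
From Stdlib Require Import ClassicalEpsilon.
From mathcomp Require Import zify ring boolp.
Set Implicit Arguments. Unset Strict Implicit. Unset Printing Implicit Defensive.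
Import Order.TTheory GRing.Theory Num.Theory.
Local Open Scope ring_scope.

(** [M_n(U)] is the space of formal expressions in modes applied to [U], modulo having the same
    (graded) value in every weak module [M] with an [A_n(V)]-map [U -> Omega_n(M)]; its universal
    property, grading and truncation come for free, because products of modes applied to [U]
    reduce to single modes.  Non-collapse needs one weak module in which [U] embeds.  Following
    Li's regular representations, it is a space of functionals [f : V -> U] such that
    [f(Y(a,x)b)] is rational in [x] with poles at 0, -1 and infinity, the last two bounded
    independently of [b]: [V] acts by residues at -1, the residue theorem turns the Borcherds
    identity of [V] (at 0) into that of the functionals (at -1), and [u] goes to
    [b |-> rho(b)u], the relations [a o_(n,t) b] bounding the pole at infinity.  If
    [M_n(U)(0)], or its image in [L_n(U)], vanished, then [U] would lie in [Omega_(n-1)], on which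
    [O_(n-1)(V)] acts as zero.  [J] consists of the vectors whose submodule avoids degree [n]. *)

(** No rational function is ever formed: it is encoded by its residues against all weights
    $x^m(1+x)^k$, and $x^m(1+x)^{k+1}=x^m(1+x)^k+x^{m+1}(1+x)^k$ spreads an identity from a region
    where it is immediate to all $m,k$. The order of a weight at infinity depends on $m+k$ alone,
    which explains the constants. The product $a*_nb$ is the weight $(1+x)^{d-1}$ of $o(a)=a_{d-1}$,
    $d=\deg a$, read at infinity: there it equals $x^{-n-1}(1+1/x)^{-n-1}(1+x)^{d+n}$, the relations
    $a\circ_{n,t}b$ kill $x^m(1+x)^{d+n}$ for $m\le-2n-2$, and so the terms $j\le n$ survive, with
    coefficients $\binom{-n-1}{j}=(-1)^j\binom{j+n}{n}$. Since the characteristic may be positive,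
    $L(-1)^i/i!$ is replaced by $a\mapsto a_{-1-i}\mathbf 1$. The relation $L(-1)a+L(0)a\in O_n(V)$
    cannot be iterated and divided by $i!$; its divided form is extracted from the fact that
    $a*_n\mathbf 1$ acts as $a$. *)

(** * Quotients by a linear congruence *)

Section SetoidModule.
Variables (F : closedFieldType) (T : Type).
Variables (add : T -> T -> T) (zero : T) (scale : F -> T -> T) (R : T -> T -> Prop).
Hypotheses (Rrefl : forall x, R x x) (Rsym : forall x y, R x y -> R y x)
  (Rtrans : forall x y z, R x y -> R y z -> R x z)
  (Radd : forall x x' y y', R x x' -> R y y' -> R (add x y) (add x' y'))
  (Rscale : forall c x x', R x x' -> R (scale c x) (scale c x'))
  (addA : forall x y z, R (add x (add y z)) (add (add x y) z))
  (addC : forall x y, R (add x y) (add y x))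
  (add0 : forall x, R (add zero x) x)
  (addN : forall x, R (add (scale (-1) x) x) zero)
  (scaleA : forall a b x, R (scale a (scale b x)) (scale (a * b) x))
  (scale1 : forall x, R (scale 1 x) x)
  (scaleDr : forall a x y, R (scale a (add x y)) (add (scale a x) (scale a y)))
  (scaleDl : forall a b x, R (scale (a + b) x) (add (scale a x) (scale b x))).

(** The quotient consists of chosen representatives. The operations obey the module axioms only up
    to [R], so the construction serves syntactic expressions, functionals paired with a proof, and a
    module modulo a submodule alike. *)
Definition setoid_can (x : T) : T := epsilon (inhabits zero) (R x).

Lemma setoid_canP x : R x (setoid_can x).
Proof. by apply: epsilon_spec; exists x. Qed.

Lemma setoid_can_eq x y : R x y -> setoid_can x = setoid_can y.
Proof.
move=> Rxy; rewrite /setoid_can; congr epsilon; apply: funext => z.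
by apply/propext; split; [move/(Rtrans (Rsym Rxy)) | move/(Rtrans Rxy)].
Qed.

Definition setoid_quo := {x : T | setoid_can x = x}.

Definition setoid_pi (x : T) : setoid_quo :=
  exist _ (setoid_can x) (setoid_can_eq (Rsym (setoid_canP x))).

Lemma setoid_pi_eq x y : setoid_pi x = setoid_pi y <-> R x y.
Proof.
split=> [[e]|Rxy].
  apply: Rtrans (setoid_canP x) _; rewrite e; exact: Rsym (setoid_canP y).
exact/eq_exist/setoid_can_eq.
Qed.

Lemma setoid_pi_val q : setoid_pi (sval q) = q.
Proof. by case: q => x xP; apply: eq_exist; rewrite /= xP. Qed.

HB.instance Definition _ := gen_eqMixin setoid_quo.
HB.instance Definition _ := gen_choiceMixin setoid_quo.

Let qadd (p q : setoid_quo) := setoid_pi (add (sval p) (sval q)).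
Let qopp (p : setoid_quo) := setoid_pi (scale (-1) (sval p)).
Let qscale (c : F) (p : setoid_quo) := setoid_pi (scale c (sval p)).

Lemma setoid_piD x y : setoid_pi (add x y) = qadd (setoid_pi x) (setoid_pi y).
Proof. by apply/setoid_pi_eq/Radd => /=; exact: setoid_canP. Qed.

Lemma setoid_piZ c x : setoid_pi (scale c x) = qscale c (setoid_pi x).
Proof. by apply/setoid_pi_eq/Rscale; exact: setoid_canP. Qed.

Lemma setoid_quo_ind (P : setoid_quo -> Prop) : (forall x, P (setoid_pi x)) -> forall q, P q.
Proof. by move=> H q; rewrite -(setoid_pi_val q). Qed.

Let qaddA : associative qadd.
Proof.
elim/setoid_quo_ind=> x; elim/setoid_quo_ind=> y; elim/setoid_quo_ind=> z.
by rewrite -!setoid_piD; apply/setoid_pi_eq.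
Qed.
Let qaddC : commutative qadd.
Proof.
by elim/setoid_quo_ind=> x; elim/setoid_quo_ind=> y; rewrite -!setoid_piD; apply/setoid_pi_eq.
Qed.
Let qadd0 : left_id (setoid_pi zero) qadd.
Proof. by elim/setoid_quo_ind=> x; rewrite -!setoid_piD; apply/setoid_pi_eq. Qed.
Let qaddN : left_inverse (setoid_pi zero) qopp qadd.
Proof.
by elim/setoid_quo_ind=> x; rewrite -[qopp _]/(qscale _ _) -setoid_piZ -!setoid_piD; apply/setoid_pi_eq.
Qed.
HB.instance Definition _ := GRing.isZmodule.Build setoid_quo qaddA qaddC qadd0 qaddN.

Let qscaleA a b v : qscale a (qscale b v) = qscale (a * b) v.
Proof. by elim/setoid_quo_ind: v => x; rewrite -!setoid_piZ; apply/setoid_pi_eq. Qed.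
Let qscale1 : left_id 1 qscale.
Proof. by elim/setoid_quo_ind=> x; rewrite -!setoid_piZ; apply/setoid_pi_eq. Qed.
Let qscaleDr : right_distributive qscale +%R.
Proof.
move=> a; elim/setoid_quo_ind=> x; elim/setoid_quo_ind=> y.
by rewrite -[_ + _]/(qadd _ _) -[RHS]/(qadd _ _) -!(setoid_piZ, setoid_piD); apply/setoid_pi_eq.
Qed.
Let qscaleDl v : {morph qscale^~ v : a b / a + b}.
Proof.
move=> a b; elim/setoid_quo_ind: v => x.
by rewrite -[RHS]/(qadd _ _) -!(setoid_piZ, setoid_piD); apply/setoid_pi_eq.
Qed.
HB.instance Definition _ := GRing.Zmodule_isLmodule.Build F setoid_quo
  qscaleA qscale1 qscaleDr qscaleDl.

Lemma setoid_lmod : exists (Q : lmodType F) (pi : T -> Q),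
  [/\ forall q, exists x, pi x = q, forall x y, pi x = pi y <-> R x y,
      forall x y, pi (add x y) = pi x + pi y & forall c x, pi (scale c x) = c *: pi x].
Proof.
exists (setoid_quo : lmodType F), setoid_pi; split.
- by move=> q; exists (sval q); exact: setoid_pi_val.
- exact: setoid_pi_eq.
- exact: setoid_piD.
- exact: setoid_piZ.
Qed.
End SetoidModule.

(** * Induction over the integers and over the lattice of weights *)

Section IntInduction.
Implicit Types (P : int -> Prop) (m k : int).

Lemma int_up P m0 : P m0 -> (forall m, m0 <= m -> P m -> P (m + 1)) -> forall m, m0 <= m -> P m.
Proof.
move=> P0 PS m le_m; have -> : m = m0 + (absz (m - m0))%:Z by lia.
elim: absz => [|j IHj]; first by rewrite addr0.
have -> : m0 + j.+1%:Z = m0 + j%:Z + 1 by lia.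
by apply: PS IHj; lia.
Qed.

Lemma int_down P m0 : P m0 -> (forall m, m < m0 -> P (m + 1) -> P m) -> forall m, m <= m0 -> P m.
Proof.
move=> P0 PS m le_m; have -> : m = m0 - (absz (m0 - m))%:Z by lia.
elim: absz => [|j IHj]; first by rewrite subr0.
apply: PS; first lia.
by have -> : m0 - j.+1%:Z + 1 = m0 - j%:Z by lia.
Qed.

Lemma int_desc P : (exists m0, forall m, m0 <= m -> P m) ->
  (forall m, P (m + 1) -> P m) -> forall m, P m.
Proof.
move=> [m0 P0] PS m; case: (lerP m0 m) => [/P0 //|lt_m].
by move: (m) (ltW lt_m); apply: int_down => [|? _]; [exact: P0 | exact: PS].
Qed.

Lemma int_asc P : (exists m0, forall m, m <= m0 -> P m) ->
  (forall m, P m -> P (m + 1)) -> forall m, P m.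
Proof.
move=> [m0 P0] PS m; case: (lerP m m0) => [/P0 //|lt_m].
by move: (m) (ltW lt_m); apply: int_up => [|? _]; [exact: P0 | exact: PS].
Qed.

(* [P m k] stands for a property of a family [T m k] with [T m (k+1) = T m k + T (m+1) k],
   the weight of [T m k] being [x^m (1+x)^k]. *)
Lemma lattice_ind0 (P : int -> int -> Prop) :
  (forall m, P m 0) -> (exists m0, forall m k, m0 <= m -> P m k) ->
  (forall m k, P m k -> P (m + 1) k -> P m (k + 1)) ->
  (forall m k, P m (k + 1) -> P (m + 1) k -> P m k) ->
  forall m k, P m k.
Proof.
move=> P0 [m0 Pm] up down m k; case: (lerP 0 k) => [le0k|ltk0].
  move: k le0k m; apply: int_up => // k _ IH m; exact: up.
move: k {ltk0} (ltW ltk0) m; apply: int_down => // k _ IH.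
by apply: int_desc => [|m ?]; [exists m0 => m /Pm | exact: down].
Qed.

(** The scheme for residues at -1: they vanish once $k$ clears the pole at -1, and for very negative
    $m$ they are governed by the residue at 0, with a bound on $m$ that may depend on $k$. *)
Lemma lattice_ind_desc (P : int -> int -> Prop) :
  (exists l, forall m k, l <= k -> P m k) ->
  (forall k, exists M, forall m, m <= M -> P m k) ->
  (forall m k, P m (k + 1) -> P m k -> P (m + 1) k) ->
  forall m k, P m k.
Proof.
move=> [l Pl] PM up m k; move: k m; apply: int_desc => [|k IH].
  by exists l => k lk m; exact: Pl.
by apply: int_asc => // m; exact: up.
Qed.
End IntInduction.

(** * Binomial coefficients with an integer upper argument *)

Lemma binomZ0 p : binomZ p 0 = 1.
Proof. by case: p => m; rewrite /binomZ ?expr0 ?mul1r !bin0. Qed.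

Lemma binomZS p i : binomZ (p + 1) i.+1 = binomZ p i.+1 + binomZ p i.
Proof.
case: p => [m|[|m]].
- by rewrite -PoszD addn1 /binomZ binS PoszD.
- by rewrite /binomZ /= !add0n !binn !mulr1 exprS mulN1r addNr.
- have -> : Negz m.+1 + 1 = Negz m by lia.
  rewrite /binomZ !addSn !addnS (binS (m + i).+1) PoszD exprS; ring.
Qed.

Lemma binomZ_nat (m i : nat) : binomZ m i = 'C(m, i) :> int.
Proof. by []. Qed.

Lemma binomZ_small (m : int) i : 0 <= m -> m < i%:Z -> binomZ m i = 0.
Proof. by case: m => // m _ lt_mi; rewrite /binomZ bin_small. Qed.

Lemma binomZ_neg (p : int) i : p < 0 -> binomZ p i = (-1) ^+ i * ('C((absz p).-1 + i, i))%:Z.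
Proof. by case: p => // m _ /=. Qed.

(** The residues of $x^m(1+x)^k$ at 0 and -1 are $\binom{k}{-m-1}$ and
    $(-1)^{m+k+1}\binom{m}{-k-1}$; they cancel because $m+k\le-2$ leaves no residue at infinity.
    Both sides are $\binom{|m|+|k|-2}{|m|-1}$. *)
Lemma binomZ_neg_sym (m k : int) : m < 0 -> k < 0 ->
  (-1) ^+ (absz (m + 1)) * binomZ k (absz (m + 1)) =
  (-1) ^+ (absz (k + 1)) * binomZ m (absz (k + 1)).
Proof.
move=> m0 k0; rewrite !binomZ_neg // !signrMK.
have [-> ->] : absz (m + 1) = (absz m).-1 /\ absz (k + 1) = (absz k).-1 by lia.
by rewrite -bin_sub ?leq_addl // addnK addnC.
Qed.

Lemma binomZ_reflect (e : int) i : (-1) ^+ i * binomZ (i%:Z - e) i = binomZ (e - 1) i.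
Proof.
case: (lerP e 0) => [le_e0|lt0e].
  rewrite (binomZ_neg (p := e - 1)); last lia.
  have -> : i%:Z - e = Posz ((absz (e - 1)).-1 + i)%N by lia.
  by rewrite binomZ_nat.
have -> : e - 1 = Posz (absz e).-1 by lia.
case: (lerP e i) => [le_ei|lt_ie].
  rewrite (@binomZ_small (_ - _)) ?mulr0 ?(@binomZ_small (Posz _)) //; lia.
rewrite binomZ_neg; last lia.
rewrite signrMK binomZ_nat.
by congr (('C(_, _))%:Z); lia.
Qed.

(** * Eventually zero sums and Pascal recursions *)

Section Isum.
Variable F : closedFieldType.
Implicit Types X Z : lmodType F.

Definition ev0 (X : nmodType) (h : nat -> X) := exists N, forall i, (N <= i)%N -> h i = 0.

Lemma sum_ev0 (X : nmodType) (h : nat -> X) N N' : (N <= N')%N ->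
  (forall i, (N <= i)%N -> h i = 0) -> \sum_(i < N') h i = \sum_(i < N) h i.
Proof.
move=> le_N h0; rewrite -!(big_mkord xpredT h) (big_cat_nat (n := N)) //=.
by rewrite [X in _ + X]big_nat_cond [X in _ + X]big1 ?addr0 // => i /andP[/andP[/h0]].
Qed.

(** [isum] stops at a bound picked by [epsilon]; past a valid bound only zeros are added, so all
    valid bounds give the same value. *)
Lemma isumE (X : nmodType) (h : nat -> X) N :
  (forall i, (N <= i)%N -> h i = 0) -> isum h = \sum_(i < N) h i.
Proof.
move=> hN; rewrite /isum; set e := epsilon _ _.
have he : forall i, (e <= i)%N -> h i = 0.
  exact: (@epsilon_spec nat (inhabits 0%N)
    (fun N => forall i, (N <= i)%N -> h i = 0) (ex_intro _ N hN)).
by case: (leqP e N) => [/sum_ev0 ->|/ltnW /sum_ev0 ->].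
Qed.

Lemma eq_isum (X : nmodType) (h g : nat -> X) : h =1 g -> isum h = isum g.
Proof. by move=> hg; congr isum; exact: funext. Qed.

Lemma isum0 (X : nmodType) (h : nat -> X) : (forall i, h i = 0) -> isum h = 0.
Proof. by move=> h0; rewrite (isumE (N := 0)) ?big_ord0. Qed.

Lemma isum1 (X : nmodType) (h : nat -> X) j : (forall i, i != j -> h i = 0) -> isum h = h j.
Proof.
move=> h0; rewrite (isumE (N := j.+1)) => [|i lt_ji]; last by apply: h0; rewrite gtn_eqF.
by rewrite big_ord_recr /= big1 ?add0r // => i _; apply: h0; rewrite ltn_eqF.
Qed.

Lemma isumD (X : nmodType) (h g : nat -> X) : ev0 h -> ev0 g ->
  isum (fun i => h i + g i) = isum h + isum g.
Proof.
move=> [N hN] [N' gN].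
rewrite !(isumE (N := maxn N N')) -?big_split // => i; rewrite geq_max => /andP[? ?];
by rewrite ?hN ?gN ?addr0.
Qed.

Lemma linmapD X Z (f : X -> Z) : linmap f -> {morph f : x y / x + y}.
Proof. by move=> lf x y; have := lf 1 x y; rewrite !scale1r. Qed.

Lemma linmap0 X Z (f : X -> Z) : linmap f -> f 0 = 0.
Proof. by move=> lf; apply: (addrI (f 0)); rewrite -linmapD // !addr0. Qed.

Lemma linmapZ X Z (f : X -> Z) : linmap f -> forall c x, f (c *: x) = c *: f x.
Proof. by move=> lf c x; have := lf c x 0; rewrite !addr0 linmap0 // addr0. Qed.

Lemma linmapN X Z (f : X -> Z) : linmap f -> {morph f : x / - x}.
Proof. by move=> lf x; rewrite -scaleN1r linmapZ // scaleN1r. Qed.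

Lemma linmapB X Z (f : X -> Z) : linmap f -> {morph f : x y / x - y}.
Proof. by move=> lf x y; rewrite linmapD // linmapN. Qed.

Lemma linmap_sum X Z (f : X -> Z) (I : Type) (r : seq I) (h : I -> X) : linmap f ->
  f (\sum_(i <- r) h i) = \sum_(i <- r) f (h i).
Proof. by move=> lf; apply: (big_morph f (linmapD lf) (linmap0 lf)). Qed.

Lemma linmap_isum X Z (f : X -> Z) (h : nat -> X) : linmap f -> ev0 h ->
  f (isum h) = isum (fun i => f (h i)).
Proof.
move=> lf [N hN]; rewrite !(isumE (N := N)) // => [|i /hN ->]; last exact: linmap0.
by rewrite -(big_mkord xpredT h) linmap_sum // big_mkord.
Qed.

Lemma linmap_scale X (c : F) : linmap (fun x : X => c *: x).
Proof. by move=> d x y; rewrite scalerDr !scalerA mulrC. Qed.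

Lemma isumZ X (c : F) (h : nat -> X) : ev0 h -> isum (fun i => c *: h i) = c *: isum h.
Proof. by move=> h0; rewrite (linmap_isum (@linmap_scale X c)). Qed.

Lemma isumN X (h : nat -> X) : ev0 h -> isum (fun i => - h i) = - isum h.
Proof. by move=> h0; rewrite -scaleN1r -isumZ //; apply: eq_isum => i; rewrite scaleN1r. Qed.

Lemma isumB X (h g : nat -> X) : ev0 h -> ev0 g ->
  isum (fun i => h i - g i) = isum h - isum g.
Proof.
by move=> h0 [N gN]; rewrite isumD ?isumN //; exists N => // i /gN ->; rewrite oppr0.
Qed.

Lemma isum_rec X (h : nat -> X) : ev0 h -> isum h = h 0%N + isum (fun i => h i.+1).
Proof.
move=> [N hN]; rewrite (isumE (N := N.+1)) => [|i /ltnW/hN //].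
rewrite big_ord_recl; congr (_ + _); rewrite (isumE (N := N)) => [|i /leqW/hN //].
by apply: eq_bigr => i _.
Qed.

Lemma ev0Z X (c : nat -> F) (h : nat -> X) : ev0 h -> ev0 (fun i => c i *: h i).
Proof. by move=> [N hN]; exists N => i /hN ->; rewrite scaler0. Qed.

Lemma ev0S (X : nmodType) (h : nat -> X) : ev0 h -> ev0 (fun i => h i.+1).
Proof. by move=> [N hN]; exists N => i /leqW/hN. Qed.

Lemma ev0_int (X : nmodType) (h : int -> X) m : (exists m0, forall m, m0 <= m -> h m = 0) ->
  ev0 (fun i : nat => h (m + i%:Z)).
Proof. by move=> [m0 h0]; exists (absz (m0 - m)) => i le_i; apply: h0; lia. Qed.

(** The pairing of [h] with $(1+x)^k$ expanded at 0; the weighted residues below have this form. *)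
Definition bsum X (k : int) (h : nat -> X) := isum (fun i => (binomZ k i)%:~R *: h i).

Lemma bsumS X k (h : nat -> X) : ev0 h -> bsum (k + 1) h = bsum k h + bsum k (fun i => h i.+1).
Proof.
move=> h0; rewrite /bsum isum_rec; last exact: ev0Z.
rewrite [in RHS]isum_rec; last exact: ev0Z.
have h1 := ev0S h0.
rewrite !binomZ0 -addrA; congr (_ + _).
rewrite -isumD; [|exact: ev0Z (fun i => (binomZ k i.+1)%:~R) _ h1|exact: ev0Z].
by apply: eq_isum => i; rewrite binomZS rmorphD scalerDl.
Qed.

Lemma bsum0 X (h : nat -> X) : bsum 0 h = h 0%N.
Proof.
rewrite /bsum (isum1 (j := 0%N)) ?binomZ0 ?scale1r // => i i0.
by rewrite binomZ_small ?scale0r //; lia.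
Qed.

Lemma bsum_lin X Z k (f : X -> Z) (h : nat -> X) : linmap f -> ev0 h ->
  f (bsum k h) = bsum k (fun i => f (h i)).
Proof.
move=> lf h0; rewrite /bsum linmap_isum //; last exact: ev0Z.
by apply: eq_isum => i; rewrite linmapZ.
Qed.

Lemma bsumD X k (h g : nat -> X) : ev0 h -> ev0 g ->
  bsum k (fun i => h i + g i) = bsum k h + bsum k g.
Proof.
move=> h0 g0; rewrite /bsum -isumD; [|exact: ev0Z..].
by apply: eq_isum => i; rewrite scalerDr.
Qed.

Lemma bsumZ X k c (h : nat -> X) : ev0 h -> bsum k (fun i => c *: h i) = c *: bsum k h.
Proof. by move=> h0; rewrite (bsum_lin k (@linmap_scale X c)). Qed.

Lemma eq_bsum X k (h g : nat -> X) : h =1 g -> bsum k h = bsum k g.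
Proof. by move=> hg; apply: eq_isum => i; rewrite hg. Qed.

Lemma bsum_eq0 X k (h : nat -> X) : (forall i, h i = 0) -> bsum k h = 0.
Proof. by move=> h0; apply: isum0 => i; rewrite h0 scaler0. Qed.

Definition lat X (T : int -> int -> X) := forall m k, T m (k + 1) = T m k + T (m + 1) k.

Definition dlat X (T : int -> int -> X) := forall m k, T (m + 1) k = T m (k + 1) - T m k.

Lemma lat_dlat X (T : int -> int -> X) : lat T <-> dlat T.
Proof. by split=> H m k; [rewrite H [RHS]addrC addKr | rewrite H [RHS]addrC subrK]. Qed.

Lemma lat_eq0 X (T T' : int -> int -> X) : lat T -> lat T' -> (forall m, T m 0 = T' m 0) ->
  (exists m0, forall m k, m0 <= m -> T m k = T' m k) -> forall m k, T m k = T' m k.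
Proof.
move=> lT lT' T0 Tm; apply: lattice_ind0 => //= m k.
  by rewrite lT lT' => -> ->.
by rewrite lT lT' => /[swap] ->; exact: addIr.
Qed.

Lemma lat_eq_desc X (T T' : int -> int -> X) : lat T -> lat T' ->
  (exists l, forall m k, l <= k -> T m k = T' m k) ->
  (forall k, exists M, forall m, m <= M -> T m k = T' m k) -> forall m k, T m k = T' m k.
Proof.
move=> /lat_dlat lT /lat_dlat lT' Tl Tk; apply: lattice_ind_desc => // m k.
by rewrite lT lT' => -> ->.
Qed.

End Isum.

(** * Weak modules *)

Section Sign.
Variable F : closedFieldType.

Definition sgnz (z : int) : F := (-1) ^ z.

Lemma sgnzD m k : sgnz (m + k) = sgnz m * sgnz k.
Proof. by rewrite /sgnz expfzDr // oppr_eq0 oner_eq0. Qed.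

Lemma sgnz_nat (i : nat) : sgnz i = (-1) ^+ i.
Proof. by []. Qed.

Lemma sgnzS m : sgnz (m + 1) = - sgnz m.
Proof. by rewrite sgnzD /sgnz expr1z mulrN1. Qed.

Lemma sgnzK m : sgnz m * sgnz m = 1.
Proof.
by rewrite /sgnz -expfzMl mulrNN mulr1 exp1rz.
Qed.

Lemma sgnz_absz m : sgnz m = (-1) ^+ absz m.
Proof.
case: m => n //; rewrite NegzE abszN /= -sgnz_nat.
by rewrite -[LHS]mul1r -(sgnzK n.+1) -mulrA -sgnzD subrr /sgnz expr0z mulr1.
Qed.

Lemma binomZ1 d : binomZ d 1 = d.
Proof. by case: d => k; rewrite /binomZ bin1 // expr1 mulN1r addn1 NegzE. Qed.

Lemma intr_sign (X : pzRingType) i : ((-1) ^+ i)%:~R = (-1) ^+ i :> X.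
Proof. by rewrite rmorphXn rmorphN1. Qed.
End Sign.

Section Subspace.
Variables (F : closedFieldType) (X : lmodType F) (S : X -> Prop).
Hypothesis hS : subspace S.

Lemma subspace0 : S 0. Proof. by case: hS. Qed.
Lemma subspaceD x y : S x -> S y -> S (x + y). Proof. by case: hS => _ H _; exact: H. Qed.
Lemma subspaceZ c x : S x -> S (c *: x). Proof. by case: hS => _ _; apply. Qed.
Lemma subspaceN x : S x -> S (- x). Proof. by rewrite -scaleN1r; exact: subspaceZ. Qed.
Lemma subspaceB x y : S x -> S y -> S (x - y).
Proof. by move=> Sx Sy; apply/subspaceD/subspaceN. Qed.

Lemma subspace_sum (I : Type) (r : seq I) (P : pred I) (h : I -> X) :
  (forall i, P i -> S (h i)) -> S (\sum_(i <- r | P i) h i).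
Proof. by move=> Sh; apply: big_ind => //; [exact: subspace0 | exact: subspaceD]. Qed.

Lemma subspace_isum (h : nat -> X) : ev0 h -> (forall i, S (h i)) -> S (isum h).
Proof. by move=> [N hN] Sh; rewrite (isumE hN); apply: subspace_sum. Qed.
End Subspace.

Lemma span_subspace (F : closedFieldType) (X : lmodType F) (P : X -> Prop) : subspace (Defs.span P).
Proof. by split; [exact: span0 | exact: spanD | exact: spanZ]. Qed.

Lemma span_min (F : closedFieldType) (X : lmodType F) (P S : X -> Prop) :
  subspace S -> (forall x, P x -> S x) -> forall x, Defs.span P x -> S x.
Proof.
move=> hS PS x; elim=> {x} [x /PS //||x y _ Sx _ Sy|c x _ Sx].
- exact: subspace0.
- exact: subspaceD.
- exact: subspaceZ.
Qed.

Lemma graded_ind (F : closedFieldType) (X : lmodType F) (gr : int -> X -> Prop) (S : X -> Prop) :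
  graded gr -> subspace S -> (forall k x, gr k x -> S x) -> forall x, S x.
Proof.
move=> [_ dec _] hS H x; have [ks [f [fk ->]]] := dec x.
by apply: subspace_sum => // k _; exact: H (fk k).
Qed.

Lemma linmap_ker (F : closedFieldType) (X Z : lmodType F) (f : X -> Z) :
  linmap f -> subspace (fun x => f x = 0).
Proof.
move=> lf; split=> [|x y fx fy|c x fx]; first exact: linmap0.
  by rewrite linmapD // fx fy addr0.
by rewrite linmapZ // fx scaler0.
Qed.

Lemma linmap_eqsub (F : closedFieldType) (X Z : lmodType F) (f g : X -> Z) :
  linmap f -> linmap g -> subspace (fun x => f x = g x).
Proof.
move=> lf lg; split=> [|x y fx fy|c x fx]; first by rewrite !linmap0.
  by rewrite !linmapD // fx fy.
by rewrite !linmapZ // fx.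
Qed.

(* Coefficient extraction in the two expansions of [(x-y)^r]:
   [xyexp] expands in nonnegative powers of [y], [yxexp] in nonnegative powers of [x]. *)
Section TwoVariables.
Variables (F : closedFieldType) (X : lmodType F).
Implicit Type g : int -> int -> X.

Definition up1 g := exists P, forall p q, P <= p -> g p q = 0.
Definition up2 g := exists Q, forall p q, Q <= q -> g p q = 0.

Definition xyexp (r : int) g (p q : int) : X :=
  bsum r (fun i => (-1) ^+ i *: g (p + r - i%:Z) (q + i%:Z)).

Definition yxexp (r : int) g (p q : int) : X :=
  sgnz F r *: xyexp r (fun q p => g p q) q p.

Lemma xyexp_ev0 r g p q : up2 g ->
  ev0 (fun i : nat => (-1) ^+ i *: g (p + r - i%:Z) (q + i%:Z)).
Proof.
move=> [Q gQ]; exists (absz (Q - q)) => i le_i; rewrite gQ ?scaler0 //; lia.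
Qed.

Lemma xyexp0 g p q : xyexp 0 g p q = g p q.
Proof. by rewrite /xyexp bsum0 scale1r subr0 !addr0. Qed.

Lemma xyexpS r g p q : up2 g -> xyexp (r + 1) g p q = xyexp r g (p + 1) q - xyexp r g p (q + 1).
Proof.
move=> g0; rewrite /xyexp bsumS; last exact: (xyexp_ev0 (r + 1)).
congr (_ + _).
  by apply: eq_bsum => i; congr (_ *: g _ _); lia.
rewrite -scaleN1r -bsumZ; last exact: xyexp_ev0.
by apply: eq_bsum => i; rewrite exprS -scalerA; congr (_ *: (_ *: g _ _)); lia.
Qed.

Lemma yxexp0 g p q : yxexp 0 g p q = g p q.
Proof. by rewrite /yxexp xyexp0 scale1r. Qed.

Lemma up_swap g : up1 g -> up2 (fun q p => g p q).
Proof. by move=> [P gP]; exists P => p q; exact: gP. Qed.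

Lemma yxexpS r g p q : up1 g -> yxexp (r + 1) g p q = yxexp r g (p + 1) q - yxexp r g p (q + 1).
Proof.
by move/up_swap=> g0; rewrite /yxexp xyexpS // sgnzS scaleNr scalerBr opprB.
Qed.

Lemma xyexp_eq r g g' p q : (forall p' q', p' <= p + r -> q <= q' -> g p' q' = g' p' q') ->
  xyexp r g p q = xyexp r g' p q.
Proof. by move=> gg'; apply: eq_bsum => i; rewrite gg' //; lia. Qed.

Lemma xyexp_eq0 r g p q : (forall p' q', p' <= p + r -> q <= q' -> g p' q' = 0) ->
  xyexp r g p q = 0.
Proof. by move=> g0; apply: bsum_eq0 => i; rewrite g0 ?scaler0 //; lia. Qed.

Lemma xyexpD r g g' p q : up2 g -> up2 g' ->
  xyexp r (fun p q => g p q + g' p q) p q = xyexp r g p q + xyexp r g' p q.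
Proof.
move=> g0 g0'; rewrite /xyexp -bsumD; [|exact: xyexp_ev0..].
by apply: eq_bsum => i; rewrite scalerDr.
Qed.
End TwoVariables.

Section TwoVariablesLinear.
Variable F : closedFieldType.

Lemma xyexp_lin (X Z : lmodType F) (f : X -> Z) r (g : int -> int -> X) p q : linmap f -> up2 g ->
  f (xyexp r g p q) = xyexp r (fun p q => f (g p q)) p q.
Proof.
move=> lf g0; rewrite /xyexp bsum_lin //; last exact: xyexp_ev0.
by apply: eq_bsum => i; rewrite linmapZ.
Qed.

Lemma xyexpZ (X : lmodType F) r c (g : int -> int -> X) p q : up2 g ->
  xyexp r (fun p q => c *: g p q) p q = c *: xyexp r g p q.
Proof. by move=> g0; rewrite (xyexp_lin (f := fun x => c *: x)) //; exact: linmap_scale. Qed.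

Lemma yxexp_lin (X Z : lmodType F) (f : X -> Z) r (g : int -> int -> X) p q : linmap f -> up1 g ->
  f (yxexp r g p q) = yxexp r (fun p q => f (g p q)) p q.
Proof. by move=> lf g0; rewrite /yxexp linmapZ // xyexp_lin //; exact: up_swap. Qed.

Lemma xyexpN (X : lmodType F) r (g : int -> int -> X) p q : up2 g ->
  xyexp r (fun p q => - g p q) p q = - xyexp r g p q.
Proof.
by move=> g0; rewrite -scaleN1r -xyexpZ //; apply: eq_bsum => i; rewrite scaleN1r.
Qed.

Lemma xyexp_comb (X : lmodType F) r c (g g' h : int -> int -> X) p q : up2 g -> up2 g' ->
  (forall p q, h p q = c *: g p q + g' p q) ->
  xyexp r h p q = c *: xyexp r g p q + xyexp r g' p q.
Proof.
move=> g0 g0' E; rewrite -xyexpZ // -xyexpD //; first by apply: xyexp_eq => *; exact: E.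
by have [Q H] := g0; exists Q => p' q' le_q; rewrite H // scaler0.
Qed.

Lemma yxexp_comb (X : lmodType F) r c (g g' h : int -> int -> X) p q : up1 g -> up1 g' ->
  (forall p q, h p q = c *: g p q + g' p q) ->
  yxexp r h p q = c *: yxexp r g p q + yxexp r g' p q.
Proof.
move=> g0 g0' E; rewrite /yxexp (xyexp_comb _ _ _ (up_swap g0) (up_swap g0') (fun q p => E p q)).
by rewrite scalerDr !scalerA mulrC.
Qed.
End TwoVariablesLinear.

(** * The Borcherds identity and its consequences *)

Section WeakModule.
Variables (F : closedFieldType) (V : lmodType F) (A : VOA V).
Local Notation "a _( k ) b" := (Y A k a b) (at level 9, k at level 99, b at level 9).

Section Modes.
Variables (M : lmodType F) (YM : int -> V -> M -> M).
Hypotheses (bilY : bilin YM) (truncY : truncation YM).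

Lemma mode_linr k a : linmap (YM k a).
Proof. by move=> c w w'; case: bilY => _ ->. Qed.

Lemma mode_linl k w : linmap (fun a => YM k a w).
Proof. by move=> c a b; case: bilY => ->. Qed.

Lemma mode_0r k a : YM k a 0 = 0.
Proof. exact/linmap0/mode_linr. Qed.

Lemma mode_0l k w : YM k 0 w = 0.
Proof. exact: (linmap0 (@mode_linl k w)). Qed.

Definition iterate3 (r p q : int) (u v : V) (w : M) : M :=
  bsum p (fun i => YM (p + q - i%:Z) (Y A (r + i%:Z) u v) w).

Lemma mode_up2 u v w : up2 (fun p q => YM p u (YM q v w)).
Proof. by have [Q HQ] := truncY v w; exists Q => p q /HQ ->; exact: mode_0r. Qed.

Lemma mode_up1 u v w : up1 (fun p q => YM q v (YM p u w)).
Proof. by have [Q HQ] := truncY u w; exists Q => p q /HQ ->; exact: mode_0r. Qed.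

Lemma iterate3_ev0 r p q u v w :
  ev0 (fun i : nat => YM (p + q - i%:Z) (Y A (r + i%:Z) u v) w).
Proof.
have [N HN] := VOA_trunc A u v; exists (absz (N - r)) => i le_i.
rewrite HN ?mode_0l //; lia.
Qed.

Lemma iterate3S r p q u v w :
  iterate3 r (p + 1) q u v w = iterate3 r p (q + 1) u v w + iterate3 (r + 1) p q u v w.
Proof.
rewrite /iterate3 bsumS; last exact: iterate3_ev0.
by congr (_ + _); apply: eq_bsum => i; congr (YM _ (Y A _ _ _) _); lia.
Qed.

Lemma iterate3_0 r q u v w : iterate3 r 0 q u v w = YM q (Y A r u v) w.
Proof. by rewrite /iterate3 bsum0 add0r subr0 addr0. Qed.

Definition commut2 (r p q : int) (u v : V) (w : M) : M :=
  xyexp r (fun p q => YM p u (YM q v w)) p q - yxexp r (fun p q => YM q v (YM p u w)) p q.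

Lemma commut2S r p q u v w :
  commut2 r (p + 1) q u v w = commut2 r p (q + 1) u v w + commut2 (r + 1) p q u v w.
Proof.
rewrite /commut2 xyexpS; last exact: mode_up2.
rewrite yxexpS; last exact: mode_up1.
by rewrite addrACA opprB addKr addrCA subrr addr0.
Qed.

Lemma iterate3_linl r p q v w : linmap (fun u => iterate3 r p q u v w).
Proof.
move=> c x y; have H := iterate3_ev0 r p q; rewrite /iterate3 -bsumZ // -bsumD //.
  by apply: eq_bsum => i; rewrite (proj1 (VOA_bilin A)); exact: mode_linl.
exact: (ev0Z (fun=> c) (H x v w)).
Qed.

Lemma iterate3_linr r p q u w : linmap (fun v => iterate3 r p q u v w).
Proof.
move=> c x y; have H := iterate3_ev0 r p q; rewrite /iterate3 -bsumZ // -bsumD //.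
  by apply: eq_bsum => i; rewrite (proj2 (VOA_bilin A)); exact: mode_linl.
exact: (ev0Z (fun=> c) (H u x w)).
Qed.

Lemma commut2_linl r p q v w : linmap (fun u => commut2 r p q u v w).
Proof.
move=> c x y; rewrite /commut2.
rewrite (xyexp_comb _ (c := c) _ _ (mode_up2 x v w) (mode_up2 y v w)) => [|p' q'].
  rewrite (yxexp_comb _ (c := c) _ _ (mode_up1 x v w) (mode_up1 y v w)) => [|p' q'].
    by rewrite scalerBr opprD addrACA.
  by rewrite (mode_linl _ _ c) (mode_linr _ _ c).
exact: mode_linl.
Qed.

Lemma commut2_linr r p q u w : linmap (fun v => commut2 r p q u v w).
Proof.
move=> c x y; rewrite /commut2.
rewrite (xyexp_comb _ (c := c) _ _ (mode_up2 u x w) (mode_up2 u y w)) => [|p' q'].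
  rewrite (yxexp_comb _ (c := c) _ _ (mode_up1 u x w) (mode_up1 u y w)) => [|p' q'].
    by rewrite scalerBr opprD addrACA.
  exact: mode_linl.
by rewrite (mode_linl _ _ c) (mode_linr _ _ c).
Qed.

Lemma borcherdsE : borcherds (Y A) YM <->
  forall p q r u v w, iterate3 r p q u v w = commut2 r p q u v w.
Proof.
suff E p q r u v w : isum (fun i => (((-1) ^+ i * binomZ r i)%:~R : F) *:
    (YM (p + r - i%:Z) u (YM (q + i%:Z) v w)
      - ((-1 : F) ^ r) *: YM (q + r - i%:Z) v (YM (p + i%:Z) u w))) = commut2 r p q u v w.
  by split=> H p q r u v w; [rewrite -E -H | rewrite E -H].
have [H1 H2] := (xyexp_ev0 r p q (mode_up2 u v w), xyexp_ev0 r q p (up_swap (mode_up1 u v w))).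
rewrite /commut2 /yxexp /xyexp /bsum -isumZ; last exact: (ev0Z _ H2).
rewrite -isumB; [|exact: ev0Z|exact/ev0Z/ev0Z].
apply: eq_isum => i; rewrite scalerBr rmorphM /= intr_sign !scalerA /sgnz.
by congr (_ *: _ - _ *: _); ring.
Qed.

(* The Borcherds identity propagates from [p = 0] (iterate formula) to all [p] by
   [x^(p+1) = x^p y + x^p (x-y)], locality starting the induction for [p < 0]. *)
Lemma borcherds_of_iterate :
  (forall u v w r q, YM q (Y A r u v) w = commut2 r 0 q u v w) ->
  (forall u v w, exists N, forall r p q, N <= r -> commut2 r p q u v w = 0) ->
  borcherds (Y A) YM.
Proof.
move=> H0 Hloc; apply/borcherdsE => p q r u v w; move: q r.
case: (lerP 0 p) => [|/ltW]; move: p.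
  apply: int_up => [q r|p _ IH q r]; first by rewrite iterate3_0 H0.
  by rewrite iterate3S commut2S !IH.
apply: int_down => [q r|p _ IH]; first by rewrite iterate3_0 H0.
move=> q r; move: r q; apply: int_desc => [|r IHr q].
  have [N HN] := Hloc u v w; have [N' HN'] := VOA_trunc A u v.
  exists (Num.max N N') => r; rewrite ge_max => /andP[Nr Nr'] q; rewrite HN // /iterate3.
  apply: bsum_eq0 => i; rewrite HN' ?mode_0l //; lia.
have := IH (q - 1) r; rewrite iterate3S commut2S subrK IHr.
exact: addIr.
Qed.

Hypothesis vacY : forall k w, YM k (vac A) w = if k == -1 then w else 0.
Hypothesis jacY : borcherds (Y A) YM.

Lemma jacobi p q r u v w : iterate3 r p q u v w = commut2 r p q u v w.
Proof. by move/borcherdsE: jacY; exact. Qed.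

Lemma mode_iterate r q u v w : YM q (Y A r u v) w = commut2 r 0 q u v w.
Proof. by rewrite -jacobi iterate3_0. Qed.

Lemma mode_commut p q u v w : YM p u (YM q v w) =
  YM q v (YM p u w) + bsum p (fun i => YM (p + q - i%:Z) (Y A i%:Z u v) w).
Proof.
have := jacobi p q 0 u v w; rewrite /commut2 xyexp0 yxexp0 => /eqP.
by rewrite eq_sym subr_eq addrC => /eqP ->; congr (_ + _).
Qed.

Lemma commut2_local u v : exists N, forall r p q w, N <= r -> commut2 r p q u v w = 0.
Proof.
have [N HN] := VOA_trunc A u v; exists N => r p q w le_Nr; rewrite -jacobi.
by apply: bsum_eq0 => i; rewrite HN ?mode_0l //; lia.
Qed.

(** This is what reduces products of modes to single modes. For large [q] the product is zero; below
    that, the Borcherds identity writes it as a combination of iterates $(u_iv)_jw$ and of products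
    with a larger second index. The sum of the two indices never changes, which keeps track of
    degrees. *)
Lemma mode_assoc_span (S : M -> Prop) p q u v w : subspace S ->
  (forall i j, i + j = p + q -> S (YM j (Y A i u v) w)) -> S (YM p u (YM q v w)).
Proof.
move=> hS; move sE: (p + q) => s H.
have [Pu HPu] := truncY u w; have [Qv HQv] := truncY v w.
suff: forall q q' p, q <= q' -> p + q' = s -> S (YM p u (YM q' v w)) by move=> /(_ q q p); exact.
move=> {p q sE}; apply: int_desc => [|q IH q' p le_q pq].
  exists Qv => q lq q' p le_q _; rewrite HQv ?mode_0r; first exact: subspace0.
  exact: le_trans le_q.
case: (ltrgtP q q') le_q => // [lt_q _|eq_q _]; first by apply: IH; lia.
(* With first exponent [Pu] every term containing $u_{p'}w$, $p'\ge$ [Pu], vanishes; the exponent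
   [p - Pu] of $x-y$ makes $u_pv_{q'}w$ the leading term of the remaining expansion. *)
have := jacobi Pu q' (p - Pu) u v w; rewrite /commut2.
rewrite [X in _ = _ - X](_ : _ = 0); last first.
  rewrite /yxexp xyexp_eq0 ?scaler0 // => p' q'' _ le_Pu; rewrite HPu ?mode_0r //.
rewrite subr0 /xyexp /bsum.
have h0 := xyexp_ev0 (p - Pu) Pu q' (mode_up2 u v w).
rewrite isum_rec; last exact: ev0Z.
rewrite binomZ0 !scale1r subr0 addr0; have pE : Pu + (p - Pu) = p by lia.
rewrite pE in h0 *.
move=> /esym/(canRL (addrK _)) ->; apply: subspaceB => //.
  apply: subspace_isum => //; first exact/ev0Z/iterate3_ev0.
  by move=> i; apply: subspaceZ => //; apply: H; lia.
apply: subspace_isum => //; first exact: (ev0S (ev0Z (fun i => (binomZ (p - Pu) i)%:~R : F) h0)).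
by move=> i; do 2! apply: subspaceZ => //; apply: IH; lia.
Qed.

(** The vector $a_{-1-i}\mathbf 1$ stands for $L(-1)^ia/i!$, so this is a divided derivative of
    $Y(a,x)$. The iterate formula with the vacuum as second vector gives it without dividing by
    $i!$; a single vacuum mode survives, in the first expansion if $k<0$ and in the second if $0\le
    i\le k$. *)
Lemma mode_deriv k i a w :
  YM k (Y A (- 1 - i%:Z) a (vac A)) w = (((-1) ^+ i * binomZ k i)%:~R : F) *: YM (k - i%:Z) a w.
Proof.
rewrite mode_iterate /commut2.
have [lt_k0|le0k] := ltrP k 0.
  rewrite [X in _ - X](_ : _ = 0) ?subr0; last first.
    rewrite /yxexp xyexp_eq0 ?scaler0 // => p q le_p le_q; rewrite vacY ifF //.
    by apply/eqP; lia.
  rewrite /xyexp /bsum (isum1 (j := absz (k + 1))) => [|j neq_j]; last first.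
    by rewrite vacY ifF ?mode_0r ?scaler0 //; apply/eqP; lia.
  rewrite vacY ifT; last by apply/eqP; lia.
  rewrite scalerA -intr_sign -rmorphM /= mulrC; congr (_%:~R *: YM _ _ _); last lia.
  have := @binomZ_neg_sym k (- 1 - i%:Z) lt_k0; have -> : absz (- 1 - i%:Z + 1) = i by lia.
  by apply; lia.
rewrite [X in X - _](_ : _ = 0); last first.
  rewrite xyexp_eq0 // => p q _ le_q; rewrite vacY ifF ?mode_0r //; apply/eqP; lia.
rewrite sub0r /yxexp /xyexp /bsum; have [lt_ki|le_ik] := ltrP k i%:Z.
  rewrite binomZ_small // mulr0 scale0r isum0 ?scaler0 ?oppr0 // => j.
  rewrite vacY ifF ?scaler0 //; apply/eqP; lia.
rewrite (isum1 (j := absz (k - i%:Z))) => [|j neq_j]; last first.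
  by rewrite vacY ifF ?scaler0 //; apply/eqP; lia.
rewrite vacY ifT; last by apply/eqP; lia.
rewrite !scalerA -scaleNr; congr (_ *: YM _ _ _); last lia.
rewrite binomZ_neg; last lia.
rewrite [X in _ = X]rmorphM /= !rmorphM /= !intr_sign.
have -> : k = Posz (i + absz (k - i%:Z))%N by lia.
rewrite binomZ_nat; have -> : absz (Posz (i + absz (k - i%:Z))%N - i%:Z) = absz (k - i%:Z) by lia.
set j := absz _; have -> : (absz (- 1 - i%:Z)%R).-1 = i by lia.
rewrite -[in RHS]bin_sub ?leq_addr // addKn.
have -> : sgnz F (- 1 - i%:Z) = - (-1) ^+ i.
  rewrite sgnz_absz; have -> : absz (- 1 - i%:Z)%R = i.+1 by lia.
  by rewrite exprS mulN1r.
rewrite !mulNr opprK -!mulrA; congr (_ * _).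
by rewrite [_%:~R * _]mulrC signrMK.
Qed.
End Modes.

Lemma VOA_weak_module : weak_module A (Y A).
Proof.
split; [exact: VOA_bilin | exact: VOA_trunc | exact: VOA_vacuum | exact: VOA_jacobi].
Qed.

(** Skew-symmetry $Y(b,x)a=e^{xL(-1)}Y(a,-x)b$, with the modes $(\cdot)_{-1-i}\mathbf 1$ as divided
    powers of $L(-1)$, hence valid in every characteristic. *)
Lemma VOA_skew m a b : Y A m b a =
  - sgnz F m *: isum (fun i => (-1) ^+ i *: Y A (- 1 - i%:Z) (Y A (m + i%:Z) a b) (vac A)).
Proof.
have [bY tY vY jY] := VOA_weak_module; have [cr0 cr1] := VOA_creation A.
(* On the vacuum nonnegative modes vanish: $q=0$ kills one expansion, and $p=-1$ leaves the single
   term $b_ma_{-1}\mathbf 1=b_ma$ of the other. *)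
have := jacobi bY tY jY (-1) 0 m a b (vac A); rewrite /commut2.
rewrite xyexp_eq0 ?sub0r => [|p q _ le_q]; last by rewrite cr0 ?(mode_0r bY).
rewrite /yxexp /xyexp /bsum (isum1 (j := 0%N)) => [|i i0]; last first.
  by rewrite (cr0 (-1 + i%:Z)) ?(mode_0r bY) ?scaler0 //; lia.
rewrite binomZ0 !scale1r subr0 addr0 add0r cr1 => E.
have -> : Y A m b a = - sgnz F m *: (- (sgnz F m *: Y A m b a)).
  by rewrite scaleNr scalerN opprK scalerA sgnzK scale1r.
rewrite -E !scaleNr.
congr (- (_ *: _)); apply: eq_isum => i.
by rewrite addr0 binomZ_neg // /= binn mulr1 intr_sign.
Qed.

Lemma om0E a : Y A 0 (om A) a = Y A (-2) a (vac A).
Proof.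
have := VOA_deriv A (-1) a (vac A); case: (VOA_creation A) => _ ->.
by rewrite opprK scale1r.
Qed.

Lemma Lop_lin k : linmap (Lop A k).
Proof. exact/mode_linr/VOA_bilin. Qed.

Lemma circ_bsum n s t d a b : circ A n s t d a b =
  bsum (d + n%:Z + s%:Z) (fun i => Y A (- Posz (2 * n + 2 + t)%N + i%:Z) a b).
Proof. by apply: eq_isum => i; congr (_ *: Y A _ _ _); lia. Qed.

Lemma VOA_mode_ev0 m a b : ev0 (fun i : nat => Y A (m + i%:Z) a b).
Proof. by apply: (ev0_int (h := fun k => Y A k a b)); exact: VOA_trunc. Qed.

Lemma circ_lin n s t d a : linmap (circ A n s t d a).
Proof.
move=> c b b'; rewrite !circ_bsum -bsumZ -?bsumD.
- by apply: eq_bsum => i; rewrite (mode_linr (VOA_bilin A)).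
- exact: (ev0Z (fun=> c) (VOA_mode_ev0 _ a b)).
- exact: VOA_mode_ev0.
- exact: VOA_mode_ev0.
Qed.

(** [ow] plays the role of $a\mapsto o(a)w$, which is prescribed on homogeneous vectors and extended
    linearly. The lemma is later applied with $n-1$ in place of $n$, to exploit that [U] does not
    factor. *)
Lemma Omega_On_zero n (M : lmodType F) (YM : int -> V -> M -> M) w (ow : V -> M) :
  weak_module A YM -> Omega A n YM w -> linmap ow ->
  (forall d a, Vgr A d a -> ow a = YM (d - 1) a w) -> forall x, On A n x -> ow x = 0.
Proof.
move=> [bY tY vY jY] Ow low owE; apply: span_min; first exact: linmap_ker.
move=> _ [[a ->]|[d [a [b [s [t [da st ->]]]]]]].
  rewrite linmapD //; apply/eqP; rewrite -[X in _ + X]opprK subr_eq0; apply/eqP.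
  pattern a; apply: (graded_ind (VOA_graded A)).
    apply: linmap_eqsub => c x y.
      by rewrite (Lop_lin _ c) low.
    by rewrite (Lop_lin _ c) low scalerN opprD.
  move=> d {}a da; rewrite /Lop addNr add0r om0E.
  rewrite (VOA_L0 da) (owE (d + 1)).
    rewrite addrK (mode_deriv bY tY vY jY _ 1) linmapZ // (owE _ _ da) expr1 mulN1r.
    by rewrite binomZ1 rmorphN scaleNr.
  by have := VOA_mode_deg (-2) da (VOA_vac_deg A); rewrite addr0 opprK -addrA.
pattern b; apply: (graded_ind (VOA_graded A)).
  apply: linmap_ker => c x y; rewrite circ_lin low //.
move=> e {}b eb; rewrite circ_bsum bsum_lin //; last exact: VOA_mode_ev0.
(* The exponents are forced: $p=d+n+s$ and $r=-(2n+2+t)$ are those of the circle product, and $q$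
   makes every iterate mode equal to $o(a_{r+i}b)$. Then $p\ge d+n$, and $s\le t$ gives $q\ge e+n$,
   so both expansions vanish on $\Omega_n$. *)
have := jacobi bY tY jY (d + n%:Z + s%:Z) (e + n%:Z + t%:Z - s%:Z) (- Posz (2 * n + 2 + t)%N) a b w.
rewrite /commut2 xyexp_eq0 => [|p q _ le_q]; last by rewrite (Ow _ _ _ eb) ?(mode_0r bY) //; lia.
rewrite /yxexp xyexp_eq0 ?scaler0 ?subr0 => [|p q _ le_q]; last first.
  by rewrite (Ow _ _ _ da) ?(mode_0r bY) //; lia.
move=> <-; apply: eq_bsum => i; rewrite (owE _ _ (VOA_mode_deg _ da eb)).
by congr (YM _ _ _); lia.
Qed.
End WeakModule.

(** * Residues at 0 and at -1 *)

Section Bounds.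
Lemma lower_bound_nat (Q : nat -> int -> Prop) :
  (forall j, exists M, forall m, m <= M -> Q j m) ->
  forall J, exists M, forall m j, m <= M -> (j < J)%N -> Q j m.
Proof.
move=> H; elim=> [|J [M HM]]; first by exists 0.
have [M' HM'] := H J; exists (Num.min M M') => m j; rewrite le_min => /andP[? ?].
by rewrite ltnS leq_eqVlt => /orP[/eqP ->|?]; [exact: HM' | exact: HM].
Qed.

Lemma upper_bound_nat (Q : nat -> int -> Prop) :
  (forall j, exists M, forall m, M <= m -> Q j m) ->
  forall J, exists M, forall m j, M <= m -> (j < J)%N -> Q j m.
Proof.
move=> H; elim=> [|J [M HM]]; first by exists 0.
have [M' HM'] := H J; exists (Num.max M M') => m j; rewrite ge_max => /andP[? ?].
by rewrite ltnS leq_eqVlt => /orP[/eqP ->|?]; [exact: HM' | exact: HM].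
Qed.

Lemma int_ind0 (P : int -> Prop) :
  P 0 -> (forall m, P m -> P (m + 1)) -> (forall m, P (m + 1) -> P m) -> forall m, P m.
Proof.
move=> P0 up down m; case: (lerP 0 m) => [|/ltW]; move: m.
  by apply: int_up => // m _; exact: up.
by apply: int_down => // m _; exact: down.
Qed.

Lemma int_desc2 (Z : int -> int -> Prop) :
  (forall q, exists p0, forall p q', p0 <= p -> q <= q' -> Z p q') ->
  (forall p, exists q0, forall p' q, q0 <= q -> p <= p' -> Z p' q) ->
  (forall p q, Z (p + 1) q -> Z p (q + 1) -> Z p q) -> forall p q, Z p q.
Proof.
move=> T1 T2 step p0 q0; suff: forall q, forall p q', p0 <= p -> q <= q' -> Z p q' by apply.
apply: int_desc => [|q IH].
  have [q1 H] := T2 p0; exists q1 => q le_q p q' le_p le_q'.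
  by apply: H => //; exact: le_trans le_q'.
suff Hq: forall p, p0 <= p -> Z p q.
  move=> p q' le_p; rewrite le_eqVlt => /orP[/eqP <-|lt_q]; first exact: Hq.
  by apply: IH => //; lia.
apply: int_desc => [|p IHp le_p].
  by have [p1 H] := T1 q; exists p1 => p le_p _; exact: H.
by apply: step; [apply: IHp; lia | apply: IH => //; lia].
Qed.
End Bounds.

Section Latticecomb.
Variable F : closedFieldType.
Implicit Types X Z : lmodType F.

Lemma lat_comb X c (T T' : int -> int -> X) : lat T -> lat T' ->
  lat (fun m k => c *: T m k + T' m k).
Proof. by move=> lT lT' m k; rewrite lT lT' scalerDr addrACA. Qed.

Lemma lat_lin X Z (f : X -> Z) (T : int -> int -> X) : linmap f -> lat T ->
  lat (fun m k => f (T m k)).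
Proof. by move=> lf lT m k; rewrite lT linmapD. Qed.

Lemma xyexp_shift1 X r (g : int -> int -> X) p q :
  xyexp r g (p + 1) q = xyexp r (fun p q => g (p + 1) q) p q.
Proof. by apply: eq_bsum => i; congr (_ *: g _ _); lia. Qed.

Lemma xyexp_shift2 X r (g : int -> int -> X) p q :
  xyexp r g p (q + 1) = xyexp r (fun p q => g p (q + 1)) p q.
Proof. by apply: eq_bsum => i; congr (_ *: g _ _); lia. Qed.

Lemma yxexp_eq0 X r (g : int -> int -> X) p q :
  (forall p' q', p <= p' -> q' <= q + r -> g p' q' = 0) -> yxexp r g p q = 0.
Proof. by move=> g0; rewrite /yxexp xyexp_eq0 ?scaler0 // => p' q' ? ?; exact: g0. Qed.
End Latticecomb.

Section VOAWeights.
Variables (F : closedFieldType) (V : lmodType F) (A : VOA V).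

(* residue at 0 of [x^m (1+x)^k Y(a,x)b] *)
Definition Vm (a : V) (m k : int) (b : V) : V := bsum k (fun i => Y A (m + i%:Z) a b).

Lemma Vm0 a m b : Vm a m 0 b = Y A m a b.
Proof. by rewrite /Vm bsum0 addr0. Qed.

Lemma Vm_lat a b : lat (fun m k => Vm a m k b).
Proof.
move=> m k; rewrite /Vm bsumS; last exact: VOA_mode_ev0.
by congr (_ + _); apply: eq_bsum => i; congr (Y A _ _ _); lia.
Qed.

Lemma Vm_top a b : exists m0, forall m k, m0 <= m -> Vm a m k b = 0.
Proof.
have [m0 H] := VOA_trunc A a b; exists m0 => m k le_m; apply: bsum_eq0 => i.
by apply: H; lia.
Qed.

Lemma Vm_linr a m k : linmap (Vm a m k).
Proof.
move=> c b b'; rewrite /Vm -bsumZ -?bsumD.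
- by apply: eq_bsum => i; rewrite (mode_linr (VOA_bilin A)).
- exact: (ev0Z (fun=> c) (VOA_mode_ev0 A m a b)).
- exact: VOA_mode_ev0.
- exact: VOA_mode_ev0.
Qed.

Lemma Vm_linl m k b : linmap (fun a => Vm a m k b).
Proof.
move=> c a a'; rewrite /Vm -bsumZ -?bsumD.
- by apply: eq_bsum => i; rewrite (mode_linl (VOA_bilin A)).
- exact: (ev0Z (fun=> c) (VOA_mode_ev0 A m a b)).
- exact: VOA_mode_ev0.
- exact: VOA_mode_ev0.
Qed.

Lemma Vm0r a m k : Vm a m k 0 = 0.
Proof. exact/linmap0/Vm_linr. Qed.

(** The residue of $x^m(1+x)^k$ at 0. *)
Definition vacweight (m k : int) : int := if m < 0 then binomZ k (absz (m + 1)) else 0.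

Lemma Vm_vac m k b : Vm (vac A) m k b = (vacweight m k)%:~R *: b.
Proof.
rewrite /vacweight; case: ltrP => [lt_m0|le0m]; last first.
  rewrite scale0r; apply: bsum_eq0 => i; rewrite VOA_vacuum ifF //; apply/eqP; lia.
rewrite /Vm /bsum (isum1 (j := absz (m + 1))) => [|i neq_i]; last first.
  by rewrite VOA_vacuum ifF ?scaler0 //; apply/eqP; lia.
by rewrite VOA_vacuum ifT //; apply/eqP; lia.
Qed.

Lemma vacweight_lat m k : vacweight m (k + 1) = vacweight m k + vacweight (m + 1) k.
Proof.
rewrite /vacweight; case: (ltrP m 0) => [lt_m|le_m]; last by rewrite ifF ?addr0 //; lia.
case: ltrP => [lt_m1|le_m1].
  have -> : absz (m + 1) = (absz (m + 1 + 1)).+1 by lia.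
  exact: binomZS.
have -> : absz (m + 1) = 0%N by lia.
by rewrite !binomZ0 addr0.
Qed.
End VOAWeights.

(* [E] is a space of [U]-valued functionals on [V] ("three-point functions" with the argument
   inserted at 0, the element of [E] at -1, and a bounded pole at infinity).  [Dm a m k e] is the
   residue at -1 of [x^m (1+x)^k Y(a,x)]; by the residue theorem it cancels the residue at 0
   as soon as the weight kills the pole at infinity. *)
Section FunctionalModule.
Variables (F : closedFieldType) (V : lmodType F) (A : VOA V) (U E : lmodType F).
Variables (ev : E -> V -> U) (Dm : V -> int -> int -> E -> E).
Hypotheses (ev_linl : forall b, linmap (fun e => ev e b)) (ev_linr : forall e, linmap (ev e))
  (ev_inj : forall e e', (forall b, ev e b = ev e' b) -> e = e')
  (Dm_lat : forall a e, lat (fun m k => Dm a m k e))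
  (Dm_top : forall a e, exists l, forall m k, l <= k -> Dm a m k e = 0)
  (Dm_inf : forall a e k, exists M, forall m b, m <= M ->
     ev (Dm a m k e) b = - ev e (Vm A a m k b)).
Local Notation Vm := (Vm A).

(** Residues at -1 are pinned down by the Pascal rule, vanishing for large $k$, and the residue
    theorem for very negative $m$. Linearity, the vacuum axiom and the iterate formula for [Dm] are
    all proved by exhibiting a candidate [T] with these properties. *)
Lemma Dm_uniq a e b (T : int -> int -> U) : lat T ->
  (exists l, forall m k, l <= k -> T m k = 0) ->
  (forall k, exists M, forall m, m <= M -> T m k = - ev e (Vm a m k b)) ->
  forall m k, T m k = ev (Dm a m k e) b.
Proof.
move=> lT [l Tl] Tinf; apply: lat_eq_desc => //.
- exact: (lat_lin (ev_linl b) (Dm_lat a e)).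
- have [l' Dl'] := Dm_top a e; exists (Num.max l l') => m k; rewrite ge_max => /andP[? ?].
  by rewrite Tl // Dl' // (linmap0 (ev_linl b)).
- move=> k; have [M HM] := Tinf k; have [M' HM'] := Dm_inf a e k.
  by exists (Num.min M M') => m; rewrite le_min => /andP[? ?]; rewrite HM // HM'.
Qed.

Lemma Dm_linr a m k : linmap (Dm a m k).
Proof.
move=> c e e'; apply: ev_inj => b; rewrite (ev_linl b).
pose T m k := c *: ev (Dm a m k e) b + ev (Dm a m k e') b.
rewrite -[RHS]/(T m k); apply/esym/Dm_uniq; rewrite {}/T.
- exact: (lat_comb _ (lat_lin (ev_linl b) (Dm_lat a e)) (lat_lin (ev_linl b) (Dm_lat a e'))).
- have [l Dl] := Dm_top a e; have [l' Dl'] := Dm_top a e'.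
  exists (Num.max l l') => m' k'; rewrite ge_max => /andP[? ?].
  by rewrite Dl // Dl' // (linmap0 (ev_linl b)) scaler0 addr0.
- move=> k'; have [M HM] := Dm_inf a e k'; have [M' HM'] := Dm_inf a e' k'.
  exists (Num.min M M') => m'; rewrite le_min => /andP[? ?].
  by rewrite HM // HM' // (ev_linl _) scalerN opprD.
Qed.

Lemma Dm_linl m k e : linmap (fun a => Dm a m k e).
Proof.
move=> c a a'; apply: ev_inj => b; rewrite (ev_linl b).
pose T m k := c *: ev (Dm a m k e) b + ev (Dm a' m k e) b.
rewrite -[RHS]/(T m k); apply/esym/Dm_uniq; rewrite {}/T.
- exact: (lat_comb _ (lat_lin (ev_linl b) (Dm_lat a e)) (lat_lin (ev_linl b) (Dm_lat a' e))).
- have [l Dl] := Dm_top a e; have [l' Dl'] := Dm_top a' e.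
  exists (Num.max l l') => m' k'; rewrite ge_max => /andP[? ?].
  by rewrite Dl // Dl' // (linmap0 (ev_linl b)) scaler0 addr0.
- move=> k'; have [M HM] := Dm_inf a e k'; have [M' HM'] := Dm_inf a' e k'.
  exists (Num.min M M') => m'; rewrite le_min => /andP[? ?].
  by rewrite HM // HM' // (Vm_linl A _ _ _ c) ev_linr scalerN opprD.
Qed.

Lemma Dm0r a m k : Dm a m k 0 = 0.
Proof. exact/linmap0/Dm_linr. Qed.

Lemma Dm_vac k e : Dm (vac A) 0 k e = if k == -1 then e else 0.
Proof.
(* The candidate is the residue of $x^m(1+x)^k$ at -1 times the value of [e] at [b]. *)
apply: ev_inj => b; pose T m k := (sgnz F (m + k + 1) * (vacweight k m)%:~R) *: ev e b.
rewrite -(@Dm_uniq (vac A) e b T) /T.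
- rewrite /vacweight; case: ltrP => [lt_k0|le0k]; last first.
    by rewrite mulr0 scale0r ifF ?(linmap0 (ev_linl b)) //; apply/eqP; lia.
  case: eqP => [->|neq_k].
    by rewrite binomZ0 mulr1 [X in sgnz F X](_ : _ = 0) // scale1r.
  rewrite binomZ_small // ?mulr0 ?scale0r ?(linmap0 (ev_linl b)) //; lia.
- move=> m' k'; rewrite -scalerDl; congr (_ *: _).
  rewrite [vacweight k' (m' + 1)]vacweight_lat rmorphD /=.
  have -> : m' + (k' + 1) + 1 = m' + k' + 1 + 1 by lia.
  have -> : m' + 1 + k' + 1 = m' + k' + 1 + 1 by lia.
  by rewrite (sgnzS _ (m' + k' + 1)) mulrDr !mulNr addNKr.
- by exists 0 => m' k' le0k; rewrite /vacweight ifF ?mulr0 ?scale0r //; lia.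
(* $m+k\le-2$ is the condition for $x^m(1+x)^k\,dx$ to have no residue at infinity. *)
move=> k'; exists (Num.min (-1) (- 2%:Z - k')) => m'; rewrite le_min => /andP[lt_m lt_mk].
rewrite Vm_vac (linmapZ (ev_linr e)) -scaleNr /vacweight; congr (_ *: _).
case: (ltrP k' 0) => [lt_k|le_k]; last first.
  by rewrite mulr0 ifT ?binomZ_small ?oppr0 //; lia.
rewrite ifT; last lia.
have -> : m' + k' + 1 = (m' + 1) + k' by lia.
have sE i : sgnz F i = ((-1) ^+ absz i)%:~R by rewrite intr_sign sgnz_absz.
have symE : sgnz F (m' + 1) * (binomZ k' (absz (m' + 1)))%:~R =
         sgnz F (k' + 1) * (binomZ m' (absz (k' + 1)))%:~R.
  by rewrite !sE -!rmorphM; congr (_%:~R); apply: binomZ_neg_sym; lia.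
have -> : (binomZ k' (absz (m' + 1)))%:~R =
    sgnz F (m' + 1) * (sgnz F (m' + 1) * (binomZ k' (absz (m' + 1)))%:~R).
  by rewrite mulrA sgnzK mul1r.
by rewrite symE sgnzD [sgnz F (k' + 1)]sgnzS !mulNr mulrN opprK mulrA.
Qed.

(** By the Pascal rule, neighbours in row $k$ are opposite modulo row $k+1$; once that row lies in
    [S], one entry of row $k$ decides the whole row. *)
Lemma Dm_ext_m (S : E -> Prop) u e k : subspace S ->
  (forall m, S (Dm u m (k + 1) e)) -> S (Dm u 0 k e) -> forall m, S (Dm u m k e).
Proof.
move=> hS Sk S0; apply: int_ind0 => // m.
  have /lat_dlat -> := Dm_lat u e; exact: subspaceB.
have -> : Dm u m k e = Dm u m (k + 1) e - Dm u (m + 1) k e by rewrite Dm_lat addrK.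
exact: subspaceB.
Qed.

(** The point is uniformity in [m1]. Rows [k1] and above are spanned by the finitely many elements
    [Dm u 0 k e] with [k1] $\le k<l$, so finitely many bounds are combined. *)
Lemma Dm_inf2 u v e k1 k2 : exists M, forall m2 m1 c, m2 <= M ->
  ev (Dm v m2 k2 (Dm u m1 k1 e)) c = - ev (Dm u m1 k1 e) (Vm v m2 k2 c).
Proof.
move: k1; apply: int_desc => [|k1 [M HM]].
  have [l Dl] := Dm_top u e; exists l => k1 le_k; exists 0 => m2 m1 c _.
  by rewrite Dl // Dm0r !(linmap0 (ev_linl _)) oppr0.
have [M' HM'] := Dm_inf v (Dm u 0 k1 e) k2.
exists (Num.min M M') => m2 m1 c; rewrite le_min => /andP[le_M le_M']; move: m1.
apply: (@Dm_ext_m (fun g => ev (Dm v m2 k2 g) c = - ev g (Vm v m2 k2 c))).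
- split=> [|g g' Hg Hg'|a g Hg].
  + by rewrite Dm0r !(linmap0 (ev_linl _)) oppr0.
  + by rewrite (linmapD (Dm_linr _ _ _)) !(linmapD (ev_linl _)) Hg Hg' opprD.
  + by rewrite (linmapZ (Dm_linr _ _ _)) !(linmapZ (ev_linl _)) Hg scalerN.
- by move=> m; exact: HM.
- exact: HM'.
Qed.

Lemma Dm_top2 u v e k1 : exists K, forall m2 k2 m1 k1', K <= k2 -> k1 <= k1' ->
  Dm v m2 k2 (Dm u m1 k1' e) = 0.
Proof.
move: k1; apply: int_desc => [|k1 [K HK]].
  have [l Dl] := Dm_top u e; exists l => k1 le_k; exists 0 => m2 k2 m1 k1' _ le_k'.
  by rewrite Dl ?Dm0r //; lia.
have [K' HK'] := Dm_top v (Dm u 0 k1 e).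
exists (Num.max K K') => m2 k2 m1 k1'; rewrite ge_max => /andP[le_K le_K'].
rewrite le_eqVlt => /orP[/eqP <-|lt_k]; last by apply: HK => //; lia.
move: m1; apply: (@Dm_ext_m (fun g => Dm v m2 k2 g = 0)).
- exact: (linmap_ker (Dm_linr v m2 k2)).
- by move=> m; apply: HK => //; lia.
- exact: HK'.
Qed.

Section ThreePoint.
Variable e : E.

(** Each passage from 0 to -1 costs a sign and moves an operator from the argument to the
    functional. This reverses the order of composition: [u], outermost in [s1], is applied first in
    [bb]. Once $x$ is at -1, $(x-y)^r=((1+x)-(1+y))^r$ is expanded in nonnegative powers of $1+x$,
    which is finite by [Dm_top]. *)
Let s1 u v c m1 k1 m2 k2 := ev e (Vm u m1 k1 (Vm v m2 k2 c)).
Let md u v c m1 k1 m2 k2 := ev (Dm u m1 k1 e) (Vm v m2 k2 c).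
Let bb u v c m1 k1 m2 k2 := ev (Dm v m2 k2 (Dm u m1 k1 e)) c.

(* [res00]: both variables near 0, [|x| > |y|]; [res10]: [x] near -1, [y] near 0;
   [res11]: both near -1, [|1+y| > |1+x|]. *)
Definition res00 u v c r m1 k1 m2 k2 := xyexp r (fun m1 m2 => s1 u v c m1 k1 m2 k2) m1 m2.
Definition res10 u v c r m1 k1 m2 k2 := yxexp r (fun k1 k2 => md u v c m1 k1 m2 k2) k1 k2.
Definition res11 u v c r m1 k1 m2 k2 := yxexp r (fun k1 k2 => bb u v c m1 k1 m2 k2) k1 k2.

Lemma s1_up2 u v c k1 k2 : up2 (fun m1 m2 => s1 u v c m1 k1 m2 k2).
Proof.
have [m0 H] := Vm_top A v c; exists m0 => m1 m2 /H E0.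
by rewrite /s1 E0 Vm0r (linmap0 (ev_linr e)).
Qed.

Lemma md_up1 u v c m1 m2 : up1 (fun k1 k2 => md u v c m1 k1 m2 k2).
Proof.
have [l H] := Dm_top u e; exists l => k1 k2 le_k.
by rewrite /md H // (linmap0 (ev_linl _)).
Qed.

Lemma bb_up1 u v c m1 m2 : up1 (fun k1 k2 => bb u v c m1 k1 m2 k2).
Proof.
have [l H] := Dm_top u e; exists l => k1 k2 le_k.
by rewrite /bb H // Dm0r (linmap0 (ev_linl _)).
Qed.

Lemma s1_latl u v c m2 k2 : lat (fun m1 k1 => s1 u v c m1 k1 m2 k2).
Proof. exact: (lat_lin (ev_linr e) (Vm_lat A u _)). Qed.

Lemma s1_latr u v c m1 k1 : lat (fun m2 k2 => s1 u v c m1 k1 m2 k2).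
Proof.
move=> m2 k2; rewrite /s1 (Vm_lat A v) (linmapD (Vm_linr A _ _ _)).
exact: (linmapD (ev_linr e)).
Qed.

Lemma bb_latl u v c m2 k2 : lat (fun m1 k1 => bb u v c m1 k1 m2 k2).
Proof.
move=> m1 k1; rewrite /bb Dm_lat (linmapD (Dm_linr _ _ _)).
exact: (linmapD (ev_linl c)).
Qed.

Lemma bb_latr u v c m1 k1 : lat (fun m2 k2 => bb u v c m1 k1 m2 k2).
Proof. exact: (lat_lin (ev_linl c) (Dm_lat v _)). Qed.

Lemma res00_latl u v c r m2 k2 : lat (fun m1 k1 => res00 u v c r m1 k1 m2 k2).
Proof.
move=> m1 k1; rewrite /res00 xyexp_shift1 -xyexpD; [|exact: s1_up2|].
  by apply: xyexp_eq => p q _ _; rewrite s1_latl.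
by have [Q H] := s1_up2 u v c k1 k2; exists Q => p q; exact: H.
Qed.

Lemma res00_latr u v c r m1 k1 : lat (fun m2 k2 => res00 u v c r m1 k1 m2 k2).
Proof.
move=> m2 k2; rewrite /res00 xyexp_shift2 -xyexpD; [|exact: s1_up2|].
  by apply: xyexp_eq => p q _ _; rewrite s1_latr.
have [Q H] := s1_up2 u v c k1 k2; exists Q => p q le_q; apply: H; lia.
Qed.

Lemma yxexp_lat1 (g : int -> int -> int -> U) r p q :
  (forall m, up1 (g m)) -> (forall m k1 k2, g m (k1 + 1) k2 = g m k1 k2 + g (m + 1) k1 k2) ->
  forall m, yxexp r (g m) (p + 1) q = yxexp r (g m) p q + yxexp r (g (m + 1)) p q.
Proof.
move=> g0 gS m; rewrite /yxexp xyexp_shift2 -scalerDr -xyexpD; [|exact: up_swap..].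
by congr (_ *: _); apply: xyexp_eq => q' p' _ _; exact: gS.
Qed.

Lemma yxexp_lat2 (g : int -> int -> int -> U) r p q :
  (forall m, up1 (g m)) -> (forall m k1 k2, g m k1 (k2 + 1) = g m k1 k2 + g (m + 1) k1 k2) ->
  forall m, yxexp r (g m) p (q + 1) = yxexp r (g m) p q + yxexp r (g (m + 1)) p q.
Proof.
move=> g0 gS m; rewrite /yxexp xyexp_shift1 -scalerDr -xyexpD; [|exact: up_swap..].
by congr (_ *: _); apply: xyexp_eq => q' p' _ _; exact: gS.
Qed.

Lemma res11_latl u v c r m2 k2 : lat (fun m1 k1 => res11 u v c r m1 k1 m2 k2).
Proof.
move=> m1 k1; apply: (yxexp_lat1 (g := fun m1 k1 k2 => bb u v c m1 k1 m2 k2)).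
  by move=> m; exact: bb_up1.
by move=> m k k'; exact: bb_latl.
Qed.

Lemma res11_latr u v c r m1 k1 : lat (fun m2 k2 => res11 u v c r m1 k1 m2 k2).
Proof.
move=> m2 k2; apply: (yxexp_lat2 (g := fun m2 k1 k2 => bb u v c m1 k1 m2 k2)).
  by move=> m; exact: bb_up1.
by move=> m k k'; exact: bb_latr.
Qed.

Lemma res00S u v c r m1 k1 m2 k2 : res00 u v c (r + 1) m1 k1 m2 k2 =
  res00 u v c r (m1 + 1) k1 m2 k2 - res00 u v c r m1 k1 (m2 + 1) k2.
Proof. by rewrite /res00 xyexpS //; exact: s1_up2. Qed.

Lemma res00Sk u v c r m1 k1 m2 k2 : res00 u v c (r + 1) m1 k1 m2 k2 =
  res00 u v c r m1 (k1 + 1) m2 k2 - res00 u v c r m1 k1 m2 (k2 + 1).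
Proof.
rewrite res00S (res00_latl u v c r m2 k2) (res00_latr u v c r m1 k1).
by rewrite opprD addrACA subrr add0r.
Qed.

Lemma res10Sk u v c r m1 k1 m2 k2 : res10 u v c (r + 1) m1 k1 m2 k2 =
  res10 u v c r m1 (k1 + 1) m2 k2 - res10 u v c r m1 k1 m2 (k2 + 1).
Proof. by rewrite /res10 yxexpS //; exact: md_up1. Qed.

Lemma res11Sk u v c r m1 k1 m2 k2 : res11 u v c (r + 1) m1 k1 m2 k2 =
  res11 u v c r m1 (k1 + 1) m2 k2 - res11 u v c r m1 k1 m2 (k2 + 1).
Proof. by rewrite /res11 yxexpS //; exact: bb_up1. Qed.

Lemma res11S u v c r m1 k1 m2 k2 : res11 u v c (r + 1) m1 k1 m2 k2 =
  res11 u v c r (m1 + 1) k1 m2 k2 - res11 u v c r m1 k1 (m2 + 1) k2.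
Proof.
rewrite res11Sk (res11_latl u v c r m2 k2) (res11_latr u v c r m1 k1).
by rewrite opprD addrACA subrr add0r.
Qed.

(* moving [x] from 0 to -1 *)
Lemma res00_res10 u v c r k1 : exists M, forall m1 m2 k2, m1 <= M ->
  res00 u v c r m1 k1 m2 k2 = - res10 u v c r m1 k1 m2 k2.
Proof.
move: r k1; apply: int_ind0 => [k1|r IH k1|r IH].
- have [M HM] := Dm_inf u e k1; exists M => m1 m2 k2 le_m.
  by rewrite /res00 /res10 xyexp0 yxexp0 /s1 /md HM // opprK.
- have [[M HM] [M' HM']] := (IH k1, IH (k1 + 1)).
  exists (Num.min M M') => m1 m2 k2; rewrite le_min => /andP[? ?].
  by rewrite res00Sk res10Sk HM // HM' // opprD.
(* Lowering [r] goes by descent in [k1]: for large [k1] there is no pole at -1 and both sides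
   vanish, and $(x-y)^{r+1}=(x-y)^r((1+x)-(1+y))$ passes from [k1 + 1] to [k1]. *)
apply: int_desc => [|k1 [M HM]].
  have [l Dl] := Dm_top u e; exists l => k1 le_k; have [M HM] := Dm_inf u e k1.
  exists (M - r) => m1 m2 k2 le_m; rewrite /res10 yxexp_eq0 ?oppr0; last first.
    by move=> p q le_p _; rewrite /md Dl ?(linmap0 (ev_linl _)) //; lia.
  apply: xyexp_eq0 => p q le_p _; rewrite /s1; have := HM p (Vm v q k2 c).
  rewrite Dl // (linmap0 (ev_linl _)) => /(_ _)/eqP; rewrite eq_sym oppr_eq0 => H.
  by apply/eqP/H; lia.
have [M' HM'] := IH k1; exists (Num.min M M') => m1 m2 k2; rewrite le_min => /andP[le1 le2].
have := res00Sk u v c r m1 k1 m2 (k2 - 1); have := res10Sk u v c r m1 k1 m2 (k2 - 1).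
rewrite subrK => B0 A0; rewrite -[LHS](subKr (res00 u v c r m1 (k1 + 1) m2 (k2 - 1))) -A0.
by rewrite HM // HM' // B0 opprK addKr.
Qed.

(* then moving [y] from 0 to -1 *)
Lemma res10_res11 u v c r k1 k2 : exists M, forall m1 m2, m2 <= M ->
  res10 u v c r m1 k1 m2 k2 = - res11 u v c r m1 k1 m2 k2.
Proof.
have [l Dl] := Dm_top u e.
have H (j : nat) : exists M, forall m2, m2 <= M -> forall m1,
    md u v c m1 (k1 + j%:Z) m2 (k2 + r - j%:Z) = - bb u v c m1 (k1 + j%:Z) m2 (k2 + r - j%:Z).
  have [M HM] := Dm_inf2 u v e (k1 + j%:Z) (k2 + r - j%:Z); exists M => m2 le_m m1.
  by rewrite /md /bb HM // opprK.
have [M HM] := lower_bound_nat H (absz (l - k1)).+1.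
exists M => m1 m2 le_m; rewrite /res10 /res11 /yxexp -scalerN -xyexpN; last first.
  by apply/up_swap/bb_up1.
congr (_ *: _); apply: eq_bsum => j; congr (_ *: _).
case: (leqP j (absz (l - k1))) => lt_j; first exact: HM.
by rewrite /md /bb Dl ?Dm0r ?(linmap0 (ev_linl _)) ?oppr0 //; lia.
Qed.

Lemma res00_res11 u v c r k1 k2 : exists M, forall m1 m2, m1 <= M -> m2 <= M ->
  res00 u v c r m1 k1 m2 k2 = res11 u v c r m1 k1 m2 k2.
Proof.
have [[M HM] [M' HM']] := (res00_res10 u v c r k1, res10_res11 u v c r k1 k2).
exists (Num.min M M') => m1 m2; rewrite !le_min => /andP[? _] /andP[_ ?].
by rewrite HM // HM' // opprK.
Qed.

Lemma res00_top1 u v c r m2 k2 : exists M, forall m1 k1, M <= m1 ->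
  res00 u v c r m1 k1 m2 k2 = 0.
Proof.
have [Q HQ] := Vm_top A v c.
have H (j : nat) : exists M, forall m, M <= m -> forall k1, s1 u v c m k1 (m2 + j%:Z) k2 = 0.
  have [M HM] := Vm_top A u (Vm v (m2 + j%:Z) k2 c); exists M => m le_m k1.
  by rewrite /s1 HM // (linmap0 (ev_linr e)).
have [M HM] := upper_bound_nat H (absz (Q - m2)).+1.
exists (M - r + (absz (Q - m2))%:Z) => m1 k1 le_m; apply: bsum_eq0 => j.
case: (leqP j (absz (Q - m2))) => lt_j; first by rewrite HM ?scaler0 //; lia.
by rewrite /s1 HQ ?Vm0r ?(linmap0 (ev_linr e)) ?scaler0 //; lia.
Qed.

Lemma res00_top2 u v c : exists M, forall r m1 k1 m2 k2, M <= m2 ->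
  res00 u v c r m1 k1 m2 k2 = 0.
Proof.
have [Q HQ] := Vm_top A v c; exists Q => r m1 k1 m2 k2 le_m.
by apply: xyexp_eq0 => p q _ le_q; rewrite /s1 HQ ?Vm0r ?(linmap0 (ev_linr e)) //; lia.
Qed.

Lemma res11_top1 u v c : exists l, forall r m1 k1 m2 k2, l <= k1 ->
  res11 u v c r m1 k1 m2 k2 = 0.
Proof.
have [l Dl] := Dm_top u e; exists l => r m1 k1 m2 k2 le_k.
by apply: yxexp_eq0 => p q le_p _; rewrite /bb Dl ?Dm0r ?(linmap0 (ev_linl _)) //; lia.
Qed.

Lemma res11_top2 u v c r k1 : exists l, forall m1 k1' m2 k2, l <= k2 -> k1 <= k1' ->
  res11 u v c r m1 k1' m2 k2 = 0.
Proof.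
have [l Dl] := Dm_top u e; have [K HK] := Dm_top2 u v e k1.
exists (K - r + (absz (l - k1))%:Z) => m1 k1' m2 k2 le_k2 le_k1.
rewrite /res11 /yxexp [xyexp _ _ _ _](_ : _ = 0) ?scaler0 //; apply: bsum_eq0 => j; rewrite /bb.
case: (leqP j (absz (l - k1))) => lt_j.
  by rewrite HK ?(linmap0 (ev_linl _)) ?scaler0 //; lia.
by rewrite Dl ?Dm0r ?(linmap0 (ev_linl _)) ?scaler0 //; lia.
Qed.

(* The commutator of the two nestings of contours, around 0 and around -1. *)
Variables (u v c : V).
Let TA r m1 k1 m2 k2 := res00 u v c r m1 k1 m2 k2 - sgnz F r *: res00 v u c r m2 k2 m1 k1.
Let TC r m1 k1 m2 k2 := res11 u v c r m1 k1 m2 k2 - sgnz F r *: res11 v u c r m2 k2 m1 k1.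

Lemma TA_TC_far r k1 k2 : exists M, forall m1 m2, m1 <= M -> m2 <= M ->
  TA r m1 k1 m2 k2 = TC r m1 k1 m2 k2.
Proof.
have [[M HM] [M' HM']] := (res00_res11 u v c r k1 k2, res00_res11 v u c r k2 k1).
exists (Num.min M M') => m1 m2; rewrite !le_min => /andP[? ?] /andP[? ?].
by rewrite /TA /TC HM // HM'.
Qed.

Lemma TA_latl r m2 k2 : lat (fun m1 k1 => TA r m1 k1 m2 k2).
Proof.
move=> m1 k1; rewrite /TA (res00_latl u v c r m2 k2) (res00_latr v u c r m2 k2).
by rewrite scalerDr opprD addrACA.
Qed.

Lemma TA_latr r m1 k1 : lat (fun m2 k2 => TA r m1 k1 m2 k2).
Proof.
move=> m2 k2; rewrite /TA (res00_latr u v c r m1 k1) (res00_latl v u c r m1 k1).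
by rewrite scalerDr opprD addrACA.
Qed.

Lemma TC_latl r m2 k2 : lat (fun m1 k1 => TC r m1 k1 m2 k2).
Proof.
move=> m1 k1; rewrite /TC (res11_latl u v c r m2 k2) (res11_latr v u c r m2 k2).
by rewrite scalerDr opprD addrACA.
Qed.

Lemma TC_latr r m1 k1 : lat (fun m2 k2 => TC r m1 k1 m2 k2).
Proof.
move=> m2 k2; rewrite /TC (res11_latr u v c r m1 k1) (res11_latl v u c r m1 k1).
by rewrite scalerDr opprD addrACA.
Qed.

Lemma TA_S r m1 k1 m2 k2 :
  TA r (m1 + 1) k1 m2 k2 = TA r m1 k1 (m2 + 1) k2 + TA (r + 1) m1 k1 m2 k2.
Proof.
rewrite /TA !res00S sgnzS scaleNr opprK scalerBr.
by rewrite [RHS]addrACA addKr [X in _ = X + _]addrC subrK.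
Qed.

Lemma TC_S r m1 k1 m2 k2 :
  TC r (m1 + 1) k1 m2 k2 = TC r m1 k1 (m2 + 1) k2 + TC (r + 1) m1 k1 m2 k2.
Proof.
rewrite /TC !res11S sgnzS scaleNr opprK scalerBr.
by rewrite [RHS]addrACA addKr [X in _ = X + _]addrC subrK.
Qed.

Lemma TA_mode r p q : TA r p 0 q 0 = ev e (commut2 (Y A) r p q u v c).
Proof.
have [bY tY _ _] := VOA_weak_module A.
rewrite /commut2 (linmapB (ev_linr e)) (xyexp_lin (f := ev e)) //; last exact: (mode_up2 bY tY).
rewrite (yxexp_lin (f := ev e)) //; last exact: (mode_up1 bY tY).
rewrite /TA /res00 /yxexp; congr (_ - _ *: _).
  by apply: xyexp_eq => p' q' _ _; rewrite /s1 !Vm0.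
by apply: xyexp_eq => p' q' _ _; rewrite /s1 !Vm0.
Qed.

Lemma TC_mode r p q :
  TC r 0 p 0 q = - ev (commut2 (fun k a => Dm a 0 k) r p q u v e) c.
Proof.
have H1 a b : up2 (fun p q => Dm a 0 p (Dm b 0 q e)).
  by have [l Dl] := Dm_top b e; exists l => p' q' le_q; rewrite Dl ?Dm0r.
have H2 a b : up1 (fun p q => Dm b 0 q (Dm a 0 p e)).
  by have [l Dl] := Dm_top a e; exists l => p' q' le_q; rewrite Dl ?Dm0r.
rewrite /commut2 (linmapB (ev_linl c)) (xyexp_lin (f := fun e => ev e c)) //.
rewrite (yxexp_lin (f := fun e => ev e c)) // opprB /TC /res11; congr (_ - _).
by rewrite /yxexp scalerA sgnzK scale1r.
Qed.

Lemma TA_top1 r m2 k2 : exists M, forall m1 k1, M <= m1 -> TA r m1 k1 m2 k2 = 0.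
Proof.
have [[M HM] [M' HM']] := (res00_top1 u v c r m2 k2, res00_top2 v u c).
exists (Num.max M M') => m1 k1; rewrite ge_max => /andP[? ?].
by rewrite /TA HM // HM' // scaler0 subr0.
Qed.

Lemma TA_top2 r m1 k1 : exists M, forall m2 k2, M <= m2 -> TA r m1 k1 m2 k2 = 0.
Proof.
have [[M HM] [M' HM']] := (res00_top1 v u c r m1 k1, res00_top2 u v c).
exists (Num.max M M') => m2 k2; rewrite ge_max => /andP[? ?].
by rewrite /TA HM // HM' // scaler0 subr0.
Qed.

Lemma TC_top1 r k2 : exists l, forall k1 k2', l <= k1 -> k2 <= k2' ->
  forall m1 m2, TC r m1 k1 m2 k2' = 0.
Proof.
have [[l Hl] [l' Hl']] := (res11_top1 u v c, res11_top2 v u c r k2).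
exists (Num.max l l') => k1 k2'; rewrite ge_max => /andP[? ?] ? m1 m2.
by rewrite /TC Hl // Hl' // scaler0 subr0.
Qed.

Lemma TC_top2 r k1 : exists l, forall k1' k2, l <= k2 -> k1 <= k1' ->
  forall m1 m2, TC r m1 k1' m2 k2 = 0.
Proof.
have [[l Hl] [l' Hl']] := (res11_top1 v u c, res11_top2 u v c r k1).
exists (Num.max l l') => k1' k2; rewrite ge_max => /andP[? ?] ? m1 m2.
by rewrite /TC Hl // Hl' // scaler0 subr0.
Qed.

Lemma TA_local N : (forall r p q w, N <= r -> commut2 (Y A) r p q u v w = 0) ->
  forall r m1 k1 m2 k2, N <= r -> TA r m1 k1 m2 k2 = 0.
Proof.
move=> HN r m1 k1 m2 k2 le_r; move: m2 k2.
have lat0 : lat (fun _ _ : int => 0 : U) by move=> ? ?; rewrite addr0.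
apply: (lat_eq0 (TA_latr r m1 k1) lat0) => [m2|]; last exact: TA_top2.
move: m1 k1; apply: (lat_eq0 (TA_latl r m2 0) lat0) => [m1|]; last exact: TA_top1.
by rewrite TA_mode HN // (linmap0 (ev_linr e)).
Qed.

(** Locality is transported from 0 to -1. For very negative [m1], [m2] the two commutators agree, so
    [TC] vanishes there; the Pascal rule extends this to all [m1], [m2] once the rows [k1 + 1] and
    [k2 + 1] are zero, and these rows are reached by descent from large exponents. *)
Lemma TC_local N : (forall r p q w, N <= r -> commut2 (Y A) r p q u v w = 0) ->
  forall r m1 k1 m2 k2, N <= r -> TC r m1 k1 m2 k2 = 0.
Proof.
move=> HN r m1 k1 m2 k2 le_r; move: k1 k2 m1 m2.
apply: int_desc2; [exact: TC_top1 | exact: TC_top2|] => k1 k2 Z1 Z2 m1 m2.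
have [M HM] := TA_TC_far r k1 k2; move: m2; apply: int_asc => [|m2 IH]; last first.
  by have /lat_dlat -> := TC_latr r m1 k1; rewrite Z2 IH subr0.
exists M => m2 le_m2; move: m1; apply: int_asc => [|m1 IH]; last first.
  by have /lat_dlat -> := TC_latl r m2 k2; rewrite Z1 IH subr0.
by exists M => m1 le_m1; rewrite -HM // (TA_local HN).
Qed.

(** Here [m1] is arbitrary, although single nestings with large [m1] do feel the pole of $x$ at
    infinity. The commutator is concentrated at $x=y$: a factor $x$ is traded for $y+(x-y)$, and
    locality ends the resulting recursion in [r]. *)
Lemma TA_TC r m1 k1 k2 : exists M, forall m2, m2 <= M -> TA r m1 k1 m2 k2 = TC r m1 k1 m2 k2.
Proof.
have [bY tY _ jY] := VOA_weak_module A.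
have [N HN] := commut2_local bY tY jY u v.
move: r m1; apply: int_desc => [|r IHr].
  by exists N => r le_r m1; exists 0 => m2 _; rewrite (TA_local HN) // (TC_local HN).
apply: int_asc => [|m1 [M HM]].
  by have [M HM] := TA_TC_far r k1 k2; exists M => m1 le_m1; exists M => m2; exact: HM.
have [M' HM'] := IHr m1; exists (Num.min (M - 1) M') => m2; rewrite le_min => /andP[? ?].
by rewrite TA_S TC_S HM' // HM //; lia.
Qed.

Lemma Dm_iterate r q :
  ev (Dm (Y A r u v) 0 q e) c = ev (commut2 (fun k a => Dm a 0 k) r 0 q u v e) c.
Proof.
have [bY tY vY jY] := VOA_weak_module A.
rewrite -[RHS]opprK -TC_mode; apply/esym.
(* The commutator with weight $y^m(1+y)^k$ in the second variable is the candidate residue at -1 for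
   $Y(u_rv,y)$. *)
pose T m k := - TC r 0 0 m k.
apply: (@Dm_uniq (Y A r u v) e c T _ _ _ 0 q) => [m k||k]; rewrite /T.
- by rewrite (TC_latr r 0 0) opprD.
- by have [l Hl] := TC_top2 r 0; exists l => m k le_k; rewrite Hl ?oppr0.
have [M HM] := TA_TC r 0 0 k; exists M => m le_m; rewrite -HM //; congr (- _).
(* On the row $k=0$ this is the iterate formula of [V] itself. *)
move: m k {M HM le_m}; apply: lat_eq0.
- exact: TA_latr.
- exact: (lat_lin (ev_linr e) (Vm_lat A _ c)).
- by move=> m; rewrite TA_mode Vm0 (mode_iterate bY tY jY).
have [M HM] := TA_top2 r 0 0; have [M' HM'] := Vm_top A (Y A r u v) c.
exists (Num.max M M') => m k; rewrite ge_max => /andP[? ?].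
by rewrite HM // HM' // (linmap0 (ev_linr e)).
Qed.
End ThreePoint.

Theorem functional_weak_module : weak_module A (fun k a e => Dm a 0 k e).
Proof.
have bD : bilin (fun k a e => Dm a 0 k e).
  by split=> [k c a b w|k a c w w']; [exact: Dm_linl | exact: Dm_linr].
have [bY tY _ jY] := VOA_weak_module A.
split=> //; first by move=> u w; have [l Hl] := Dm_top u w; exists l => k; exact: Hl.
  by move=> k w; exact: Dm_vac.
apply: borcherds_of_iterate => //.
- by move=> u w; have [l Hl] := Dm_top u w; exists l => k; exact: Hl.
- by move=> u v w r q; apply: ev_inj => c; exact: Dm_iterate.
move=> u v w; have [N HN] := commut2_local bY tY jY u v; exists N => r p q le_r.
apply: ev_inj => c; rewrite (linmap0 (ev_linl c)); apply/eqP; rewrite -oppr_eq0 -TC_mode.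
by rewrite (TC_local _ _ HN).
Qed.
End FunctionalModule.

(** * Functionals with bounded poles *)

Section TameFunctionals.
Variables (F : closedFieldType) (V : lmodType F) (A : VOA V) (U : lmodType F).
Implicit Types (h : int -> V -> U) (f : V -> U).

(* [h] is the coefficient family of a series [\sum_m h m x^(-m-1)] such that some
   [(1+x)^L] times it has bounded degree at infinity, uniformly in the argument. *)
Definition tame_family h := exists L M, forall m b, m <= M -> bsum L (fun i => h (m + i%:Z) b) = 0.

Definition top_family h := forall b, exists m0, forall m, m0 <= m -> h m b = 0.

Lemma top_family_ev0 h m b : top_family h -> ev0 (fun i : nat => h (m + i%:Z) b).
Proof. by move=> top; exact: (ev0_int (h := fun m => h m b) m (top b)). Qed.

Lemma bsum_family h m b k : top_family h -> bsum (k + 1) (fun i => h (m + i%:Z) b) =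
  bsum k (fun i => h (m + i%:Z) b) + bsum k (fun i => h (m + 1 + i%:Z) b).
Proof.
move=> top; rewrite bsumS; last exact: top_family_ev0.
by congr (_ + _); apply: eq_bsum => i; congr (h _ _); lia.
Qed.

(** Each further factor $1+x$ raises the order at infinity by one, so the bound on [m] drops by
    one. *)
Lemma tame_raise h L M : top_family h ->
  (forall m b, m <= M -> bsum L (fun i => h (m + i%:Z) b) = 0) ->
  forall L', L <= L' -> forall m b, m <= M - (L' - L) -> bsum L' (fun i => h (m + i%:Z) b) = 0.
Proof.
move=> top H; apply: int_up => [m b|L' _ IH m b le_m].
  by rewrite subrr subr0; exact: H.
by rewrite bsum_family // !IH ?addr0 //; lia.
Qed.

Lemma tame_add h h' c : top_family h -> top_family h' -> tame_family h -> tame_family h' ->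
  tame_family (fun m b => c *: h m b + h' m b).
Proof.
move=> top top' [L [M H]] [L' [M' H']]; pose L2 := Num.max L L'.
exists L2, (Num.min (M - (L2 - L)) (M' - (L2 - L'))) => m b.
rewrite le_min => /andP[? ?]; rewrite bsumD; [|exact: (ev0Z (fun=> c) (top_family_ev0 _ _ top))
  |exact: top_family_ev0].
rewrite bsumZ; last exact: top_family_ev0.
by rewrite (tame_raise top H) ?(tame_raise top' H') ?scaler0 ?addr0 //; rewrite /L2; lia.
Qed.

Lemma tame_shift h s : tame_family h -> tame_family (fun m => h (m + s)).
Proof.
move=> [L [M H]]; exists L, (M - s) => m b le_m; rewrite -[RHS](H (m + s) b); last lia.
by apply: eq_bsum => i; congr (h _ _); lia.
Qed.

Lemma tame_ext h h' : (forall m b, h m b = h' m b) -> tame_family h -> tame_family h'.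
Proof.
move=> E [L [M H]]; exists L, M => m b le_m; rewrite -[RHS](H m b le_m).
by apply: eq_bsum => i; rewrite E.
Qed.

Lemma tame_div h : top_family h -> tame_family (fun m b => h m b + h (m + 1) b) -> tame_family h.
Proof.
move=> top [L [M H]]; exists (L + 1), M => m b le_m; rewrite bsum_family //.
rewrite -[RHS](H m b le_m) -bsumD; [|exact: top_family_ev0..].
by apply: eq_bsum => i; congr (_ + h _ _); lia.
Qed.

Lemma tame0 : tame_family (fun _ _ => 0).
Proof. by exists 0, 0 => m b _; exact: bsum_eq0. Qed.

Lemma top0 : top_family (fun _ _ => 0).
Proof. by move=> b; exists 0. Qed.

Lemma top_add h h' c : top_family h -> top_family h' -> top_family (fun m b => c *: h m b + h' m b).
Proof.
move=> top top' b; have [[M HM] [M' HM']] := (top b, top' b).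
by exists (Num.max M M') => m; rewrite ge_max => /andP[? ?]; rewrite HM // HM' // scaler0 addr0.
Qed.

Definition tame f := linmap f /\ forall a, exists l M, forall m b, m <= M -> f (Vm A a m l b) = 0.

Lemma lin_Vm f a m k b : linmap f -> f (Vm A a m k b) = bsum k (fun i => f (Y A (m + i%:Z) a b)).
Proof. by move=> lf; rewrite /Vm bsum_lin //; exact: VOA_mode_ev0. Qed.

Lemma mode_top_family f a : linmap f -> top_family (fun m => f \o Y A m a).
Proof.
move=> lf b; have [m0 H] := VOA_trunc A a b; exists m0 => m /H /= ->; exact: linmap0.
Qed.

Lemma tameP f : tame f <-> linmap f /\ forall a, tame_family (fun m => f \o Y A m a).
Proof.
split=> -[lf H]; split=> // a; have [l [M HM]] := H a; exists l, M => m b le_m.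
  by rewrite -lin_Vm // HM.
by rewrite lin_Vm // HM.
Qed.

Lemma tame_comb f g c : tame f -> tame g -> tame (fun b => c *: f b + g b).
Proof.
move=> /tameP[lf Hf] /tameP[lg Hg]; apply/tameP; split=> [d x y|a].
  by rewrite lf lg !scalerDr !scalerA mulrC -!addrA; congr (_ + _); rewrite addrCA.
exact: (tame_add c (mode_top_family a lf) (mode_top_family a lg)).
Qed.

Lemma tame_eq f g : (forall b, f b = g b) -> tame f -> tame g.
Proof. by move=> /funext ->. Qed.

Lemma tame_zero : tame (fun=> 0).
Proof. by split=> [c x y|a]; [rewrite scaler0 addr0 | exists 0, 0]. Qed.

Section Closure.
Variable f : V -> U.
Hypothesis tf : tame f.
Let lf : linmap f := proj1 tf.

(** With $\partial^{(j)}$ the divided derivative, this is [f] applied to the residue at 0 of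
    $x^m\,\partial^{(j)}(x^{m'}(1+x)^k)\,Y(w,x)b$. Such terms arise when a residue of $Y(v,y)$ is
    commuted past $Y(u,x)$, with $w=v_ju$. *)
Definition weighted w j m' k m b :=
  bsum k (fun i => (binomZ (m' + i%:Z) j)%:~R *: f (Y A (m' + i%:Z + m - j%:Z) w b)).

Lemma weighted_ev0 w j m' m b :
  ev0 (fun i : nat => ((binomZ (m' + i%:Z) j)%:~R : F) *: f (Y A (m' + i%:Z + m - j%:Z) w b)).
Proof.
have [m0 H] := VOA_trunc A w b; exists (absz (m0 - m' - m + j%:Z)) => i le_i.
by rewrite H ?(linmap0 lf) ?scaler0 //; lia.
Qed.

Lemma weighted_top w j m' k : top_family (weighted w j m' k).
Proof.
move=> b; have [m0 H] := VOA_trunc A w b; exists (m0 - m' + j%:Z) => m le_m.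
by apply: bsum_eq0 => i; rewrite H ?(linmap0 lf) ?scaler0 //; lia.
Qed.

Lemma weighted_lat w j m' k m b :
  weighted w j m' (k + 1) m b = weighted w j m' k m b + weighted w j (m' + 1) k m b.
Proof.
rewrite /weighted bsumS; last exact: weighted_ev0.
by congr (_ + _); apply: eq_bsum => i; congr ((binomZ _ _)%:~R *: f (Y A _ _ _)); lia.
Qed.

(** For $k=0$ the weight is a monomial, and larger $k$ follow from the Pascal rule. Negative $k$ put
    a pole at -1, which one more factor $1+x$ clears ([tame_div]). *)
Lemma weighted_tame w j : forall k m', tame_family (weighted w j m' k).
Proof.
elim: j => [|j IHj]; apply: int_ind0 => [m'|k IHk m'|k IHk m'].
- have [_ /(_ w)] := proj1 (tameP f) tf; move/(tame_shift m'); apply: tame_ext => m b.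
  by rewrite /weighted bsum0 binomZ0 scale1r /=; congr (f (Y A _ _ _)); lia.
- apply: (tame_ext (h := fun m b => 1 *: weighted w 0 m' k m b + weighted w 0 (m' + 1) k m b)).
    by move=> m b; rewrite scale1r weighted_lat.
  by apply: tame_add => //; exact: weighted_top.
- apply: tame_div; first exact: weighted_top.
  apply: tame_ext (IHk m') => m b; rewrite weighted_lat; congr (_ + _).
  by apply: eq_bsum => i; rewrite !binomZ0; congr (_ *: f (Y A _ _ _)); lia.
- apply: (tame_ext (h := fun m b =>
    (binomZ m' j.+1)%:~R *: f (Y A (m + (m' - j.+1%:Z)) w b) + 0)).
    move=> m b; rewrite addr0 /weighted bsum0 addr0.
    by congr (_ *: f (Y A _ _ _)); lia.
  apply: (tame_add (h := fun m b => f (Y A (m + (m' - j.+1%:Z)) w b)) (h' := fun _ _ => 0)).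
  + move=> b; have [m0 H] := VOA_trunc A w b; exists (m0 - (m' - j.+1%:Z)) => m le_m.
    by rewrite H ?(linmap0 lf) //; lia.
  + exact: top0.
  + have [_ /(_ w)] := proj1 (tameP f) tf; exact: tame_shift.
  + exact: tame0.
- apply: (tame_ext (h := fun m b => 1 *: weighted w j.+1 m' k m b + weighted w j.+1 (m' + 1) k m b)).
    by move=> m b; rewrite scale1r weighted_lat.
  by apply: tame_add => //; exact: weighted_top.
(* The Leibniz rule $(1+x)\partial^{(j+1)}g=\partial^{(j+1)}((1+x)g)-\partial^{(j)}g$ with
   $g=x^{m'}(1+x)^k$ calls on the hypotheses for $j$ and for $k+1$. *)
apply: tame_div; first exact: weighted_top.
have := tame_add (-1) (weighted_top w j m' k) (weighted_top w j.+1 m' (k + 1)) (IHj k m') (IHk m').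
apply: tame_ext => m b; rewrite weighted_lat addrCA; congr (_ + _).
rewrite scaleN1r addrC; apply/eqP; rewrite subr_eq; apply/eqP.
rewrite /weighted -bsumD; [|exact: weighted_ev0..].
apply: eq_bsum => i.
have -> : m' + 1 + i%:Z = m' + i%:Z + 1 by lia.
rewrite binomZS rmorphD scalerDl.
by congr (_ *: f (Y A _ _ _) + _ *: f (Y A _ _ _)); lia.
Qed.

Lemma tame_family_sum (h : nat -> int -> V -> U) J : (forall j, top_family (h j)) ->
  (forall j, tame_family (h j)) -> tame_family (fun m b => \sum_(j < J) h j m b).
Proof.
move=> top th; suff [] : top_family (fun m b => \sum_(j < J) h j m b) /\
  tame_family (fun m b => \sum_(j < J) h j m b) by [].
elim: J => [|J [IH1 IH2]].
  by split; [move=> b; exists 0 => m _; rewrite big_ord0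
            |apply: tame_ext tame0 => m b; rewrite big_ord0].
have E m b : 1 *: \sum_(j < J) h j m b + h J m b = \sum_(j < J.+1) h j m b.
  by rewrite scale1r big_ord_recr.
split; last exact: tame_ext E (tame_add 1 IH1 (top J) IH2 (th J)).
by move=> b; have [m0 H] := top_add 1 IH1 (top J) b; exists m0 => m /H; rewrite E.
Qed.

(** Residues at -1 are built from these functionals, so they must stay in the space. The commutator
    formula leaves $f(u_m\cdot)$, tame by assumption, plus finitely many [weighted] families, as
    $v_ju=0$ for large $j$. *)
Lemma tame_Vm v m' k' : tame (fun b => f (Vm A v m' k' b)).
Proof.
apply/tameP; split=> [c x y|u]; first by rewrite (Vm_linr A _ _ _ c) lf.
have [bY tY _ jY] := VOA_weak_module A; have [N HN] := VOA_trunc A v u.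
pose J := absz N.
have E m b : 1 *: f (Y A m u (Vm A v m' k' b)) +
    \sum_(j < J) weighted (Y A j v u) j m' k' m b = f (Vm A v m' k' (Y A m u b)).
  rewrite scale1r /Vm !bsum_lin //; try exact: VOA_mode_ev0; last first.
  - exact: (mode_linr bY).
  - have [m0 H] := VOA_trunc A v b; exists (absz (m0 - m')) => i le_i.
    by rewrite H ?(mode_0r bY) //; lia.
  have h0 j : ev0 (fun i : nat => ((binomZ (m' + i%:Z) j)%:~R : F) *:
     f (Y A (m' + i%:Z + m - j%:Z) (Y A j v u) b)) by exact: weighted_ev0.
  have -> : \sum_(j < J) weighted (Y A j v u) j m' k' m b =
    bsum k' (fun i => \sum_(j < J) ((binomZ (m' + i%:Z) j)%:~R : F) *:
     f (Y A (m' + i%:Z + m - j%:Z) (Y A j v u) b)).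
    have [K HK] : exists K : nat, forall i, (K <= i)%N -> forall j : 'I_J,
       ((binomZ (m' + i%:Z) j)%:~R : F) *: f (Y A (m' + i%:Z + m - j%:Z) (Y A j v u) b) = 0.
      have H (j : nat) : exists K, forall i : int, K <= i -> forall i' : nat, i = i' ->
          ((binomZ (m' + i) j)%:~R : F) *: f (Y A (m' + i + m - j%:Z) (Y A j v u) b) = 0.
        by have [K HK] := h0 j; exists K%:Z => i le_i i' Ei; rewrite Ei; apply: HK; lia.
      have [K HK] := upper_bound_nat H J; exists (absz K) => i le_i j.
      by apply: (HK i%:Z j _ _ i) => //; lia.
    rewrite /weighted /bsum (isumE (N := K)) => [|i le_i]; last first.
      by rewrite big1 ?scaler0 // => j _; exact: HK.
    under [RHS]eq_bigr => i _ do rewrite scaler_sumr.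
    rewrite exchange_big /=; apply: eq_bigr => j _.
    by rewrite (isumE (N := K)) // => i le_i; rewrite (HK i le_i j) scaler0.
  rewrite -bsumD.
  - apply: eq_bsum => i; rewrite [Y A _ v (Y A m u b)](mode_commut bY tY jY) (linmapD lf); congr (_ + _).
    rewrite bsum_lin //; last first.
      have [m0 H] := VOA_trunc A v u; exists (absz m0) => j le_j.
      by rewrite H ?(mode_0l bY) //; lia.
    rewrite /bsum (isumE (N := J)) // => j le_j.
    by rewrite HN ?(mode_0l bY) ?(linmap0 lf) ?scaler0 //; rewrite /J in le_j; lia.
  - have [m0 H] := VOA_trunc A v b; exists (absz (m0 - m')) => i le_i.
    by rewrite H ?(mode_0r bY) ?(linmap0 lf) //; lia.
  - elim: J => [|J [K HK]]; first by exists 0%N => i _; rewrite big_ord0.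
    have [K' HK'] := h0 J; exists (maxn K K') => i; rewrite geq_max => /andP[le1 le2].
    by rewrite big_ord_recr /= HK // add0r HK'.
have T1 : top_family (fun m b => f (Y A m u (Vm A v m' k' b))).
  by move=> b; have [m0 H] := VOA_trunc A u (Vm A v m' k' b); exists m0 => m /H ->; exact: linmap0.
have T2 (j : nat) : top_family (weighted (Y A j v u) j m' k') by exact: weighted_top.
have G1 : tame_family (fun m b => f (Y A m u (Vm A v m' k' b))).
  have [_ /(_ u) [L [M H]]] := proj1 (tameP f) tf; exists L, M => m b le_m; exact: H.
have G2 : tame_family (fun m b => \sum_(j < J) weighted (Y A j v u) j m' k' m b).
  by apply: (tame_family_sum (h := fun j => weighted (Y A j v u) j m' k')) => // j; exact: weighted_tame.
apply: tame_ext E (tame_add 1 T1 _ G1 G2).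
move=> b; have [m0 H] := upper_bound_nat (Q := fun j m => weighted (Y A j v u) j m' k' m b = 0)
  (fun j => T2 j b) J.
by exists m0 => m le_m; rewrite big1 // => j _; exact: H.
Qed.

(* Solves the lattice recursion upwards in [m] from row [M0], where it is prescribed. *)
Lemma residue_exists a l M0 : (forall m b, m <= M0 -> f (Vm A a m l b) = 0) ->
  exists T : int -> int -> V -> U, [/\ forall b, lat (fun m k => T m k b),
    forall m k b, l <= k -> T m k b = 0,
    forall m k b, m <= M0 -> k < l -> T m k b = - f (Vm A a m k b) &
    forall m k, tame (T m k)].
Proof.
move=> Hl.
pose row0 k b := if k < l then - f (Vm A a M0 k b) else 0.
pose step (row : int -> V -> U) k b := row (k + 1) b - row k b.
pose T m k b := if m <= M0 then (if k < l then - f (Vm A a m k b) else 0)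
  else iter (absz (m - M0)) step row0 k b.
have TM0 j k b : T (M0 + j%:Z) k b = iter j step row0 k b.
  rewrite /T; case: (lerP (M0 + j%:Z) M0) => [le_j|lt_j].
    have -> : j = 0%N by lia.
    by rewrite addr0.
  by congr (iter _ _ _ _ _); lia.
have raise m k b : l <= k -> m <= M0 - (k - l) -> f (Vm A a m k b) = 0.
  move=> le_lk le_m; rewrite lin_Vm //.
  apply: (@tame_raise (fun m => f \o Y A m a) l M0 (mode_top_family a lf) _ k le_lk m b le_m).
  by move=> m2 b2 le_m2; rewrite -[RHS](Hl m2 b2 le_m2) lin_Vm.
have Tlat b : lat (fun m k => T m k b).
  apply/lat_dlat => m k; case: (ltrP m M0) => [lt_m|le_m]; last first.
    have -> : m = M0 + (absz (m - M0))%:Z by lia.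
    have -> : M0 + (absz (m - M0))%:Z + 1 = M0 + (absz (m - M0)).+1%:Z by lia.
    by rewrite !TM0.
  have [le1 le2] : m <= M0 /\ m + 1 <= M0 by split; lia.
  rewrite /T le1 le2.
  case: (ltrP k l) => [lt_k|le_k]; last by rewrite ifF ?subr0 //; lia.
  have /lat_dlat -> := Vm_lat A a b; rewrite (linmapB lf) opprB opprK addrC.
  case: ltrP => [//|le_k]; have -> : k + 1 = l by lia.
  by rewrite Hl ?oppr0 //; lia.
exists T; split=> //.
- move=> m k b le_k; rewrite /T; case: ifP => _; first by rewrite ifF //; lia.
  elim: absz k le_k => [|j IH] k le_k; first by rewrite /= /row0 ifF //; lia.
  by rewrite iterS /step !IH ?subr0 //; lia.
- by move=> m k b le_m lt_k; rewrite /T le_m lt_k.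
have tN m k : tame (fun b => - f (Vm A a m k b)).
  apply: tame_eq (tame_comb (-1) (tame_Vm a m k) tame_zero) => b.
  by rewrite scaleN1r addr0.
move=> m k; rewrite /T; case: (m <= M0).
  by case: (k < l); [exact: tN | exact: tame_zero].
elim: absz k => [|j IH] k.
  by rewrite /= /row0; case: (k < l); [exact: tN | exact: tame_zero].
rewrite iterS; apply: tame_eq (tame_comb (-1) (IH k) (IH (k + 1))) => b.
by rewrite scaleN1r addrC.
Qed.
End Closure.

Definition functional_model (E : lmodType F) (ev : E -> V -> U)
    (Dm : V -> int -> int -> E -> E) :=
  [/\ (forall b, linmap (fun e => ev e b)) /\ (forall e, linmap (ev e)),
      forall e e', (forall b, ev e b = ev e' b) -> e = e',
      forall a e, lat (fun m k => Dm a m k e),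
      forall a e, exists l, forall m k, l <= k -> Dm a m k e = 0 &
      forall a e k, exists M, forall m b, m <= M -> ev (Dm a m k e) b = - ev e (Vm A a m k b)].

Lemma functional_model_exists : exists (E : lmodType F) ev Dm,
  @functional_model E ev Dm /\ forall f, tame f -> exists e, forall b, ev e b = f b.
Proof.
pose T := {f : V -> U | tame f}.
pose add (f g : T) : T := exist _ _ (tame_comb 1 (svalP f) (svalP g)).
pose scale c (f : T) : T := exist _ _ (tame_comb c (svalP f) tame_zero).
pose R (f g : T) := forall b, sval f b = sval g b.
have [|||||||||||||Q [pi [surj piE piD piZ]]] :=
  @setoid_lmod F T add (exist _ _ tame_zero) scale R.
- by [].
- by move=> f g H b.
- by move=> f g h H1 H2 b; rewrite H1.
- by move=> f f' g g' H1 H2 b; rewrite /= H1 H2.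
- by move=> c f f' H b; rewrite /= H.
- by move=> f g h b; rewrite /= !scale1r addrA.
- by move=> f g b; rewrite /= !scale1r addrC.
- by move=> f b; rewrite /= scale1r add0r.
- by move=> f b; rewrite /= scale1r addr0 scaleN1r addNr.
- by move=> c d f b; rewrite /= !addr0 scalerA.
- by move=> f b; rewrite /= scale1r addr0.
- by move=> c f g b; rewrite /= !addr0 !scale1r scalerDr.
- by move=> c d f b; rewrite /= !addr0 scale1r scalerDl.
have [rep repK] := choice surj.
pose ev e := sval (rep e).
have ev_pi (f : T) b : ev (pi f) b = sval f b.
  by have /piE := repK (pi f); exact.
have ev_linl b : linmap (fun e => ev e b).
  move=> c e e'; rewrite -[e in LHS]repK -[e' in LHS]repK -piZ -piD ev_pi /=.
  by rewrite scale1r addr0.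
have ev_tame e : tame (ev e) by exact: svalP.
have ev_inj e e' : (forall b, ev e b = ev e' b) -> e = e'.
  by move=> H; rewrite -(repK e) -(repK e'); apply/piE.
have ev_surj f : tame f -> exists e, forall b, ev e b = f b.
  by move=> tf; exists (pi (exist _ f tf)) => b; rewrite ev_pi.
have DmE (p : V * Q) : exists D : int -> int -> Q,
   [/\ lat D, exists l, forall m k, l <= k -> D m k = 0 &
     forall k, exists M, forall m b, m <= M -> ev (D m k) b = - ev p.2 (Vm A p.1 m k b)].
  case: p => a e /=; have [l [M0 HM]] := (ev_tame e).2 a.
  have [S [Slat Stop Sinf St]] := residue_exists (ev_tame e) HM.
  have [D HD] := choice (fun p : int * int => ev_surj _ (St p.1 p.2)).
  have HD' m k b : ev (D (m, k)) b = S m k b by rewrite HD.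
  exists (fun m k => D (m, k)); split.
  - by move=> m k; apply: ev_inj => b; rewrite (linmapD (ev_linl b)) !HD' Slat.
  - exists l => m k le_k; apply: ev_inj => b; rewrite HD' Stop //.
    exact/esym/(linmap0 (ev_linl b)).
  move=> k; case: (ltrP k l) => [lt_k|le_k].
    by exists M0 => m b le_m; rewrite HD' Sinf.
  exists (M0 - (k - l)) => m b le_m; rewrite HD' Stop //.
  have le := (ev_tame e).1; rewrite lin_Vm //.
  rewrite (@tame_raise (fun m => ev e \o Y A m a) l M0 (mode_top_family a le) _ k le_k m b le_m) ?oppr0 //.
  by move=> m2 b2 le_m2; rewrite -[RHS](HM m2 b2 le_m2) lin_Vm.
have [D HD] := choice DmE.
exists Q, ev, (fun a m k e => D (a, e) m k); split=> //; split=> //.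
- by split=> // e; case: (ev_tame e).
- by move=> a e; case: (HD (a, e)).
- by move=> a e; case: (HD (a, e)).
- by move=> a e; case: (HD (a, e)).
Qed.
End TameFunctionals.

(** * Embedding an A_n(V)-module *)

Local Arguments binomZ : simpl never.

Section LatticeExpansions.
Variables (F : closedFieldType) (X : lmodType F).
Implicit Type T : int -> int -> X.

(* expansion at infinity: [(1+x)^k = x^(-s) (1+1/x)^(-s) (1+x)^(k+s)] *)
Lemma lat_expand T (s : nat) m k : lat T ->
  (exists M, forall m' k', m' <= M -> k <= k' -> k' <= k + s%:Z -> T m' k' = 0) ->
  T m k = bsum (- s%:Z) (fun j => T (m - s%:Z - j%:Z) (k + s%:Z)).
Proof.
move=> lT; elim: s => [|s IH] [M HM].
  by rewrite oppr0 bsum0; congr (T _ _); lia.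
rewrite IH; last by exists M => m' k' ? ? ?; apply: HM => //; lia.
have ev g0 : ev0 (fun j : nat => T (g0 - j%:Z) (k + s%:Z)).
  by exists (absz (g0 - M)) => j le_j; apply: HM; lia.
have -> : - s%:Z = - s.+1%:Z + 1 by lia.
rewrite bsumS; last exact: ev.
rewrite addrC -bsumD; [|exact: ev0S (ev _)|exact: ev].
apply: eq_bsum => j.
have -> : k + s.+1%:Z = k + s%:Z + 1 by lia.
by rewrite lT; congr (T _ _ + T _ _); lia.
Qed.

(* [T] with its weight [x^m (1+x)^k] replaced by [(-1)^i] times its [i]-th divided derivative *)
Definition leibniz (i : nat) T m k : X :=
  (-1) ^+ i *: \sum_(s < i.+1) (binomZ m (i - s) * binomZ k s)%:~R *: T (m - i%:Z + s%:Z) (k - s%:Z).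

(** A family with the Pascal rule behaves as a linear functional on the weights, and differentiating
    a relation between weights yields a relation. *)
Lemma leibniz_lat i T : lat T -> lat (leibniz i T).
Proof.
move=> lT m k; rewrite /leibniz -scalerDr; congr (_ *: _).
have bk s : binomZ (k + 1) s = binomZ k s + (if s is s'.+1 then binomZ k s' else 0).
  by case: s => [|s]; rewrite ?binomZ0 ?addr0 // binomZS.
have bm s : binomZ (m + 1) (i - s) =
    binomZ m (i - s) + (if (s < i)%N then binomZ m (i - s.+1) else 0).
  case: ltnP => [lt_s|le_s]; last first.
    have -> : (i - s)%N = 0%N by lia.
    by rewrite !binomZ0 addr0.
  have -> : (i - s)%N = (i - s.+1).+1 by lia.
  exact: binomZS.
under eq_bigr => s _ do rewrite bk mulrDr rmorphD scalerDl.
under [X in _ = _ + X]eq_bigr => s _ do rewrite bm mulrDl rmorphD scalerDl.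
rewrite !big_split /= [RHS]addrA; congr (_ + _).
  rewrite -big_split /=; apply: eq_bigr => s _; rewrite -scalerDr; congr (_ *: _).
  have -> : k + 1 - s%:Z = k - s%:Z + 1 by lia.
  by rewrite lT; congr (T _ _ + T _ _); lia.
rewrite big_ord_recl mulr0 scale0r add0r [RHS]big_ord_recr /= ltnn mul0r scale0r addr0.
apply: eq_bigr => s _; rewrite /= ltn_ord; congr ((_ * _)%:~R *: T _ _); rewrite /bump /=; lia.
Qed.

Lemma leibniz_eq i T T' m k :
  (forall m' k', m' + k' = m + k - i%:Z -> k - i%:Z <= k' -> T m' k' = T' m' k') ->
  leibniz i T m k = leibniz i T' m k.
Proof.
move=> H; congr (_ *: _); apply: eq_bigr => s _; rewrite H //; have := ltn_ord s; lia.
Qed.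

Lemma leibniz_eq0 i T m k :
  (forall m' k', m' + k' = m + k - i%:Z -> m - i%:Z <= m' -> T m' k' = 0) -> leibniz i T m k = 0.
Proof.
move=> H; rewrite /leibniz big1 ?scaler0 // => s _; rewrite H ?scaler0 //; lia.
Qed.

Lemma leibniz_m0 i T k : leibniz i T 0 k = ((-1) ^+ i * binomZ k i)%:~R *: T 0 (k - i%:Z).
Proof.
rewrite /leibniz big_ord_recr /= big1 ?add0r => [|s _]; last first.
  by rewrite (@binomZ_small 0) ?mul0r ?scale0r //; have := ltn_ord s; lia.
by rewrite subnn binomZ0 mul1r scalerA rmorphM /= intr_sign addNr.
Qed.

Lemma leibniz_k0 i T m : leibniz i T m 0 = ((-1) ^+ i * binomZ m i)%:~R *: T (m - i%:Z) 0.
Proof.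
rewrite /leibniz big_ord_recl /= big1 ?addr0 => [|s _]; last first.
  by rewrite (@binomZ_small 0) ?mulr0 ?scale0r.
rewrite subn0 binomZ0 mulr1 scalerA rmorphM /= intr_sign.
by congr (_ *: T _ _); lia.
Qed.
End LatticeExpansions.

(** * Explicit pole bounds for the functionals $b\mapsto\rho(b)u$ *)

Section FaithfulModel.
Variables (F : closedFieldType) (V : lmodType F) (A : VOA V).
Local Notation Vm := (Vm A).

Lemma Vm_raise (X : lmodType F) (f : V -> X) a b l M : linmap f ->
  (forall m, m <= M -> f (Vm a m l b) = 0) ->
  forall k, l <= k -> forall m, m <= M - (k - l) -> f (Vm a m k b) = 0.
Proof.
move=> lf H; apply: int_up => [m|k _ IH m le_m]; first by rewrite subrr subr0; exact: H.
by rewrite Vm_lat (linmapD lf) !IH ?addr0 //; lia.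
Qed.

Variables (U E : lmodType F) (ev : E -> V -> U) (Dm : V -> int -> int -> E -> E).
Hypothesis hM : functional_model A ev Dm.
Let ev_linl := let: And5 (conj h _) _ _ _ _ := hM in h.
Let ev_linr := let: And5 (conj _ h) _ _ _ _ := hM in h.
Let ev_inj := let: And5 _ h _ _ _ := hM in h.
Let Dm_lat := let: And5 _ _ h _ _ := hM in h.
Let Dm_top := let: And5 _ _ _ h _ := hM in h.
Let Dm_inf := let: And5 _ _ _ _ h := hM in h.

(** This makes the existential bounds on [Dm] explicit: if $(1+x)^l$ clears the pole at -1 and
    weights of total exponent at most $M_0+l$ give no residue at infinity, the residue theorem holds
    down to every $k\le l$ with the same bound on $m+k$. *)
Lemma Dm_region e a l M0 : (forall m b, m <= M0 -> ev e (Vm a m l b) = 0) ->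
  (forall m k, l <= k -> Dm a m k e = 0) /\
  (forall m k b, k <= l -> m + k <= M0 + l -> ev (Dm a m k e) b = - ev e (Vm a m k b)).
Proof.
move=> H; have D0 m k : l <= k -> Dm a m k e = 0.
  move=> le_k; apply: ev_inj => b; rewrite (linmap0 (ev_linl b)); move: m k le_k.
  apply: lattice_ind_desc.
  - have [l' Hl'] := Dm_top a e; exists l' => m k le_k _.
    by rewrite Hl' // (linmap0 (ev_linl b)).
  - move=> k; case: (ltrP k l) => [lt_k|le_k]; first by exists 0 => m _; lia.
    have [M HM] := Dm_inf a e k; exists (Num.min M (M0 - (k - l))) => m.
    rewrite le_min => /andP[le1 le2] _; rewrite HM //.
    rewrite (@Vm_raise _ (ev e) a b l M0 (ev_linr e) _ k le_k m) ?oppr0 // => m'; exact: H.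
  move=> m k H1 H2 le_k; have /lat_dlat -> := Dm_lat a e.
  by rewrite (linmapB (ev_linl b)) H1 ?H2 ?subr0 //; lia.
split=> // m k b le_k; move: k le_k m; apply: int_down => [m le_m|k lt_k IH].
  by rewrite D0 // (linmap0 (ev_linl b)) H ?oppr0 //; lia.
apply: int_asc => [|m IHm le_m].
  by have [M HM] := Dm_inf a e k; exists M => m le_m _; exact: HM.
have /lat_dlat -> := Dm_lat a e; rewrite (linmapB (ev_linl b)) IH ?IHm; [|lia..].
by have /lat_dlat -> := Vm_lat A a b; rewrite (linmapB (ev_linr e)) opprB opprK addrC.
Qed.

Variable n : nat.

(** The coefficients of $*_n$ are $\binom{-n-1}{j}$, so the product is the expansion of
    $(1+x)^{d-1}$ at infinity cut after $j=n$; [h] supplies the vanishing tail. *)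
Lemma star_expand (X : lmodType F) (f : V -> X) d a b (h : nat -> X) : linmap f ->
  (forall j, (j <= n)%N -> h j = f (Vm a (- n.+1%:Z - j%:Z) (d + n%:Z) b)) ->
  (forall j, (n < j)%N -> h j = 0) -> f (star A n d a b) = bsum (- n.+1%:Z) h.
Proof.
move=> lf hn h0; rewrite /star linmap_sum //.
rewrite /bsum (isumE (N := n.+1)) => [|j /h0 ->]; last by rewrite scaler0.
apply: eq_bigr => j _; rewrite linmapZ // hn -1?ltnS //; congr (_ *: f _).
  rewrite -NegzE /binomZ rmorphM /= intr_sign; congr (_ * _).
  by rewrite -bin_sub ?leq_addl // addnK addnC.
by apply: eq_bsum => i; congr (Y A _ _ _); lia.
Qed.

Variable rho : V -> U -> U.
Hypothesis hU : An_module A n rho.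
Variables (u : U) (e : E).
Hypothesis he : forall b, ev e b = rho b u.

Let f b := rho b u.
Let lf : linmap f.
Proof. by case: hU => H _ _ _ _ c x y; exact: H. Qed.

Lemma rho_star d a b : Vgr A d a -> rho a (rho b u) = f (star A n d a b).
Proof. by move=> da; case: hU => _ _ _ H _; rewrite /f (H d). Qed.

Lemma rho_region d a : Vgr A d a -> forall m b, m <= - (2 * n + 2)%N%:Z ->
  ev e (Vm a m (d + n%:Z) b) = 0.
Proof.
move=> da m b le_m; rewrite he; case: hU => _ _ H _ _; apply: H; apply: span_gen; right.
(* The circle product with $s=0$ and $t=-(m+2n+2)$, nonnegative by the bound on [m]. *)
exists d, a, b, 0%N, (absz (m + (2 * n + 2)%N%:Z)); split=> //.
rewrite circ_bsum addr0; apply: eq_bsum => i; congr (Y A _ _ _); lia.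
Qed.

(** $L(-1)$ acts as $-L(0)$, in divided powers. Right multiplication by $\mathbf 1$ expresses both
    sides through [T], the sum of the residues at 0 and -1, that is, minus the residue at infinity:
    [f c] is [T 0 (d - 1)], and $c_{-1-i}\mathbf 1$ gives the same entry after $i$ divided
    differentiations of the weight $(1+x)^{d+i-1}$. *)
Lemma rho_deriv d c i : Vgr A d c ->
  f (Y A (- 1 - i%:Z) c (vac A)) = (binomZ (- d) i)%:~R *: f c.
Proof.
move=> dc; have [D0 Dreg] := Dm_region (rho_region dc).
pose S m k := f (Vm c m k (vac A)); pose T m k := ev (Dm c m k e) (vac A) + S m k.
have lS : lat S by exact: (lat_lin lf (Vm_lat A c _)).
have lT : lat T.
  move=> m k; rewrite /T lS Dm_lat (linmapD (ev_linl _)); exact: addrACA.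
have TS m k : d + n%:Z <= k -> T m k = S m k.
  by move=> le_k; rewrite /T D0 // (linmap0 (ev_linl _)) add0r.
have S0 m k : d + n%:Z <= k -> m + k <= d - n%:Z - 2 -> S m k = 0.
  move=> le_k le_mk; apply: (Vm_raise lf (M := - (2 * n + 2)%N%:Z) _ le_k); last lia.
  by move=> m' le_m'; rewrite /f -he (rho_region dc).
have T0 m k : m + k <= d - n%:Z - 2 -> T m k = 0.
  move=> le_mk; case: (lerP k (d + n%:Z)) => [le_k|/ltW le_k]; last by rewrite TS // S0.
  by rewrite /T Dreg // ?he ?addNr //; lia.
have vac0 := VOA_vac_deg A; have [_ _ _ _ hvac] := hU.
have starvac b s : Vgr A s b -> f b = f (star A n s b (vac A)).
  by move=> sb; rewrite -rho_star // hvac.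
have fc : f c = T 0 (d - 1).
  rewrite (starvac _ _ dc) (lat_expand (s := n.+1) _ lT); last first.
    by exists (- (2 * n + 2)%N%:Z) => m' k' le_m _ le_k; apply: T0; lia.
  apply: star_expand => // j lt_j; last by apply: T0; lia.
  have -> : d - 1 + n.+1%:Z = d + n%:Z by lia.
  by rewrite TS // /S sub0r.
set ci := Y A _ c _.
have dci : Vgr A (d + i%:Z) ci.
  by have := VOA_mode_deg (- 1 - i%:Z) dc vac0; congr (Vgr A _ _); lia.
have [bY tY vY jY] := VOA_weak_module A.
have Sci m k : f (Vm ci m k (vac A)) = leibniz i S m k.
  move: m k; apply: lat_eq0.
  - exact: (lat_lin lf (Vm_lat A ci _)).
  - exact: leibniz_lat.
  - by move=> m; rewrite Vm0 leibniz_k0 /S Vm0 (mode_deriv bY tY vY jY) linmapZ.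
  have [[M HM] [M' HM']] := (Vm_top A ci (vac A), Vm_top A c (vac A)).
  exists (Num.max M (M' + i%:Z)) => m k; rewrite ge_max => /andP[le1 le2].
  rewrite HM // (linmap0 lf) leibniz_eq0 // => m' k' _ le_m'.
  by rewrite /S HM' ?(linmap0 lf) //; lia.
rewrite (starvac _ _ dci).
have -> : f (star A n (d + i%:Z) ci (vac A)) = leibniz i T 0 (d + i%:Z - 1).
  rewrite (lat_expand (s := n.+1) _ (leibniz_lat i lT)); last first.
    exists (- (2 * n + 2)%N%:Z) => m' k' le_m _ le_k.
    by apply: leibniz_eq0 => m'' k'' eq_mk _; apply: T0; lia.
  have -> : d + i%:Z - 1 + n.+1%:Z = d + i%:Z + n%:Z by lia.
  apply: star_expand => // j lt_j; last first.
    by apply: leibniz_eq0 => m'' k'' eq_mk _; apply: T0; lia.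
  by rewrite Sci sub0r; apply: leibniz_eq => m' k' _ le_k'; apply: TS; lia.
rewrite leibniz_m0 fc; have -> : d + i%:Z - 1 - i%:Z = d - 1 by lia.
congr (_%:~R *: _); have := binomZ_reflect (1 - d) i.
have -> : i%:Z - (1 - d) = d + i%:Z - 1 by lia.
by have -> : 1 - d - 1 = - d by lia.
Qed.

(** In $Y(b,z)a=e^{zL(-1)}Y(a,-z)b$, [rho_deriv] turns the exponential into $(1+z)^{-\deg}$. The
    substitution $z=-x/(1+x)$ then produces the exponent $d+s-2-m-k$, the $-2$ coming from
    $dz=-(1+x)^{-2}dx$. *)
Lemma rho_skew d s a b : Vgr A d a -> Vgr A s b -> forall m k,
  f (Vm b m k a) = - sgnz F m *: f (Vm a m (d + s - 2%:Z - m - k) b).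
Proof.
move=> da sb; have lS : lat (fun m k => f (Vm a m k b)) by exact: (lat_lin lf (Vm_lat A a b)).
apply: lat_eq0.
- exact: (lat_lin lf (Vm_lat A b a)).
- move=> m k; rewrite sgnzS opprK !scaleNr.
  have -> : d + s - 2%:Z - m - (k + 1) = d + s - 2%:Z - (m + 1) - k by lia.
  have -> : d + s - 2%:Z - m - k = d + s - 2%:Z - (m + 1) - k + 1 by lia.
  by have /lat_dlat -> := lS; rewrite scalerBr addKr.
- move=> m; rewrite Vm0 subr0 VOA_skew linmapZ //; congr (_ *: _).
  rewrite (linmap_isum lf); last first.
    have [m0 H] := VOA_trunc A a b; exists (absz (m0 - m)) => i le_i.
    by rewrite H ?(mode_0l (VOA_bilin A)) ?scaler0 //; lia.
  rewrite lin_Vm //; apply: eq_isum => i; rewrite linmapZ //.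
  have dab := VOA_mode_deg (m + i%:Z) da sb; rewrite (rho_deriv i dab) scalerA -intr_sign -rmorphM.
  congr (_%:~R *: _); have := binomZ_reflect (d + s - m - 1) i.
  have -> : d + s - m - 1 - 1 = d + s - 2%:Z - m by lia.
  by move=> <-; congr (_ * binomZ _ _); lia.
have [[M HM] [M' HM']] := (Vm_top A b a, Vm_top A a b).
exists (Num.max M M') => m k; rewrite ge_max => /andP[? ?].
by rewrite HM // HM' // (linmap0 lf) scaler0.
Qed.

(* Both sides are residues at -1 of the same form: skew-symmetry is the change of variable
   [z = -x/(1+x)], which maps infinity to -1. *)
Lemma rho_mode d a b : Vgr A d a -> ev (Dm a 0 (d - 1) e) b = rho b (rho a u).
Proof.
move=> da; have [D0 Dreg] := Dm_region (rho_region da).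
pattern b; apply: (graded_ind (VOA_graded A)).
  apply: linmap_eqsub; first exact: ev_linr.
  by case: hU => H _ _ _ _ c x y; exact: H.
move=> s {}b sb; rewrite (rho_star _ sb).
(* In the coordinate $z=-x/(1+x)$ this is minus the residue at infinity with weight $z^m(1+z)^k$, to
   be expanded there into $b*_na$. *)
pose T m k := sgnz F m *: ev (Dm a m (d + s - 2%:Z - m - k) e) b.
have lT : lat T.
  move=> m k; rewrite /T sgnzS scaleNr -scalerBr; congr (_ *: _).
  have -> : d + s - 2%:Z - m - (k + 1) = d + s - 2%:Z - (m + 1) - k by lia.
  have /lat_dlat -> := Dm_lat a e; rewrite (linmapB (ev_linl b)) opprB addrCA.
  have -> : d + s - 2%:Z - (m + 1) - k + 1 = d + s - 2%:Z - m - k by lia.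
  by rewrite subrr addr0.
have T0 m k : m + k <= s - n%:Z - 2%:Z -> T m k = 0.
  by move=> le_mk; rewrite /T D0 ?(linmap0 (ev_linl b)) ?scaler0 //; lia.
have -> : ev (Dm a 0 (d - 1) e) b = T 0 (s - 1).
  by rewrite /T scale1r; congr (ev (Dm _ _ _ _) _); lia.
rewrite (lat_expand (s := n.+1) _ lT); last first.
  by exists (- (2 * n + 2)%N%:Z) => m' k' le_m _ le_k; apply: T0; lia.
apply/esym/star_expand => // j le_j; last by apply: T0; lia.
(* For $j\le n$ the exponents in $x$ are $-n-1-j$ and $d-1+j$; their sum $d-n-2$ is exactly the
   limit allowed by [Dm_region]. *)
rewrite sub0r (rho_skew da sb) scaleNr -scalerN /T.
have -> : s - 1 + n.+1%:Z = s + n%:Z by lia.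
by rewrite Dreg ?he //; lia.
Qed.
End FaithfulModel.

Section FaithfulModule.
Variables (F : closedFieldType) (V : lmodType F) (A : VOA V) (n : nat).
Variables (U : lmodType F) (rho : V -> U -> U).
Hypothesis hU : An_module A n rho.

Lemma rho_linl u : linmap (fun a => rho a u).
Proof. by case: hU => H _ _ _ _ c x y; exact: H. Qed.

Lemma rho_tame u : tame A (fun b => rho b u).
Proof.
split; first exact: rho_linl.
apply: (graded_ind (VOA_graded A)).
  split=> [|a a' [l [M H]] [l' [M' H']]|c a [l [M H]]].
  - exists 0, 0 => m b _.
    by rewrite (linmap0 (Vm_linl A m 0 b)) (linmap0 (rho_linl u)).
  - pose l2 := Num.max l l'.
    exists l2, (Num.min (M - (l2 - l)) (M' - (l2 - l'))) => m b; rewrite le_min => /andP[? ?].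
    rewrite (linmapD (Vm_linl A m _ b)) (linmapD (rho_linl u)).
    rewrite (Vm_raise (rho_linl u) (H^~ b)) ?(Vm_raise (rho_linl u) (H'^~ b)) ?addr0 //;
    by rewrite /l2; lia.
  - exists l, M => m b le_m; rewrite (linmapZ (Vm_linl A m _ b)) (linmapZ (rho_linl u)).
    by rewrite H // scaler0.
move=> d a da; exists (d + n%:Z), (- (2 * n + 2)%N%:Z) => m b le_m.
case: hU => _ _ H _ _; apply: H; apply: span_gen; right.
exists d, a, b, 0%N, (absz (m + (2 * n + 2)%N%:Z)); split=> //.
rewrite circ_bsum addr0; apply: eq_bsum => i; congr (Y A _ _ _); lia.
Qed.

Theorem An_module_embeds : exists (E : lmodType F) (YE : int -> V -> E -> E) (phi : U -> E),
  [/\ weak_module A YE, linmap phi, forall u, Omega A n YE (phi u),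
      forall d a u, Vgr A d a -> phi (rho a u) = YE (d - 1) a (phi u) & injective phi].
Proof.
have [E [ev [Dm [hM surj]]]] := functional_model_exists A U.
have [[evl evr] evi Dlat Dtop Dinf] := hM.
have [phi Hphi] := choice (fun u => surj _ (rho_tame u)).
exists E, (fun k a e => Dm a 0 k e), phi; split.
- exact: (functional_weak_module evl evr evi Dlat Dtop Dinf).
- move=> c u u'; apply: evi => b; rewrite (evl b) !Hphi.
  by case: hU => _ H _ _ _; exact: H.
- move=> u d a i da le_i.
  have [D0 _] := Dm_region hM (rho_region hU (Hphi u) da); exact: D0.
- by move=> d a u da; apply: evi => b; rewrite Hphi (rho_mode hM hU (Hphi u) _ da).
(* The functional of [u] returns [u] at the vacuum. *)
move=> u u' eq_phi; case: hU => _ _ _ _ hvac.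
by rewrite -[u]hvac -[u']hvac -!Hphi eq_phi.
Qed.
End FaithfulModule.

(** * The universal module *)

Section GradedComponents.
Variables (F : closedFieldType) (X : lmodType F) (gr : int -> X -> Prop).

Lemma sum_support (Z : nmodType) (ks ks' : seq int) (f : int -> Z) : uniq ks -> uniq ks' ->
  {subset ks <= ks'} -> (forall k, k \notin ks -> f k = 0) ->
  \sum_(k <- ks') f k = \sum_(k <- ks) f k.
Proof.
move=> uks uks' sub f0; rewrite (bigID (mem ks)) /= [X in _ + X]big1 ?addr0 => [|k /f0 //].
rewrite -big_filter; apply: perm_big; apply: uniq_perm; rewrite ?filter_uniq // => k.
by rewrite mem_filter andbC; case: (boolP (k \in ks)) => [/sub ->|_]; rewrite ?andbF.
Qed.

Definition decomposes (x : X) (p : seq int * (int -> X)) :=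
  [/\ uniq p.1, forall k, gr k (p.2 k), forall k, k \notin p.1 -> p.2 k = 0
    & x = \sum_(k <- p.1) p.2 k].

Lemma decomposes_comb c x y p q : (forall k, subspace (gr k)) ->
  decomposes x p -> decomposes y q ->
  decomposes (c *: x + y) (undup (p.1 ++ q.1), fun k => c *: p.2 k + q.2 k).
Proof.
move=> sgr [up pg p0 ->] [uq qg q0 ->]; split=> /= [|k|k|].
- exact: undup_uniq.
- by apply: subspaceD => //; apply: subspaceZ.
- by rewrite mem_undup mem_cat negb_or => /andP[/p0 -> /q0 ->]; rewrite scaler0 addr0.
rewrite big_split /= -scaler_sumr; congr (_ *: _ + _).
  by apply/esym/sum_support => // [|k kp]; rewrite ?undup_uniq // mem_undup mem_cat kp.
by apply/esym/sum_support => // [|k kp]; rewrite ?undup_uniq // mem_undup mem_cat kp orbT.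
Qed.

Lemma decomposes_single k x : (forall k, subspace (gr k)) -> gr k x ->
  decomposes x ([:: k], fun k' => if k' == k then x else 0).
Proof.
move=> sgr gx; split=> //= [k'|k'|].
- by case: eqP => [->|_] //; exact: subspace0.
- by rewrite inE => /negbTE ->.
- by rewrite big_seq1 eqxx.
Qed.

Lemma span_decomposes : (forall k, subspace (gr k)) ->
  forall x, Defs.span (fun x => exists k, gr k x) x -> exists p, decomposes x p.
Proof.
move=> sgr x; elim=> {x} [x [k gx]||x y _ [p Hp] _ [q Hq]|c x _ [p Hp]].
- by eexists; exact: decomposes_single gx.
- exists ([::], fun=> 0); split=> //= [k|]; [exact: subspace0 | by rewrite big_nil].
- by have := decomposes_comb 1 sgr Hp Hq; rewrite scale1r => H; eexists; exact: H.
have D0 : decomposes 0 ([::], fun=> 0).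
  by split=> //= [k|]; [exact: subspace0 | rewrite big_nil].
by have := decomposes_comb c sgr Hp D0; rewrite addr0 => H; eexists; exact: H.
Qed.

Record components (comp : int -> X -> X) (supp : X -> seq int) : Prop := Components {
  comp_gr : forall k x, gr k (comp k x);
  comp_lin : forall k, linmap (comp k);
  supp_uniq : forall x, uniq (supp x);
  supp_out : forall x k, k \notin supp x -> comp k x = 0;
  comp_sum : forall x, x = \sum_(k <- supp x) comp k x;
  comp_id : forall k x, gr k x -> comp k x = x;
  comp_neq : forall k l x, gr k x -> l != k -> comp l x = 0 }.

Hypothesis hgr : graded gr.

Lemma decomposes_uniq x p q : decomposes x p -> decomposes x q -> forall k, p.2 k = q.2 k.
Proof.
case: hgr => sgr _ indep Hp Hq k.
have := decomposes_comb (-1) sgr Hp Hq; rewrite scaleN1r addNr => -[/= uk gk k0 /esym sum0].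
case: (boolP (k \in undup (p.1 ++ q.1))) => [/(indep _ _ uk gk sum0)|/k0];
  by rewrite scaleN1r addrC => /eqP; rewrite subr_eq0 => /eqP.
Qed.

Lemma components_exist : exists comp supp, components comp supp.
Proof.
case: (hgr) => sgr dec indep.
have /choice[d Hd] x : exists p, decomposes x p.
  apply: span_decomposes => //; have [ks [f [fk ->]]] := dec x.
  apply: subspace_sum => [|k _]; first exact: span_subspace.
  by apply: span_gen; exists k.
exists (fun k x => (d x).2 k), (fun x => (d x).1); split.
- by move=> k x; case: (Hd x).
- by move=> k c x y; exact: (decomposes_uniq (Hd _) (decomposes_comb c sgr (Hd x) (Hd y))).
- by move=> x; case: (Hd x).
- by move=> x k; case: (Hd x) => _ _ H _; exact: H.
- by move=> x; case: (Hd x).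
- move=> k x gx; have /= -> := decomposes_uniq (Hd x) (decomposes_single sgr gx).
  by rewrite eqxx.
move=> k l x gx nlk; have /= -> := decomposes_uniq (Hd x) (decomposes_single sgr gx).
by rewrite (negbTE nlk).
Qed.

Variables (comp : int -> X -> X) (supp : X -> seq int).
Hypothesis hc : components comp supp.

Lemma comp_sum_uniq (ks : seq int) (f : int -> X) : uniq ks -> (forall k, gr k (f k)) ->
  forall k, k \in ks -> comp k (\sum_(l <- ks) f l) = f k.
Proof.
move=> uks gf k kks; rewrite (linmap_sum _ _ (comp_lin hc k)) (bigD1_seq k) //=.
rewrite (comp_id hc (gf k)) big1 ?addr0 // => l nlk.
by rewrite (comp_neq hc (gf l)) // eq_sym.
Qed.

Section GradedExtension.
Variables (Z : lmodType F) (G : int -> X -> Z).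
Hypothesis linG : forall k, linmap (G k).

Definition gext (x : X) : Z := \sum_(k <- supp x) G k (comp k x).

Lemma gext_wide ks x : uniq ks -> {subset supp x <= ks} -> gext x = \sum_(k <- ks) G k (comp k x).
Proof.
move=> uks sub; apply/esym/sum_support => // [|k kx]; first exact: supp_uniq hc x.
by rewrite (supp_out hc) // (linmap0 (linG k)).
Qed.

Lemma gext_lin : linmap gext.
Proof.
move=> c x y; pose ks := undup (supp (c *: x + y) ++ supp x ++ supp y).
have uks : uniq ks by exact: undup_uniq.
rewrite !(gext_wide uks) => [|k kx|k kx|k kx]; rewrite ?mem_undup ?mem_cat ?kx ?orbT //.
rewrite scaler_sumr -big_split; apply: eq_bigr => k _.
by rewrite (comp_lin hc) linG.
Qed.

Lemma gext_hom k x : gr k x -> gext x = G k x.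
Proof.
move=> gx; rewrite (gext_wide (undup_uniq (k :: supp x))) => [|l lx]; last first.
  by rewrite mem_undup inE lx orbT.
rewrite (bigD1_seq k) ?undup_uniq ?mem_undup ?mem_head //= (comp_id hc gx) big1 ?addr0 //.
by move=> l nlk; rewrite (comp_neq hc gx) // (linmap0 (linG l)).
Qed.
End GradedExtension.
End GradedComponents.

Section ModuleLemmas.
Variables (F : closedFieldType) (V : lmodType F) (A : VOA V).
Variables (M : lmodType F) (YM : int -> V -> M -> M) (gr : int -> M -> Prop).
Hypothesis hM : Vmodule A YM gr.
Variables (cM : int -> M -> M) (sM : M -> seq int).
Hypothesis hc : components gr cM sM.

Lemma comp_mode s a k j x : Vgr A s a -> cM (j + s - k - 1) (YM k a x) = YM k a (cM j x).
Proof.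
case: hM => -[bY _ _ _] hg _ hdeg sa; pattern x; apply: (graded_ind hg).
  apply: linmap_eqsub => c y z.
    by rewrite (mode_linr bY k a c) (comp_lin hc _ c).
  by rewrite (comp_lin hc _ c) (mode_linr bY k a c).
move=> l {}x gx; case: (eqVneq j l) => [->|njl].
  by rewrite (comp_id hc gx) (comp_id hc (hdeg _ _ _ _ _ sa gx)).
rewrite (comp_neq hc gx) // (mode_0r bY) (comp_neq hc (hdeg _ _ _ _ _ sa gx)) //.
by apply: contra njl => /eqP H; apply/eqP; lia.
Qed.
End ModuleLemmas.

(** * Formal expressions and their values in all weak modules *)

Section Universal.
Variables (F : closedFieldType) (V : lmodType F) (A : VOA V) (n : nat).
Variables (U : lmodType F) (rho : V -> U -> U).
Hypothesis hU : An_module A n rho.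
Variables (cV : int -> V -> V) (sV : V -> seq int).
Hypothesis hcV : components (Vgr A) cV sV.

Inductive expr :=
| Egen of U | Ezero | Eadd of expr & expr | Escale of F & expr
| Emode of int & int & V & expr.

Definition admissible (M : lmodType F) (YM : int -> V -> M -> M) (phi : U -> M) :=
  [/\ weak_module A YM, linmap phi, forall u, Omega A n YM (phi u)
    & forall d a u, Vgr A d a -> phi (rho a u) = YM (d - 1) a (phi u)].

(* Evaluation in [M[t,1/t]]: [Emode s k a] is the [k]-th mode of the degree [s] component of [a],
   and [eval YM phi e m] is the coefficient of [t^m]. *)
Fixpoint eval (M : lmodType F) (YM : int -> V -> M -> M) (phi : U -> M) (e : expr) (m : int) : M :=
  match e with
  | Egen u => if m == n%:Z then phi u else 0
  | Ezero => 0
  | Eadd e e' => eval YM phi e m + eval YM phi e' m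
  | Escale c e => c *: eval YM phi e m
  | Emode s k a e => YM k (cV s a) (eval YM phi e (m - s + k + 1))
  end.

Definition same_value (e e' : expr) :=
  forall (M : lmodType F) (YM : int -> V -> M -> M) (phi : U -> M),
    admissible YM phi -> forall m, eval YM phi e m = eval YM phi e' m.

Section Span.
Variables (M : lmodType F) (YM : int -> V -> M -> M) (phi : U -> M).
Hypothesis adm : admissible YM phi.

Definition mode_span (m : int) : M -> Prop := Defs.span (fun w => exists s k a u,
  [/\ Vgr A s a, s - k - 1 + n%:Z = m & w = YM k a (phi u)]).

(** Two things follow: values in negative degree vanish by the definition of $\Omega_n$, and in
    degree $n$ only the modes $o(a)$ remain, which stay inside the image of [U]. *)
Lemma eval_mode_span e m : mode_span m (eval YM phi e m).
Proof.
have [[bY tY vY jY] _ _ _] := adm.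
have hS m' : subspace (mode_span m') by exact: span_subspace.
elim: e m => [u||e IH e' IH'|c e IH|s k a e IH] m /=.
- case: eqP => [->|_]; last exact: subspace0.
  apply: span_gen; exists 0, (-1), (vac A), u; split; [exact: VOA_vac_deg | lia |].
  by rewrite vY eqxx.
- exact: subspace0.
- exact: subspaceD.
- exact: subspaceZ.
move: (eval _ _ _ _) (IH (m - s + k + 1)).
have sa := comp_gr hcV s a.
apply: span_min => [|_ [t [l [b [u [tb eq_m ->]]]]]].
  split=> [|x y Sx Sy|c x Sx].
  - by rewrite (mode_0r bY); exact: subspace0.
  - by rewrite (linmapD (mode_linr bY _ _)); exact: subspaceD.
  - by rewrite (linmapZ (mode_linr bY _ _)); exact: subspaceZ.
apply: (mode_assoc_span bY tY jY (hS m)) => i j eq_ij; apply: span_gen.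
exists (s + t - i - 1), j, (Y A i (cV s a) b), u; split=> //; last lia.
exact: VOA_mode_deg.
Qed.

Lemma mode_span_neg m w : m < 0 -> mode_span m w -> w = 0.
Proof.
have [_ _ hO _] := adm => lt_m.
apply: (span_min (S := fun w => w = 0)) => [|_ [s [k [a [u [sa eq_m ->]]]]]]; last first.
  by apply: (hO u s a k) => //; lia.
by split=> [|x y -> ->|c x ->]; rewrite ?addr0 ?scaler0.
Qed.
End Span.

(** [B] depends on the expression alone. Truncation in the universal space needs this uniformity,
    since the truncation bounds of individual modules have no common maximum in general. *)
Lemma eval_bounded e : exists B, forall (M : lmodType F) (YM : int -> V -> M -> M) (phi : U -> M),
  admissible YM phi -> forall m, B < m -> eval YM phi e m = 0.
Proof.
elim: e => [u||e [B HB] e' [B' HB']|c e [B HB]|s k a e [B HB]].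
- by exists n%:Z => M YM phi _ m lt_m /=; rewrite ifF //; apply/eqP; lia.
- by exists 0.
- exists (Num.max B B') => M YM phi adm m; rewrite gt_max => /andP[? ?] /=.
  by rewrite (HB _ _ _ adm) // (HB' _ _ _ adm) // addr0.
- by exists B => M YM phi adm m lt_m /=; rewrite (HB _ _ _ adm) // scaler0.
exists (B + s - k - 1) => M YM phi adm m lt_m /=.
rewrite (HB _ _ _ adm); last lia.
by case: adm => -[bY _ _ _] _ _ _; exact: (mode_0r bY).
Qed.

(** [same_value] quantifies over all weak modules but is a proposition, so the quotient can itself
    be one of the modules tested. The maps [evq] are jointly injective: identities in [Q] are
    checked after evaluation. *)
Lemma universal_space : exists (Q : lmodType F) (pi : expr -> Q)
    (evq : forall M : lmodType F, (int -> V -> M -> M) -> (U -> M) -> int -> Q -> M),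
  [/\ forall q, exists e, pi e = q,
    forall M YM phi e m, admissible YM phi -> evq M YM phi m (pi e) = eval YM phi e m,
    forall M YM phi m, admissible YM phi -> linmap (evq M YM phi m) &
    forall x y, (forall M YM phi m, admissible YM phi -> evq M YM phi m x = evq M YM phi m y) ->
      x = y].
Proof.
have [|||||||||||||Q [pi [surj piE piD piZ]]] :=
  @setoid_lmod F expr Eadd Ezero Escale same_value.
- by [].
- by move=> f g H M YM phi adm m; rewrite H.
- by move=> f g h H1 H2 M YM phi adm m; rewrite H1 ?H2.
- by move=> f f' g g' H1 H2 M YM phi adm m; rewrite /= H1 ?H2.
- by move=> c f f' H M YM phi adm m; rewrite /= H.
- by move=> f g h M YM phi adm m; rewrite /= addrA.
- by move=> f g M YM phi adm m; rewrite /= addrC.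
- by move=> f M YM phi adm m; rewrite /= add0r.
- by move=> f M YM phi adm m; rewrite /= scaleN1r addNr.
- by move=> c d f M YM phi adm m; rewrite /= scalerA.
- by move=> f M YM phi adm m; rewrite /= scale1r.
- by move=> c f g M YM phi adm m; rewrite /= scalerDr.
- by move=> c d f M YM phi adm m; rewrite /= scalerDl.
have [rep repK] := choice surj.
have evE M YM phi e m : admissible YM phi -> @eval M YM phi (rep (pi e)) m = eval YM phi e m.
  by move=> adm; have /piE := repK (pi e); exact.
exists Q, pi, (fun M YM phi m q => eval YM phi (rep q) m); split=> //.
- move=> M YM phi m adm c x y; rewrite -[x in LHS]repK -[y in LHS]repK -piZ -piD.
  by rewrite evE.
- by move=> x y H; rewrite -(repK x) -(repK y); apply/piE => M YM phi adm m; exact: H.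
Qed.

Section UniversalModule.
Variables (Q : lmodType F) (pi : expr -> Q)
  (evq : forall M : lmodType F, (int -> V -> M -> M) -> (U -> M) -> int -> Q -> M).
Hypotheses (evq_pi : forall M YM phi e m, admissible YM phi -> @evq M YM phi m (pi e) = eval YM phi e m)
  (evq_lin : forall M YM phi m, admissible YM phi -> linmap (@evq M YM phi m))
  (evq_ext : forall x y, (forall M YM phi m, admissible YM phi ->
     @evq M YM phi m x = evq YM phi m y) -> x = y).
Variable rep : Q -> expr.
Hypothesis repK : forall q, pi (rep q) = q.

(** The chosen representative does not matter, as [evq_ext] separates points. [Emode] sees one
    graded component of [a]; [umode] sums over the components. *)
Definition hmode (k : int) (x : Q) (s : int) (a : V) : Q := pi (Emode s k a (rep x)).

Lemma evq_hmode M YM phi k x s a m : admissible YM phi ->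
  @evq M YM phi m (hmode k x s a) = YM k (cV s a) (evq YM phi (m - s + k + 1) x).
Proof. by move=> adm; rewrite evq_pi //= -evq_pi // repK. Qed.

Lemma hmode_lin k x s : linmap (hmode k x s).
Proof.
move=> c a b; apply: evq_ext => M YM phi m adm.
rewrite (evq_lin _ adm) !evq_hmode // (comp_lin hcV s c).
by case: adm => -[bY _ _ _] _ _ _; rewrite (mode_linl bY _ _ c).
Qed.

Definition umode (k : int) (a : V) (x : Q) : Q := gext cV sV (hmode k x) a.

Lemma evq_umode M YM phi k x s a m : admissible YM phi -> Vgr A s a ->
  @evq M YM phi m (umode k a x) = YM k a (evq YM phi (m - s + k + 1) x).
Proof.
move=> adm sa; rewrite /umode (gext_hom hcV (hmode_lin k x) sa) evq_hmode //.
by rewrite (comp_id hcV sa).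
Qed.

Lemma umode_linl k x : linmap (fun a => umode k a x).
Proof. exact: (gext_lin hcV (hmode_lin k x)). Qed.

Lemma umode_linr k a : linmap (umode k a).
Proof.
move=> c x y; pattern a; apply: (graded_ind (VOA_graded A)).
  apply: linmap_eqsub; first exact: umode_linl.
  move=> d b b'; rewrite (umode_linl k x d) (umode_linl k y d) !scalerDr !scalerA mulrC.
  by rewrite addrACA.
move=> s {}a sa; apply: evq_ext => M YM phi m adm.
rewrite (evq_lin _ adm) !(evq_umode _ _ _ adm sa) (evq_lin _ adm).
by case: adm => -[bY _ _ _] _ _ _; rewrite (mode_linr bY _ _ c).
Qed.

Lemma umode_bilin : bilin umode.
Proof. by split=> [k c a b w|k a c w w']; [exact: umode_linl | exact: umode_linr]. Qed.

Lemma evq_neg M YM phi m x : admissible YM phi -> m < 0 -> @evq M YM phi m x = 0.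
Proof.
move=> adm lt_m; rewrite -(repK x) evq_pi //.
exact: (mode_span_neg adm lt_m (eval_mode_span adm _ m)).
Qed.

Lemma umode_trunc : truncation umode.
Proof.
move=> a x; pattern a; apply: (graded_ind (VOA_graded A)).
  split=> [|b b' [N HN] [N' HN']|c b [N HN]].
  - by exists 0 => k _; rewrite (linmap0 (umode_linl k x)).
  - exists (Num.max N N') => k; rewrite ge_max => /andP[? ?].
    by rewrite (linmapD (umode_linl k x)) HN // HN' // addr0.
  - by exists N => k le_k; rewrite (linmapZ (umode_linl k x)) HN // scaler0.
move=> s {}a sa; have [B HB] := eval_bounded (rep x); exists (B + s) => k le_k.
apply: evq_ext => M YM phi m adm; rewrite (linmap0 (evq_lin m adm)).
case: (ltrP m 0) => [lt_m|le_m]; first exact: evq_neg.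
rewrite (evq_umode _ _ _ adm sa) -[x]repK evq_pi // (HB _ _ _ adm); last lia.
by case: adm => -[bY _ _ _] _ _ _; exact: (mode_0r bY).
Qed.

Lemma umode_borcherds : borcherds (Y A) umode.
Proof.
have [bU tU] := (umode_bilin, umode_trunc).
apply/borcherdsE => // p q r u v w.
pattern u; apply: (graded_ind (VOA_graded A)).
  by apply: linmap_eqsub; [exact: iterate3_linl | exact: commut2_linl].
move=> s {}u su; pattern v; apply: (graded_ind (VOA_graded A)).
  by apply: linmap_eqsub; [exact: iterate3_linr | exact: commut2_linr].
move=> t {}v tv; apply: evq_ext => M YM phi m adm.
have [[bY tY vY jY] _ _ _] := adm.
have lin := evq_lin m adm.
have [H H'] := (mode_up2 bU tU u v w, mode_up1 bU tU u v w).
rewrite /commut2 (linmapB lin) (xyexp_lin (f := evq YM phi m)) // (yxexp_lin (f := evq YM phi m)) //.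
rewrite /iterate3 (bsum_lin p lin (iterate3_ev0 A bU r p q u v w)).
(* Every term of the identity shifts degree by $s+t-p-q-r-2$, so all of them in degree [m] start
   from the same component of [w]. *)
have := jacobi bY tY jY p q r u v (evq YM phi (m - s - t + p + q + r + 2%:Z) w).
rewrite /iterate3 /commut2 => J.
transitivity (bsum p (fun i => YM (p + q - i%:Z) (Y A (r + i%:Z) u v)
    (evq YM phi (m - s - t + p + q + r + 2%:Z) w))).
  apply: eq_bsum => i; rewrite (evq_umode _ _ _ adm (VOA_mode_deg _ su tv)).
  by congr (YM _ _ (evq _ _ _ _)); lia.
rewrite J; congr (_ - _ *: _); apply: eq_bsum => i; congr (_ *: _).
  rewrite (evq_umode _ _ _ adm su) (evq_umode _ _ _ adm tv).
  by congr (YM _ _ (YM _ _ (evq _ _ _ _))); lia.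
rewrite (evq_umode _ _ _ adm tv) (evq_umode _ _ _ adm su).
by congr (YM _ _ (YM _ _ (evq _ _ _ _))); lia.
Qed.

Lemma umode_weak : weak_module A umode.
Proof.
split; [exact: umode_bilin | exact: umode_trunc | | exact: umode_borcherds].
move=> k w; apply: evq_ext => M YM phi m adm.
rewrite (evq_umode _ _ _ adm (VOA_vac_deg A)); case: (adm) => -[_ _ vY _] _ _ _.
rewrite vY; case: eqP => [->|_]; last by rewrite (linmap0 (evq_lin m adm)).
by congr (evq _ _ _ _); lia.
Qed.

Definition uiota (u : U) : Q := pi (Egen u).

Lemma evq_uiota M YM phi m u : admissible YM phi ->
  @evq M YM phi m (uiota u) = if m == n%:Z then phi u else 0.
Proof. by move=> adm; rewrite evq_pi. Qed.

Lemma uiota_adm : admissible umode uiota.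
Proof.
split; first exact: umode_weak.
- move=> c u u'; apply: evq_ext => M YM phi m adm; rewrite (evq_lin _ adm) !evq_uiota //.
  by case: eqP => _; [case: adm => _ lphi _ _; exact: lphi | rewrite scaler0 addr0].
- move=> u d a i da le_i; apply: evq_ext => M YM phi m adm.
  rewrite (evq_umode _ _ _ adm da) evq_uiota // (linmap0 (evq_lin m adm)).
  case: (adm) => -[bY _ _ _] _ hO _; case: eqP => _; last exact: (mode_0r bY).
  exact: (hO u d a i).
move=> d a u da; apply: evq_ext => M YM phi m adm.
rewrite (evq_umode _ _ _ adm da) !evq_uiota //.
have -> : m - d + (d - 1) + 1 = m by lia.
case: (adm) => -[bY _ _ _] _ _ hphi; case: eqP => _; first exact: hphi.
by rewrite (mode_0r bY).
Qed.

Definition ugr (m : int) (x : Q) := forall M YM phi m', admissible YM phi -> m' != m ->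
  @evq M YM phi m' x = 0.

Lemma ugr_subspace m : subspace (ugr m).
Proof.
split=> [|x y gx gy|c x gx] M YM phi m' adm nm.
- exact: (linmap0 (evq_lin m' adm)).
- by rewrite (linmapD (evq_lin m' adm)) gx // gy // addr0.
- by rewrite (linmapZ (evq_lin m' adm)) gx // scaler0.
Qed.

Lemma ugr_iota u : ugr n (uiota u).
Proof. by move=> M YM phi m adm /negbTE nm; rewrite evq_uiota // nm. Qed.

Lemma ugr_mode s k m a x : Vgr A s a -> ugr m x -> ugr (m + s - k - 1) (umode k a x).
Proof.
move=> sa gx M YM phi m' adm nm; rewrite (evq_umode _ _ _ adm sa) gx //.
  by case: (adm) => -[bY _ _ _] _ _ _; exact: (mode_0r bY).
by apply: contra nm => /eqP H; apply/eqP; lia.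
Qed.

Lemma pi_mode s k a e : pi (Emode s k a e) = umode k (cV s a) (pi e).
Proof.
apply: evq_ext => M YM phi m adm.
by rewrite (evq_umode _ _ _ adm (comp_gr hcV s a)) !evq_pi.
Qed.

Lemma umode_generated S : weak_sub umode S -> (forall u, S (uiota u)) -> forall x, S x.
Proof.
move=> [hS Sm] Su x; rewrite -(repK x); elim: (rep x) => [u||e IH e' IH'|c e IH|s k a e IH].
- exact: Su.
- suff -> : pi Ezero = 0 by exact: subspace0.
  by apply: evq_ext => M YM phi m adm; rewrite evq_pi // (linmap0 (evq_lin m adm)).
- suff -> : pi (Eadd e e') = pi e + pi e' by exact: subspaceD.
  by apply: evq_ext => M YM phi m adm; rewrite (linmapD (evq_lin m adm)) !evq_pi.
- suff -> : pi (Escale c e) = c *: pi e by exact: subspaceZ.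
  by apply: evq_ext => M YM phi m adm; rewrite (linmapZ (evq_lin m adm)) !evq_pi.
- by rewrite pi_mode; exact: Sm.
Qed.

Lemma ugr_graded : graded ugr.
Proof.
split; first exact: ugr_subspace.
  move=> x; suff [p [_ gp _ ->]] : exists p, decomposes ugr x p by exists p.1, p.2.
  apply: span_decomposes; first exact: ugr_subspace.
  move: x; apply: umode_generated => [|u]; last first.
    by apply: span_gen; exists n%:Z; exact: ugr_iota.
  split; first exact: span_subspace.
  move=> k a w Sw; move: w Sw.
  pattern a; apply: (graded_ind (VOA_graded A)).
    split=> [w _|b b' Hb Hb' w Sw|c b Hb w Sw].
    - by rewrite (linmap0 (umode_linl k w)); exact: span0.
    - by rewrite (linmapD (umode_linl k w)); apply: spanD; [exact: Hb | exact: Hb'].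
    - by rewrite (linmapZ (umode_linl k w)); apply: spanZ; exact: Hb.
  move=> s {}a sa; apply: span_min => [|w [m gw]].
    split=> [|x y Sx Sy|c x Sx].
    - by rewrite (linmap0 (umode_linr k a)); exact: span0.
    - by rewrite (linmapD (umode_linr k a)); exact: spanD.
    - by rewrite (linmapZ (umode_linr k a)); exact: spanZ.
  by apply: span_gen; exists (m + s - k - 1); exact: ugr_mode.
move=> ks f uks gf sum0 k kks; apply: evq_ext => M YM phi m adm.
rewrite (linmap0 (evq_lin m adm)); case: (eqVneq m k) => [->|nmk]; last exact: gf.
rewrite -(linmap0 (evq_lin k adm)) -sum0 (linmap_sum _ _ (evq_lin k adm)).
rewrite (bigD1_seq k) //= [X in _ + X]big1 ?addr0 // => l nlk.
by apply: gf => //; rewrite eq_sym.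
Qed.

Lemma umode_Vmodule : Vmodule A umode ugr.
Proof.
split; [exact: umode_weak | exact: ugr_graded | | by move=> *; exact: ugr_mode].
move=> j w lt_j gw; apply: evq_ext => M YM phi m adm; rewrite (linmap0 (evq_lin m adm)).
by case: (eqVneq m j) => [->|nmj]; [exact: evq_neg | exact: gw].
Qed.

(** [M] has no grading, so values live in $M[t,1/t]$; summing the coefficients over all degrees,
    that is, setting $t=1$, gives the map to [M]. *)
Lemma umode_lift (M : lmodType F) (YM : int -> V -> M -> M) phi : admissible YM phi ->
  exists2 f : Q -> M, weak_hom umode YM f &
  (forall m x, ugr m x -> f x = evq YM phi m x) /\ forall u, f (uiota u) = phi u.
Proof.
move=> adm; have [cQ [sQ hcQ]] := components_exist ugr_graded.
have lG m := evq_lin m adm.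
pose f := gext cQ sQ (fun m => evq YM phi m).
have fhom m x : ugr m x -> f x = evq YM phi m x by exact: (gext_hom hcQ lG).
have lf : linmap f by exact: (gext_lin hcQ lG).
have [[bY _ _ _] _ _ _] := adm.
exists f; last first.
  by split=> // u; rewrite (fhom _ _ (ugr_iota u)) evq_uiota // eqxx.
split=> // k a x; pattern a; apply: (graded_ind (VOA_graded A)).
  apply: linmap_eqsub => c b b'; first by rewrite (umode_linl k x c) lf.
  exact: (mode_linl bY).
move=> s {}a sa; pattern x; apply: (graded_ind ugr_graded).
  apply: linmap_eqsub => c y z; first by rewrite (umode_linr k a c) lf.
  by rewrite lf (mode_linr bY k a c).
move=> m {}x gx; rewrite (fhom _ _ (@ugr_mode s k m a x sa gx)) (fhom _ _ gx) (evq_umode _ _ _ adm sa).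
by congr (YM _ _ (evq _ _ _ _)); lia.
Qed.

Lemma umode_hom_uniq (M : lmodType F) (YM : int -> V -> M -> M) f g :
  weak_hom umode YM f -> weak_hom umode YM g -> (forall u, f (uiota u) = g (uiota u)) ->
  forall w, f w = g w.
Proof.
move=> [lf mf] [lg mg] E; apply: umode_generated => //; split; first exact: linmap_eqsub.
by move=> k v w Ew; rewrite mf mg Ew.
Qed.

Lemma umode_iso : An_iso_onto A rho umode uiota (ugr n).
Proof.
have [_ li _ hi] := uiota_adm; split=> //.
(* Non-collapse: the degree $n$ coefficient is evaluated in the module of functionals, where [U]
   embeds. *)
- move=> u u' E; have [M [YM [phi [wM lphi hO hphi injphi]]]] := An_module_embeds hU.
  have adm : admissible YM phi by [].
  by apply: injphi; have := evq_uiota n u adm; rewrite E evq_uiota // eqxx.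
- move=> w; split=> [gw|[u ->]]; last exact: ugr_iota.
  (* The universal space is evaluated in itself: its lift agrees with the identity on [U], so [w] is
     its own degree $n$ value and hence a combination of modes $o(a)$ applied to [U]. *)
  have [f hf [fgr fi]] := umode_lift uiota_adm.
  have hid : weak_hom umode umode id by split.
  have Ew : evq umode uiota n w = w.
    by rewrite -fgr // (umode_hom_uniq hf hid).
  have := eval_mode_span uiota_adm (rep w) n; rewrite -evq_pi ?repK ?Ew; last exact: uiota_adm.
  apply: (span_min (S := fun w => exists u, w = uiota u)) => [|_ [s [k [a [u [sa eq_n ->]]]]]].
    split=> [|_ _ [u ->] [u' ->]|c _ [u ->]].
    + by exists 0; rewrite (linmap0 li).
    + by exists (u + u'); rewrite (linmapD li).
    + by exists (c *: u); rewrite (linmapZ li).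
  exists (rho a u); rewrite (hi s) //; congr (umode _ _ _); lia.
Qed.
End UniversalModule.

Theorem universal_module_exists :
  exists (MU : lmodType F) (YMU : int -> V -> MU -> MU) (grMU : int -> MU -> Prop) (iota : U -> MU),
  [/\ Vmodule A YMU grMU, generated_by YMU (grMU n%:Z), An_iso_onto A rho YMU iota (grMU n%:Z),
    forall (M : lmodType F) (YM : int -> V -> M -> M) phi, admissible YM phi ->
      exists f, weak_hom YMU YM f /\ forall u, f (iota u) = phi u &
    forall (M : lmodType F) (YM : int -> V -> M -> M) f g, weak_hom YMU YM f -> weak_hom YMU YM g ->
      (forall u, f (iota u) = g (iota u)) -> forall w, f w = g w].
Proof.
have [Q [pi [evq [surj evq_pi evq_lin evq_ext]]]] := universal_space.
have [rep repK] := choice surj.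
exists Q, (umode pi rep), (ugr evq), (uiota pi); split.
- exact: umode_Vmodule.
- move=> S hS Sn; apply: (umode_generated evq_pi evq_lin evq_ext repK hS) => u.
  by apply: Sn; exact: ugr_iota.
- exact: umode_iso.
- move=> M YM phi adm.
  by have [f hf [_ fi]] := umode_lift evq_pi evq_lin evq_ext repK adm; exists f.
- by move=> M YM f g; exact: (umode_hom_uniq evq_pi evq_lin evq_ext repK).
Qed.
End Universal.

(** * The radical and its quotient *)

Section GradedSubmodules.
Variables (F : closedFieldType) (X : lmodType F) (gr : int -> X -> Prop).
Variables (comp : int -> X -> X) (supp : X -> seq int).
Hypotheses (hgr : graded gr) (hc : components gr comp supp).

Lemma gr_closed_comp (S : X -> Prop) : subspace S -> gr_closed gr S ->
  forall k x, S x -> S (comp k x).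
Proof.
move=> hS H k x Sx; case: (boolP (k \in supp x)) => [kx|/(supp_out hc) ->]; last exact: subspace0.
apply: (H x Sx (supp x) (comp^~ x)) => //.
- exact: supp_uniq hc x.
- by move=> l; exact: comp_gr hc l x.
- exact: comp_sum hc x.
Qed.

Lemma comp_gr_closed (S : X -> Prop) : (forall k x, S x -> S (comp k x)) -> gr_closed gr S.
Proof.
by move=> H x Sx ks f uks gf E k kks; rewrite -(comp_sum_uniq hc uks gf kks) -E; exact: H.
Qed.
End GradedSubmodules.

Section Quotient.
Variables (F : closedFieldType) (V : lmodType F) (A : VOA V).
Variables (M : lmodType F) (YM : int -> V -> M -> M) (gr : int -> M -> Prop).
Hypothesis hM : Vmodule A YM gr.

Lemma quotient_Vmodule (J : M -> Prop) : graded_sub YM gr J ->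
  exists (L : lmodType F) (YL : int -> V -> L -> L) (grL : int -> L -> Prop) (pi : M -> L),
    [/\ Vmodule A YL grL, weak_hom YM YL pi, forall x, exists w, pi w = x,
      forall w, pi w = 0 <-> J w & forall m x, grL m x <-> exists2 w, gr m w & pi w = x].
Proof.
case: hM => -[bY tY vY jY] hg neg deg [[hJ JY] Jgr].
pose R x y := J (x - y).
have J0 x y : x = y -> R x y by move=> ->; rewrite /R subrr; exact: subspace0.
have [|||||||||||||L [pi [surj piE piD piZ]]] :=
  @setoid_lmod F M +%R 0 (fun c x => c *: x) R.
- by move=> x; exact: J0.
- by move=> x y; rewrite /R => /(subspaceN hJ); rewrite opprB.
- by move=> x y z Rxy Ryz; have := subspaceD hJ Rxy Ryz; rewrite addrA subrK.
- by move=> x x' y y' Rx Ry; have := subspaceD hJ Rx Ry; rewrite /R opprD addrACA.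
- by move=> c x x' Rx; have := subspaceZ hJ c Rx; rewrite /R scalerBr.
- by move=> x y z; apply: J0; rewrite addrA.
- by move=> x y; apply: J0; rewrite addrC.
- by move=> x; apply: J0; rewrite add0r.
- by move=> x; apply: J0; rewrite scaleN1r addNr.
- by move=> c d x; apply: J0; rewrite scalerA.
- by move=> x; apply: J0; rewrite scale1r.
- by move=> c x y; apply: J0; rewrite scalerDr.
- by move=> c d x; apply: J0; rewrite scalerDl.
have lpi : linmap pi by move=> c x y; rewrite piD piZ.
have pi0 w : pi w = 0 <-> J w by rewrite -(linmap0 lpi) piE /R subr0.
have [rep repK] := choice surj.
pose YL k a y := pi (YM k a (rep y)).
have YLpi k a x : YL k a (pi x) = pi (YM k a x).
  by apply/piE; rewrite /R -(linmapB (mode_linr bY k a)); apply/JY/piE; rewrite repK.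
pose grL m y := exists2 w, gr m w & pi w = y.
exists L, YL, grL, pi; split=> //; last by split=> // k v w; rewrite YLpi.
have bL : bilin YL.
  split=> [k c a b y|k a c y z].
    by rewrite -(repK y) !YLpi (mode_linl bY _ _ c) lpi.
  by rewrite -(repK y) -(repK z) -lpi !YLpi (mode_linr bY _ _ c) lpi.
have tL : truncation YL.
  move=> a y; have [N HN] := tY a (rep y); exists N => k /HN E.
  by rewrite /YL E (linmap0 lpi).
split.
- split=> //.
    move=> k y; rewrite -(repK y) YLpi vY; case: ifP => // _.
    exact: (linmap0 lpi).
  apply/borcherdsE => // p q r u v y; rewrite -(repK y); set w := rep y.
  have -> : iterate3 A YL r p q u v (pi w) = pi (iterate3 A YM r p q u v w).
    rewrite /iterate3 (bsum_lin p lpi (iterate3_ev0 A bY r p q u v w)).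
    by apply: eq_bsum => i; rewrite YLpi.
  rewrite (jacobi bY tY jY) /commut2 (linmapB lpi).
  rewrite (xyexp_lin (f := pi)) //; last exact: mode_up2.
  rewrite (yxexp_lin (f := pi)) //; last exact: mode_up1.
  by congr (_ - _ *: _); apply: eq_bsum => i; rewrite !YLpi.
- case: hg => sgr dec indep; split.
  + move=> k; split=> [|_ _ [x gx <-] [y gy <-]|c _ [x gx <-]].
    * by exists 0; [exact: subspace0 | exact: linmap0].
    * by exists (x + y); [exact: subspaceD | exact: linmapD].
    * by exists (c *: x); [exact: subspaceZ | exact: linmapZ].
  + move=> y; have [ks [f [gf E]]] := dec (rep y); exists ks, (fun k => pi (f k)); split.
      by move=> k; exists (f k).
    by rewrite -(repK y) E (linmap_sum _ _ lpi).
  move=> ks f uks gf sum0 k kks.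
  have [g Hg] := choice (fun k => let: ex_intro2 w gw pw := gf k in ex_intro _ w (conj gw pw)).
  have [_ <-] := Hg k; apply/pi0.
  have Jg : J (\sum_(l <- ks) g l).
    apply/pi0; rewrite (linmap_sum _ _ lpi) -[RHS]sum0.
    by apply: eq_bigr => l _; case: (Hg l).
  exact: (Jgr _ Jg ks g uks (fun l => (Hg l).1) erefl k kks).
- by move=> j y lt_j [w gw <-]; rewrite (neg j w) ?(linmap0 lpi).
move=> s k m v y sv [w gw <-]; rewrite YLpi; exists (YM k v w) => //; exact: deg.
Qed.
End Quotient.

Section Radical.
Variables (F : closedFieldType) (V : lmodType F) (A : VOA V) (n : nat).
Variables (U : lmodType F) (rho : V -> U -> U).
Hypothesis hU : An_module A n rho.

Lemma low_degree_zero_factors (L : lmodType F) (YL : int -> V -> L -> L) (grL : int -> L -> Prop)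
    (psi : U -> L) : Vmodule A YL grL -> An_iso_onto A rho YL psi (grL n%:Z) ->
  (forall x, grL 0 x -> x = 0) -> factors_prev A n rho.
Proof.
move=> [wL _ neg deg] [lpsi inj psin hpsi] L0.
have gpsi u : grL n%:Z (psi u) by apply/psin; exists u.
case: n neg deg psin gpsi hU => [|n'] neg deg psin gpsi hU'.
  by move=> x u; apply: inj; rewrite (linmap0 lpsi) (L0 _ (gpsi _)).
move=> x u xO; apply: inj; rewrite (linmap0 lpsi).
have Ou : Omega A n' YL (psi u).
  (* A mode of index $i\ge d+n'$ sends degree $n'+1$ to degree at most 0, where everything
     vanishes. *)
  move=> d a i da le_i; have g := deg _ i _ _ _ da (gpsi u).
  case: (ltrP (n'.+1%:Z + d - i - 1) 0) => [lt_d|le_d]; first exact: neg lt_d g.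
  by apply: L0; move: g; congr (grL _ _); lia.
apply: (Omega_On_zero (ow := fun a => psi (rho a u)) wL Ou) => //.
  by move=> c a b; rewrite (rho_linl hU' u c) lpsi.
by move=> d a da; exact: hpsi.
Qed.

Variables (M : lmodType F) (YM : int -> V -> M -> M) (gr : int -> M -> Prop) (iota : U -> M).
Hypotheses (hM : Vmodule A YM gr) (hgen : generated_by YM (gr n%:Z)).
Variables (cM : int -> M -> M) (sM : M -> seq int).
Hypothesis hc : components gr cM sM.

(* the vectors generating a submodule that avoids degree [n] *)
Definition radical (x : M) := forall k a, cM n (YM k a x) = 0.

(** Testing single modes is enough: on $b_jx$, a product $a_kb_jx$ is a combination of modes
    $(a_ib)_lx$, whose degree $n$ components vanish. *)
Lemma radical_sub : graded_sub YM gr radical.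
Proof.
case: hM => -[bY tY vY jY] hg _ deg; split; [split|].
- split=> [|x y Hx Hy|c x Hx] k a.
  + by rewrite (mode_0r bY) (linmap0 (comp_lin hc _)).
  + by rewrite (linmapD (mode_linr bY k a)) (linmapD (comp_lin hc _)) Hx Hy addr0.
  + by rewrite (linmapZ (mode_linr bY k a)) (linmapZ (comp_lin hc _)) Hx scaler0.
- move=> j b x Hx k a; apply: (mode_assoc_span bY tY jY (linmap_ker (comp_lin hc n))).
  by move=> i l _; exact: Hx.
apply: (comp_gr_closed hc) => k x Hx j a; pattern a; apply: (graded_ind (VOA_graded A)).
  apply: linmap_ker => c b b'.
  by rewrite (mode_linl bY j (cM k x) c) (comp_lin hc n c).
move=> s {}a sa; rewrite /= -(comp_mode hM hc j k x sa).
case: (eqVneq n%:Z (k + s - j - 1)) => [<-|neq]; first by rewrite Hx (linmap0 (comp_lin hc _)).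
by rewrite (comp_neq hc (comp_gr hc _ _)).
Qed.

Lemma radical_top w : radical w -> gr n%:Z w -> w = 0.
Proof.
case: hM => -[_ _ vY _] _ _ _ Rw gw.
by have := Rw (-1) (vac A); rewrite vY eqxx (comp_id hc gw).
Qed.

Lemma radical_max J : graded_sub YM gr J -> (forall w, J w -> gr n%:Z w -> w = 0) ->
  forall w, J w -> radical w.
Proof.
move=> [[hJ JY] Jgr] J0 w Jw k a; apply: J0; last exact: comp_gr hc _ _.
by apply: (gr_closed_comp hc hJ Jgr); exact: JY.
Qed.

Hypothesis hiso : An_iso_onto A rho YM iota (gr n%:Z).
Variables (L : lmodType F) (YL : int -> V -> L -> L) (grL : int -> L -> Prop) (pi : M -> L).
Hypotheses (hL : Vmodule A YL grL) (hpi : weak_hom YM YL pi) (pi_surj : forall x, exists w, pi w = x)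
  (pi_ker : forall w, pi w = 0 <-> radical w)
  (pi_gr : forall m x, grL m x <-> exists2 w, gr m w & pi w = x).

Lemma quotient_iso : An_iso_onto A rho YL (pi \o iota) (grL n%:Z).
Proof.
have [li inj in_n hi] := hiso; have [lpi mpi] := hpi; split=> [c u u'|u u' /= E|x|d a u da] /=.
- by rewrite li lpi.
- apply/eqP; rewrite -subr_eq0; apply/eqP/inj; rewrite (linmap0 li).
  apply: radical_top; last by apply/in_n; exists (u - u').
  by apply/pi_ker; rewrite (linmapB li) (linmapB lpi) E subrr.
- rewrite pi_gr; split=> [[w /in_n[u ->] <-]|[u ->]]; first by exists u.
  by exists (iota u) => //; apply/in_n; exists u.
- by rewrite (hi d) // mpi.
Qed.

Lemma quotient_generated : generated_by YL (grL n%:Z).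
Proof.
move=> S [hS SY] Sn x; have [w <-] := pi_surj x; have [lpi mpi] := hpi.
move: w; apply: hgen => [|w gw]; last by apply: Sn; rewrite pi_gr; exists w.
split=> [|k v w Sw]; last by rewrite mpi; exact: SY.
split=> [|w w' Sw Sw'|c w Sw].
- by rewrite (linmap0 lpi); exact: subspace0.
- by rewrite (linmapD lpi); exact: subspaceD.
- by rewrite (linmapZ lpi); exact: subspaceZ.
Qed.

(** The degree $n$ part of a graded submodule [S] pulls back to a submodule of [U]. If it is
    everything, [S] contains the generators; if it is zero, the preimage of [S] avoids degree $n$,
    lies in the radical, and [S] is zero. *)
Lemma simple_quotient_irreducible : simple_An rho -> irreducible YL grL.
Proof.
move=> [[u0 nz] simple]; have [lpsi inj in_n hpsi] := quotient_iso; have [lpi mpi] := hpi.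
have [cL [sL hcL]] : exists cL sL, components grL cL sL.
  by case: hL => _ hg _ _; exact: components_exist.
split; first by exists (pi (iota u0)) => E; apply: nz; apply: inj; rewrite (linmap0 lpsi) /= E.
move=> S [[hS SY] Sgr].
pose SU u := S (pi (iota u)).
have sSU : subspace SU.
  split=> [|u u' Su Su'|c u Su].
  - by rewrite /SU -/((pi \o iota) 0) (linmap0 lpsi); exact: subspace0.
  - by rewrite /SU -/((pi \o iota) (u + u')) (linmapD lpsi); exact: subspaceD.
  - by rewrite /SU -/((pi \o iota) (c *: u)) (linmapZ lpsi); exact: subspaceZ.
have rSU a u : SU u -> SU (rho a u).
  move=> Su; pattern a; apply: (graded_ind (VOA_graded A)).
    split=> [|b b' Sb Sb'|c b Sb].
    - by rewrite (linmap0 (rho_linl hU u)); exact: subspace0.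
    - by rewrite (linmapD (rho_linl hU u)); exact: subspaceD.
    - by rewrite (linmapZ (rho_linl hU u)); exact: subspaceZ.
  by move=> d {}a da; have /= := hpsi _ _ u da; rewrite /SU => ->; exact: SY.
case: (simple SU sSU rSU) => [SU0|SUT]; last first.
  right; apply: quotient_generated => // w; rewrite in_n => -[u ->]; exact: SUT.
left=> x; have [w <-] := pi_surj x => Sw; apply/pi_ker.
apply: (@radical_max (fun w => S (pi w))) Sw.
  split; [split|].
  - split=> [|y z Sy Sz|c y Sy].
    + by rewrite (linmap0 lpi); exact: subspace0.
    + by rewrite (linmapD lpi); exact: subspaceD.
    + by rewrite (linmapZ lpi); exact: subspaceZ.
  - by move=> k v y Sy; rewrite mpi; exact: SY.
  - move=> y Sy ks f uks gf E k kks; apply: (Sgr _ Sy ks (fun k => pi (f k))) => //.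
      by move=> l; rewrite pi_gr; exists (f l).
    by rewrite E (linmap_sum _ _ lpi).
move=> y Sy gy; case: hiso => li _ /(_ y)[/(_ gy)[u Eu] _] _.
by rewrite Eu in Sy *; rewrite (SU0 u Sy) (linmap0 li).
Qed.

(** The submodule [T] generated by [S] meets degree $n$ in [S] only, because the modes preserving
    degree are the $o(a)$. So [T] zero or everything forces the same for [S]. *)
Lemma irreducible_quotient_simple : irreducible YL grL -> simple_An rho.
Proof.
move=> [[x0 nz] irr]; have [lpsi inj in_n hpsi] := quotient_iso.
case: (hL) => -[bL tL vL jL] hgL _ degL.
have [cL [sL hcL]] := components_exist hgL.
set psi := pi \o iota in lpsi inj in_n hpsi.
split.
  (* If [U] were zero, so would be the degree $n$ part, which generates the quotient. *)
  apply: contrapT => H; apply: nz; apply: (quotient_generated (S := fun x => x = 0)).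
    split; first by split=> [|x y -> ->|c x ->]; rewrite ?addr0 ?scaler0.
    by move=> k v w ->; exact: mode_0r.
  move=> w /in_n[u ->]; suff -> : u = 0 by exact: linmap0.
  by apply: contrapT => nu; apply: H; exists u.
move=> S hS Srho; pose T := Defs.span (fun x => exists k a u, S u /\ x = YL k a (psi u)).
have hT : subspace T by exact: span_subspace.
have ST u : S u -> T (psi u).
  by move=> Su; apply: span_gen; exists (-1), (vac A), u; rewrite vL eqxx.
have gT : graded_sub YL grL T.
  split; [split=> //|].
    move=> k b; apply: span_min => [|_ [j [a [u [Su ->]]]]].
      split=> [|x y Tx Ty|c x Tx].
      - by rewrite (mode_0r bL); exact: subspace0.
      - by rewrite (linmapD (mode_linr bL k b)); exact: subspaceD.
      - by rewrite (linmapZ (mode_linr bL k b)); exact: subspaceZ.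
    apply: (mode_assoc_span bL tL jL hT) => i l _.
    by apply: span_gen; exists l, (Y A i b a), u.
  apply: (comp_gr_closed hcL) => k; apply: span_min => [|_ [j [a [u [Su ->]]]]].
    split=> [|x y Tx Ty|c x Tx].
    - by rewrite (linmap0 (comp_lin hcL k)); exact: subspace0.
    - by rewrite (linmapD (comp_lin hcL k)); exact: subspaceD.
    - by rewrite (linmapZ (comp_lin hcL k)); exact: subspaceZ.
  pattern a; apply: (graded_ind (VOA_graded A)).
    split=> [|b b' Tb Tb'|c b Tb].
    - by rewrite (mode_0l bL) (linmap0 (comp_lin hcL k)); exact: subspace0.
    - rewrite (linmapD (mode_linl bL j (psi u))) (linmapD (comp_lin hcL k)).
      exact: subspaceD.
    - rewrite (linmapZ (mode_linl bL j (psi u))) (linmapZ (comp_lin hcL k)).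
      exact: subspaceZ.
  move=> d {}a da; have gu : grL n%:Z (psi u) by apply/in_n; exists u.
  have g := degL _ j _ _ _ da gu; case: (eqVneq k (n%:Z + d - j - 1)) => [->|nk].
    by rewrite (comp_id hcL g); apply: span_gen; exists j, a, u.
  by rewrite (comp_neq hcL g nk); exact: subspace0.
have Tn x : T x -> exists2 u, S u & cL n x = psi u.
  move: x; apply: (span_min (S := fun x => exists2 u, S u & cL n x = psi u)).
    split=> [|x y [u Su Eu] [u' Su' Eu']|c x [u Su Eu]].
    - by exists 0; [exact: subspace0 | rewrite (linmap0 (comp_lin hcL n)) (linmap0 lpsi)].
    - exists (u + u'); first exact: subspaceD.
      by rewrite (linmapD (comp_lin hcL n)) Eu Eu' (linmapD lpsi).
    - exists (c *: u); first exact: subspaceZ.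
      by rewrite (linmapZ (comp_lin hcL n)) Eu (linmapZ lpsi).
  move=> _ [j [a [u [Su ->]]]]; pattern a; apply: (graded_ind (VOA_graded A)).
    split=> [|b b' [v Sv Ev] [v' Sv' Ev']|c b [v Sv Ev]].
    - exists 0; first exact: subspace0.
      by rewrite (mode_0l bL) (linmap0 (comp_lin hcL n)) (linmap0 lpsi).
    - exists (v + v'); first exact: subspaceD.
      by rewrite (linmapD (mode_linl bL j (psi u))) (linmapD (comp_lin hcL n)) Ev Ev' (linmapD lpsi).
    - exists (c *: v); first exact: subspaceZ.
      by rewrite (linmapZ (mode_linl bL j (psi u))) (linmapZ (comp_lin hcL n)) Ev (linmapZ lpsi).
  move=> d {}a da; have gu : grL n%:Z (psi u) by apply/in_n; exists u.
  have g := degL _ j _ _ _ da gu; case: (eqVneq j (d - 1)) => [Ej|nj].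
    exists (rho a u); first exact: Srho.
    rewrite (hpsi d) // -Ej (comp_id hcL) //; move: g; congr (grL _ _); lia.
  exists 0; first exact: subspace0.
  rewrite (linmap0 lpsi) (comp_neq hcL g) //.
  by apply: contra nj => /eqP H; apply/eqP; lia.
case: (irr T gT) => [T0|TT]; [left|right] => u.
  by move=> /ST/T0 E; apply: inj; rewrite E (linmap0 lpsi).
have [v Sv] := Tn _ (TT (psi u)); rewrite (comp_id hcL); last by apply/in_n; exists u.
by move=> /inj ->.
Qed.
End Radical.

Theorem theorem4p1 (F : closedFieldType) (hF2 : (2%:R : F) != 0)
  (V : lmodType F) (A : VOA V) (n : nat)
  (U : lmodType F) (rho : V -> U -> U)
  (hU : An_module A n rho) (hnf : ~ factors_prev A n rho) :
  exists (MU : lmodType F) (YMU : int -> V -> MU -> MU) (grMU : int -> MU -> Prop)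
         (iota : U -> MU),
    Vmodule A YMU grMU /\
    (exists w, grMU 0 w /\ w <> 0) /\
    generated_by YMU (grMU n%:Z) /\
    An_iso_onto A rho YMU iota (grMU n%:Z) /\
        (* universal property *)
        (forall (M : lmodType F) (YM : int -> V -> M -> M) (phi : U -> M),
           weak_module A YM -> linmap phi -> (forall u, Omega A n YM (phi u)) ->
           (forall d a u, Vgr A d a -> phi (rho a u) = YM (d - 1) a (phi u)) ->
           (exists f, weak_hom YMU YM f /\ forall u, f (iota u) = phi u) /\
           (forall f g, weak_hom YMU YM f -> weak_hom YMU YM g ->
              (forall u, f (iota u) = phi u) -> (forall u, g (iota u) = phi u) ->
              forall w, f w = g w)) /\
        (* unique maximal submodule J with J \cap M(n) = 0, and the quotient *)
        let maxJ (J : MU -> Prop) :=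
          [/\ graded_sub YMU grMU J,
              (forall w, J w -> grMU n%:Z w -> w = 0)
            & (forall J', graded_sub YMU grMU J' ->
                 (forall w, J' w -> grMU n%:Z w -> w = 0) ->
                 (forall w, J w -> J' w) -> forall w, J' w -> J w)] in
        exists J, maxJ J /\ (forall J', maxJ J' -> forall w, J' w <-> J w) /\
          exists (L : lmodType F) (YL : int -> V -> L -> L) (grL : int -> L -> Prop)
                 (pi : MU -> L),
            Vmodule A YL grL /\
            (weak_hom YMU YL pi /\ (forall x, exists w, pi w = x)) /\
            ((forall m w, grMU m w -> grL m (pi w)) /\ (forall w, pi w = 0 <-> J w)) /\
            (exists psi : U -> L, An_iso_onto A rho YL psi (grL n%:Z)) /\
            (exists x, grL 0 x /\ x <> 0) /\
            (simple_An rho <-> irreducible YL grL).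
Proof.
have [cV [sV hcV]] := components_exist (VOA_graded A).
have [MU [YMU [grMU [iota [hM hgen hiso lift uniq_hom]]]]] := universal_module_exists hU hcV.
have [cM [sM hcM]] : exists cM sM, components grMU cM sM.
  by case: hM => _ hg _ _; exact: components_exist.
have low0 (W : lmodType F) (YW : int -> V -> W -> W) grW psi : Vmodule A YW grW ->
    An_iso_onto A rho YW psi (grW n%:Z) -> exists x, grW 0 x /\ x <> 0.
  move=> hW hpsi; apply: contrapT => H; apply: hnf.
  apply: (low_degree_zero_factors hU hW hpsi) => x gx.
  by apply: contrapT => nx; apply: H; exists x.
exists MU, YMU, grMU, iota; split=> //; split; first exact: low0 hM hiso.
do 2!split=> //; split.
  move=> M YM phi wM lphi hO hphi; split; first exact: lift.
  by move=> f g hf hg Ef Eg; apply: uniq_hom hf hg _ => u; rewrite Ef Eg.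
have Jsub := radical_sub n hM hcM.
have Jmax := radical_max hcM (n := n).
have Jtop w := @radical_top _ _ _ n _ _ _ hM _ _ hcM w.
exists (radical n YMU cM); split.
  by split=> [|w|J' sJ' J'0 _]; [exact: Jsub | exact: Jtop | exact: Jmax].
(* The radical contains every graded submodule avoiding degree $n$; a maximal one therefore equals
   it. *)
split=> [J' [sJ' J'0 maxJ'] w|].
  by split; [exact: Jmax | apply: maxJ' => // w'; exact: Jmax].
have [L [YL [grL [pi [hL hpi surj ker pgr]]]]] := quotient_Vmodule hM Jsub.
have qiso := quotient_iso hM hcM hiso hpi ker pgr.
exists L, YL, grL, pi; split=> //; split=> //; split.
  by split=> // m w gw; rewrite pgr; exists w.
split; first by exists (pi \o iota).
split; first exact: low0 hL qiso.
split; first exact: (simple_quotient_irreducible hU hM hgen hcM hiso hL hpi surj ker pgr).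
exact: (irreducible_quotient_simple hM hgen hcM hiso hL hpi surj ker pgr).
Qed.
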